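(* Let $A$ be one of the following connected graded algebras (all listed generators have degree $1$), and let $H$ be a Hopf algebra acting on $A$ such that the pair $(A,H)$ satisfies the standing hypotheses (i)--(iv) of the context. Then $H$ is a commutative group algebra. (1) $A=k_{p_{ij}}[t_1,t_2,t_3]$, generated by $t_1,t_2,t_3$ with relations $t_jt_i=p_{ij}t_it_j$ for $1\le i<j\le 3$ ($p_{ij}\in k^\times$, $p_{ji}:=p_{ij}^{-1}$), where none of the elements $p_{12}^{-2}p_{23}p_{31}$, $p_{31}^{-2}p_{12}p_{23}$, $p_{23}^{-2}p_{31}p_{12}$ is a root of unity. (A special case is when $p_{12}$ and $p_{13}$ are roots of unity and $p_{23}$ is not.) (2) $A$ generated by $t_1,t_2,t_3$ with relations $t_1t_2-t_2t_1=t_1t_3-t_3t_1=t_3t_2-pt_2t_3-t_1^2=0$, where $p\in k^\times$ is not a root of unity. (3) $A$ generated by $t_1,t_2,t_3$ with relations $(t_2+t_1)t_1-t_1t_2=t_3t_1-qt_1t_3=t_3t_2-q(t_2+t_1)t_3=0$, where $q\in k^\times$ is not a root of unity. (4) $A$ generated by $t_1,t_2,t_3$ with relations $(t_2+t_1)t_1-t_1t_2=t_3t_1-pt_1t_3=t_3t_2-pt_2t_3=0$, where $p\in k^\times$ is not a root of unity. (5) $A$ generated by $t_1,t_2,t_3$ with relations $(t_2+t_1)t_1-t_1t_2=(t_3+t_2+t_1)t_1-t_1t_3=(t_3+t_2+t_1)t_2-(t_2+t_1)t_3=0$. (6) $A=A(\alpha,\beta)$, the graded down-up algebra generated by $x,y$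 with relations $x^2y-\alpha xyx-\beta yx^2=xy^2-\alpha yxy-\beta y^2x=0$, where $\alpha\in k$, $\alpha\neq 0$, and $\beta\in k^\times$ is not a root of unity.
   Context: Throughout $k$ is an algebraically closed field of characteristic zero; all algebras and Hopf algebras are over $k$; $k^\times=k\setminus\{0\}$. A connected graded algebra is an $\mathbb N$-graded algebra $A=\bigoplus_{i\ge 0}A_i$ with $A_0=k$. It is Artin-Schelter (AS) regular if it has finite (graded) global dimension $d$, injective dimension $d$ on both sides, $\mathrm{Ext}^i_A(k,A)=\mathrm{Ext}^i_{A^{op}}(k,A)=0$ for $i\ne d$ where $k=A/A_{\ge1}$, and $\mathrm{Ext}^d_A(k,A)\cong k(l)\cong\mathrm{Ext}^d_{A^{op}}(k,A)$ for some integer $l$. All algebras listed in the claim are noetherian AS regular of global dimension three. Standing hypotheses on $(A,H)$: (i) $H$ is a finite dimensional Hopf algebra; (ii) $A$ is a connected graded AS regular algebra generated in degree $1$; (iii) $H$ acts on $A$ (i.e. $A$ is a left $H$-module algebra) inner faithfully, i.e. there is no nonzero Hopf ideal $I\subset H$ with $IA=0$; (iv) the $H$-action preserves the grading of $A$. ''$H$ is a commutative group algebra'' means $H\cong kG$ as Hopf algebras for some abelian group $G$. *)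

(* Defs.v *)
From HB Require Import structures.
From mathcomp Require Import all_boot all_order all_algebra all_fingroup all_field.
From mathcomp Require Import finmap monalg.

Set Implicit Arguments.
Unset Strict Implicit.
Unset Printing Implicit Defensive.

Import GRing.Theory.
Local Open Scope ring_scope.

(* The tensor product of two finite dimensional spaces is realised as the
   space of matrices of coordinates in the bases vbasis {:U} and vbasis {:V}.
   Maps out of it are given by tlift, the linear extension of a bilinear map
   (tlift_tens, tlift_unique). *)
Section Tensor.
Variable K : fieldType.

Definition tensor (U V : vectType K) : Type :=
  'M[K]_(\dim {:U}, \dim {:V}).
HB.instance Definition _ U V :=
  Vector.copy (tensor U V) 'M[K]_(\dim {:U}, \dim {:V}).

Definition tens (U V : vectType K) (u : U) (v : V) : tensor U V :=
  \matrix_(i, j) (coord (vbasis {:U}) i u * coord (vbasis {:V}) j v).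

Definition tlift (U V : vectType K) (X : lmodType K) (B : U -> V -> X)
    (M : tensor U V) : X :=
  \sum_(i < \dim {:U}) \sum_(j < \dim {:V})
    (M : 'M[K]_(_, _)) i j *: B (vbasis {:U})`_i (vbasis {:V})`_j.

Definition bilinear_map (U V X : lmodType K) (B : U -> V -> X) : Prop :=
  (forall u, linear (B u)) /\ (forall v, linear (B^~ v)).

Definition tensv (U V : vectType K) (U' : {vspace U}) (V' : {vspace V}) :
    {vspace tensor U V} :=
  <<[seq tens u v | u <- vbasis U', v <- vbasis V']>>%VS.

Lemma tens_bilinear (U V : vectType K) : bilinear_map (@tens U V).
Proof.
split=> [u a v w|v a u w]; apply/matrixP=> i j; rewrite !mxE linearP /=.
  by rewrite mulrDr mulrCA.
by rewrite mulrDl mulrA.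
Qed.

Lemma tlift_linear (U V : vectType K) (X : lmodType K) (B : U -> V -> X) :
  linear (tlift B).
Proof.
move=> a M N; rewrite /tlift scaler_sumr -big_split; apply: eq_bigr => i _ /=.
rewrite scaler_sumr -big_split; apply: eq_bigr => j _ /=.
by rewrite !mxE scalerDl scalerA.
Qed.

HB.instance Definition _ (U V : vectType K) (X : lmodType K) (B : U -> V -> X) :=
  GRing.isLinear.Build K (tensor U V) X _ (tlift B) (tlift_linear B).

Lemma linear_comb (U X : lmodType K) (f : U -> X) (I : Type) (r : seq I)
    (a : I -> K) (u : I -> U) :
  linear f -> f (\sum_(i <- r) a i *: u i) = \sum_(i <- r) a i *: f (u i).
Proof.
move=> lf; elim: r => [|i r IHr]; last by rewrite !big_cons lf IHr.
have := lf (- 1) 0 0; rewrite !big_nil scaler0 addr0 => /eqP.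
by rewrite scaleN1r addNr => /eqP.
Qed.

Lemma bilinear_comb (U V X : lmodType K) (B : U -> V -> X) (I J : Type)
    (r : seq I) (s : seq J) (a : I -> K) (b : J -> K) (u : I -> U) (v : J -> V) :
  bilinear_map B ->
  B (\sum_(i <- r) a i *: u i) (\sum_(j <- s) b j *: v j) =
  \sum_(i <- r) \sum_(j <- s) (a i * b j) *: B (u i) (v j).
Proof.
case=> Br Bl; rewrite (linear_comb r a u (Bl _)); apply: eq_bigr => i _.
rewrite (linear_comb s b v (Br _)) scaler_sumr.
by apply: eq_bigr => j _; rewrite scalerA.
Qed.

Lemma tlift_param_linear (U V : vectType K) (W X : lmodType K)
    (B : W -> U -> V -> X) (M : tensor U V) :
  (forall u v, linear (fun w => B w u v)) -> linear (fun w => tlift (B w) M).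
Proof.
move=> BL a w w'; rewrite /tlift scaler_sumr -big_split; apply: eq_bigr => i _.
rewrite scaler_sumr -big_split; apply: eq_bigr => j _ /=.
by rewrite BL scalerDr !scalerA mulrC.
Qed.

Lemma tlift_tens (U V : vectType K) (X : lmodType K) (B : U -> V -> X) u v :
  bilinear_map B -> tlift B (tens u v) = B u v.
Proof.
move=> BB; rewrite {2}(coord_vbasis (memvf u)) {2}(coord_vbasis (memvf v)).
rewrite bilinear_comb //; apply: eq_bigr => i _; apply: eq_bigr => j _.
by rewrite mxE.
Qed.

Lemma tlift_id (U V : vectType K) (M : tensor U V) : tlift (@tens U V) M = M.
Proof.
apply/matrixP=> i j; rewrite summxE (bigD1 i) //= summxE (bigD1 j) //= !mxE.
have fr (W : vectType K) : free (vbasis {:W}) := basis_free (vbasisP _).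
rewrite !(coord_free _ _ (fr _)) !eqxx !mulr1 big1 ?addr0 => [|j' ne].
  rewrite big1 ?addr0 // => i' ne; rewrite summxE big1 // => j' _.
  by rewrite !mxE !(coord_free _ _ (fr _)) (negPf ne) mul0r mulr0.
by rewrite !mxE !(coord_free _ _ (fr _)) (negPf ne) !mulr0.
Qed.

Lemma tlift_unique (U V : vectType K) (X : lmodType K)
    (f : {linear tensor U V -> X}) (B : U -> V -> X) :
  (forall u v, f (tens u v) = B u v) -> f =1 tlift B.
Proof.
move=> fB M; rewrite -{1}(tlift_id M) /tlift linear_sum; apply: eq_bigr => i _.
by rewrite linear_sum; apply: eq_bigr => j _; rewrite linearZ /= fB.
Qed.

End Tensor.

(* Product of the algebra H (x) H : (a (x) b) (c (x) d) = ac (x) bd. *)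
Definition tmul (K : fieldType) (H : falgType K) (M N : tensor H H) :
    tensor H H :=
  tlift (fun a b => tlift (fun c d => tens (a * c) (b * d)) N) M.

HB.mixin Record Falgebra_isHopf (K : fieldType) H of Falgebra K H := {
  comul : {linear H -> tensor H H};
  counit : {scalar H};
  antipode : {linear H -> H};
  comulA : forall h : H,
    tlift (fun a b => tlift (fun a1 a2 => tens a1 (tens a2 b)) (comul a))
      (comul h)
    = tlift (fun a b => tens a (comul b)) (comul h);
  counitl : forall h : H, tlift (fun a b => counit a *: b) (comul h) = h;
  counitr : forall h : H, tlift (fun a b => counit b *: a) (comul h) = h;
  comul1 : comul 1 = tens 1 1;
  comulM : forall g h : H, comul (g * h) = tmul (comul g) (comul h);
  counit1 : counit 1 = 1;
  counitM : forall g h : H, counit (g * h) = counit g * counit h;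
  antipodel : forall h : H,
    tlift (fun a b => antipode a * b) (comul h) = counit h *: 1;
  antipoder : forall h : H,
    tlift (fun a b => a * antipode b) (comul h) = counit h *: 1
}.

#[short(type="fdHopfType")]
HB.structure Definition FdHopf (K : fieldType) :=
  { H of Falgebra_isHopf K H & Falgebra K H }.

Record hopf_ideal (K : fieldType) (H : fdHopfType K) (I : {vspace H}) : Prop :=
  HopfIdeal {
    hopf_ideal_l : forall g h, h \in I -> g * h \in I;
    hopf_ideal_r : forall g h, h \in I -> h * g \in I;
    hopf_ideal_comul : forall h, h \in I ->
      comul h \in (tensv I {:H} + tensv {:H} I)%VS;
    hopf_ideal_counit : forall h, h \in I -> counit h = 0;
    hopf_ideal_antipode : forall h, h \in I -> antipode h \in I
  }.

Definition hopf_isomorphic (K : fieldType) (H H' : fdHopfType K) : Prop :=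
  exists2 f : {lrmorphism H -> H'}, bijective f &
    [/\ forall h, comul (f h) = tlift (fun a b => tens (f a) (f b)) (comul h),
        forall h, counit (f h) = counit h
      & forall h, antipode (f h) = f (antipode h)].

Section GroupAlgebra.
Variables (K : fieldType) (gT : finGroupType).

Definition group_algebra : Type := {ffun gT -> K}.
HB.instance Definition _ := Vector.copy group_algebra {ffun gT -> K^o}.

Implicit Types f g h : group_algebra.

Definition gelt (x : gT) : group_algebra := [ffun y => (y == x)%:R].

Definition gmul f g : group_algebra :=
  [ffun x => \sum_(y : gT) f y * g (y^-1 * x)%g].


Lemma gmulA : associative gmul.
Proof.
move=> f g h; apply/ffunP=> x; rewrite !ffunE.
under eq_bigr do rewrite ffunE mulr_sumr.
under [RHS]eq_bigr do rewrite ffunE mulr_suml.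
rewrite [RHS]exchange_big; apply: eq_bigr => y _ /=.
rewrite (reindex_inj (mulgI y^-1%g)); apply: eq_bigr => z _ /=.
by rewrite invMg invgK mulrA -!mulgA mulKVg.
Qed.

Lemma gmul1f : left_id (gelt 1%g) gmul.
Proof.
move=> f; apply/ffunP=> x; rewrite ffunE (bigD1 1%g) //= big1 => [|y ne].
  by rewrite ffunE eqxx mul1r invg1 mul1g addr0.
by rewrite ffunE (negPf ne) mul0r.
Qed.

Lemma gmulf1 : right_id (gelt 1%g) gmul.
Proof.
move=> f; apply/ffunP=> x; rewrite ffunE (bigD1 x) //= big1 => [|y ne].
  by rewrite ffunE mulVg eqxx mulr1 addr0.
by rewrite ffunE -eq_mulVg1 (negPf ne) mulr0.
Qed.

Lemma gmulDl : left_distributive gmul +%R.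
Proof.
move=> f g h; apply/ffunP=> x; rewrite !ffunE -big_split; apply: eq_bigr => y _.
by rewrite ffunE mulrDl.
Qed.

Lemma gmulDr : right_distributive gmul +%R.
Proof.
move=> f g h; apply/ffunP=> x; rewrite !ffunE -big_split; apply: eq_bigr => y _.
by rewrite ffunE mulrDr.
Qed.

Lemma gelt1_neq0 : gelt 1%g != 0.
Proof. by apply/eqP=> /ffunP/(_ 1%g)/eqP; rewrite !ffunE eqxx oner_eq0. Qed.

HB.instance Definition _ := GRing.Zmodule_isNzRing.Build group_algebra
  gmulA gmul1f gmulf1 gmulDl gmulDr gelt1_neq0.

Lemma gscaleAl (a : K) f g : a *: (f * g) = (a *: f) * g.
Proof.
apply/ffunP=> x; rewrite !ffunE /= -[LHS]/(_ * _) mulr_sumr.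
by apply: eq_bigr => y _; rewrite ffunE mulrA.
Qed.

HB.instance Definition _ :=
  GRing.Lmodule_isLalgebra.Build K group_algebra gscaleAl.

Lemma gscaleAr (a : K) f g : a *: (f * g) = f * (a *: g).
Proof.
apply/ffunP=> x; rewrite !ffunE /= -[LHS]/(_ * _) mulr_sumr.
by apply: eq_bigr => y _; rewrite ffunE mulrCA.
Qed.

HB.instance Definition _ :=
  GRing.Lalgebra_isAlgebra.Build K group_algebra gscaleAr.
HB.instance Definition _ := Algebra_isFalgebra.Build K group_algebra.

Lemma gsum f : f = \sum_x f x *: gelt x.
Proof.
apply/ffunP=> y; rewrite sum_ffunE (bigD1 y) //= big1 => [|x ne].
  by rewrite !ffunE eqxx addr0 -[RHS]/(_ * _) mulr1.
by rewrite !ffunE eq_sym (negPf ne) -[LHS]/(_ * _) mulr0.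
Qed.

Lemma geltM x y : gelt (x * y)%g = gelt x * gelt y.
Proof.
apply/ffunP=> z; rewrite !ffunE (bigD1 x) //= big1 => [|t ne].
  rewrite !ffunE eqxx mul1r addr0; congr (_%:R); congr nat_of_bool.
  by apply/eqP/eqP => [->|<-]; rewrite ?mulKg ?mulKVg.
by rewrite !ffunE (negPf ne) mul0r.
Qed.

Definition gcomul f : tensor group_algebra group_algebra :=
  \sum_x f x *: tens (gelt x) (gelt x).
Definition gcounit f : K := \sum_x f x.
Definition gantipode f : group_algebra := [ffun x => f x^-1%g].

Lemma gcomul_linear : linear gcomul.
Proof.
move=> a f g; rewrite scaler_sumr -big_split; apply: eq_bigr => x _ /=.
by rewrite !ffunE scalerDl scalerA.
Qed.

Lemma gcounit_scalar : scalar gcounit.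
Proof.
by move=> a f g; rewrite mulr_sumr -big_split; apply: eq_bigr => x _; rewrite !ffunE.
Qed.

Lemma gantipode_linear : linear gantipode.
Proof. by move=> a f g; apply/ffunP=> x; rewrite !ffunE. Qed.

HB.instance Definition _ := GRing.isLinear.Build K group_algebra
  (tensor group_algebra group_algebra) _ gcomul gcomul_linear.
HB.instance Definition _ := GRing.isLinear.Build K group_algebra
  K _ gcounit gcounit_scalar.
HB.instance Definition _ := GRing.isLinear.Build K group_algebra
  group_algebra _ gantipode gantipode_linear.

Lemma gcomulE x : gcomul (gelt x) = tens (gelt x) (gelt x).
Proof.
rewrite /gcomul (bigD1 x) //= big1 => [|y ne]; rewrite ffunE.
  by rewrite eqxx scale1r addr0.
by rewrite (negPf ne) scale0r.
Qed.

Lemma gcounitE x : gcounit (gelt x) = 1.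
Proof.
rewrite /gcounit (bigD1 x) //= big1 => [|y ne]; rewrite ffunE.
  by rewrite eqxx addr0.
by rewrite (negPf ne).
Qed.

Lemma gantipodeE x : gantipode (gelt x) = gelt x^-1%g.
Proof.
by apply/ffunP=> y; rewrite !ffunE -(inj_eq (@invg_inj gT)) invgK.
Qed.

Lemma glift (X : lmodType K) (B : group_algebra -> group_algebra -> X) f :
  bilinear_map B ->
  tlift B (gcomul f) = \sum_x f x *: B (gelt x) (gelt x).
Proof.
move=> BB; rewrite linear_sum; apply: eq_bigr => x _.
by rewrite linearZ /= tlift_tens.
Qed.

Lemma gcomulA f :
  tlift (fun a b => tlift (fun a1 a2 => tens a1 (tens a2 b)) (gcomul a))
    (gcomul f)
  = tlift (fun a b => tens a (gcomul b)) (gcomul f).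
Proof.
have tr (U V : vectType K) (u : U) := (tens_bilinear U V).1 u.
have tl (U V : vectType K) (v : V) := (tens_bilinear U V).2 v.
rewrite !glift; first 1 last.
- by split=> [a c b b'|b c a a']; rewrite ?linearP ?tr //= tl.
- split=> [a|b c a a']; last by rewrite !linearP.
  by apply: tlift_param_linear => a1 a2 c b b'; rewrite !tr.
apply: eq_bigr => x _; rewrite gcomulE tlift_tens //.
by split=> [a c b b'|b c a a']; rewrite ?tl ?tr.
Qed.

Lemma gcounitl f : tlift (fun a b => gcounit a *: b) (gcomul f) = f.
Proof.
rewrite glift; first by rewrite [RHS]gsum; apply: eq_bigr => x _; rewrite gcounitE scale1r.
split=> [a c b b'|b c a a']; first by rewrite scalerDr !scalerA mulrC.
by rewrite linearP /= scalerDl scalerA.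
Qed.

Lemma gcounitr f : tlift (fun a b => gcounit b *: a) (gcomul f) = f.
Proof.
rewrite glift; first by rewrite [RHS]gsum; apply: eq_bigr => x _; rewrite gcounitE scale1r.
split=> [a c b b'|b c a a']; last by rewrite scalerDr !scalerA mulrC.
by rewrite linearP /= scalerDl scalerA.
Qed.

Lemma gmul_bilinear : bilinear_map (fun f g => f * g).
Proof.
split=> [f a g h|g a f h]; first by rewrite mulrDr scalerAr.
by rewrite mulrDl scalerAl.
Qed.

Lemma gmulE f g : f * g = \sum_x \sum_y (f x * g y) *: gelt (x * y)%g.
Proof.
rewrite {1}(gsum f) {1}(gsum g) (bilinear_comb _ _ _ _ _ _ gmul_bilinear).
by apply: eq_bigr => x _; apply: eq_bigr => y _; rewrite geltM.
Qed.

Lemma gcomulM f g : gcomul (f * g) = tmul (gcomul f) (gcomul g).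
Proof.
have tr (U V : vectType K) (u : U) := (tens_bilinear U V).1 u.
have tl (U V : vectType K) (v : V) := (tens_bilinear U V).2 v.
have [mr ml] := gmul_bilinear.
rewrite gmulE linear_sum /tmul glift; last first.
  split=> [a|b]; apply: tlift_param_linear => c d e u v.
    by rewrite ml tr.
  by rewrite ml tl.
apply: eq_bigr => x _; rewrite linear_sum glift; last first.
  by split=> [a c b b'|b c a a']; rewrite mr ?tr ?tl.
rewrite scaler_sumr; apply: eq_bigr => y _.
by rewrite linearZ /= gcomulE scalerA geltM.
Qed.

Lemma gcounitM f g : gcounit (f * g) = gcounit f * gcounit g.
Proof.
rewrite gmulE linear_sum /= mulr_suml; apply: eq_bigr => x _.
rewrite linear_sum mulr_sumr; apply: eq_bigr => y _.
by rewrite linearZ /= gcounitE mulr1.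
Qed.

Lemma gantipodel f :
  tlift (fun a b => gantipode a * b) (gcomul f) = gcounit f *: 1.
Proof.
have [mr ml] := gmul_bilinear.
rewrite glift; last by split=> [a c b b'|b c a a']; rewrite ?linearP ?mr ?ml.
rewrite scaler_suml; apply: eq_bigr => x _.
by rewrite gantipodeE -geltM mulVg.
Qed.

Lemma gantipoder f :
  tlift (fun a b => a * gantipode b) (gcomul f) = gcounit f *: 1.
Proof.
have [mr ml] := gmul_bilinear.
rewrite glift; last by split=> [a c b b'|b c a a']; rewrite ?linearP ?mr ?ml.
rewrite scaler_suml; apply: eq_bigr => x _.
by rewrite gantipodeE -geltM mulgV.
Qed.

HB.instance Definition _ := Falgebra_isHopf.Build K group_algebra
  gcomulA gcounitl gcounitr (gcomulE 1%g) gcomulM (gcounitE 1%g) gcounitM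
  gantipodel gantipoder.

End GroupAlgebra.

(* A finite dimensional group algebra has a finite group. *)
Definition commutative_group_algebra (K : fieldType) (H : fdHopfType K) : Prop :=
  exists gT : finGroupType,
    abelian [set: gT] /\ hopf_isomorphic H (group_algebra K gT).

Section Presentation.
Variable K : fieldType.

Definition free_algebra (n : nat) : lalgType K := {malg K[{fmonom 'I_n}]}.

Definition fgen (n : nat) (i : 'I_n) : free_algebra n := << fmu i >>.

Definition feval (A : algType K) (n : nat) (t : 'I_n -> A) (p : free_algebra n) : A :=
  mmap (in_alg A) (fun w : {fmonom 'I_n} => \prod_(i <- w) t i) p.

Definition two_sided_ideal (n : nat) (J : free_algebra n -> Prop) : Prop :=
  [/\ J 0, forall p q, J p -> J q -> J (p + q)
    & forall p q r, J q -> J (p * q * r)].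

Definition ideal_generated (n : nat) (rels : seq (free_algebra n))
    (p : free_algebra n) : Prop :=
  forall J, two_sided_ideal J -> (forall r, r \in rels -> J r) -> J p.

(* A is the quotient of the free algebra by the ideal generated by rels,
   with t i the class of the i-th free generator. *)
Definition presented_by (A : algType K) (n : nat) (t : 'I_n -> A)
    (rels : seq (free_algebra n)) : Prop :=
  (forall a, exists p, feval t p = a) /\
  (forall p, feval t p = 0 <-> ideal_generated rels p).

(* The degree d component of the grading with all t i in degree 1. *)
Definition graded_piece (A : algType K) (n : nat) (t : 'I_n -> A) (d : nat)
    (a : A) : Prop :=
  exists2 p : free_algebra n,
    (forall w, w \in msupp p -> fdeg w = d) & feval t p = a.

Definition root_of_unity (z : K) : Prop := exists2 n, (0 < n)%N & n.-unity_root z.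

Local Notation t1 := (fgen (@Ordinal 3 0 isT)).
Local Notation t2 := (fgen (@Ordinal 3 1 isT)).
Local Notation t3 := (fgen (@Ordinal 3 2 isT)).
Local Notation x := (fgen (@Ordinal 2 0 isT)).
Local Notation y := (fgen (@Ordinal 2 1 isT)).

(* These are the relations of noetherian AS regular algebras of global
   dimension three generated in degree 1, so AS regularity of a presented
   algebra is not a separate hypothesis. *)
Inductive listed_relations : forall n : nat, seq (free_algebra n) -> Prop :=
| SkewPolynomial (p12 p13 p23 : K) (p31 := p13^-1) :
    p12 != 0 -> p13 != 0 -> p23 != 0 ->
    ~ root_of_unity (p12 ^- 2 * p23 * p31) ->
    ~ root_of_unity (p31 ^- 2 * p12 * p23) ->
    ~ root_of_unity (p23 ^- 2 * p31 * p12) ->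
    listed_relations
      [:: t2 * t1 - p12 *: (t1 * t2);
          t3 * t1 - p13 *: (t1 * t3);
          t3 * t2 - p23 *: (t2 * t3)]
| CentralSquare (p : K) :
    p != 0 -> ~ root_of_unity p ->
    listed_relations
      [:: t1 * t2 - t2 * t1;
          t1 * t3 - t3 * t1;
          t3 * t2 - p *: (t2 * t3) - t1 ^+ 2]
| JordanTwisted (q : K) :
    q != 0 -> ~ root_of_unity q ->
    listed_relations
      [:: (t2 + t1) * t1 - t1 * t2;
          t3 * t1 - q *: (t1 * t3);
          t3 * t2 - q *: ((t2 + t1) * t3)]
| JordanScaled (p : K) :
    p != 0 -> ~ root_of_unity p ->
    listed_relations
      [:: (t2 + t1) * t1 - t1 * t2;
          t3 * t1 - p *: (t1 * t3);
          t3 * t2 - p *: (t2 * t3)]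
| JordanFull :
    listed_relations
      [:: (t2 + t1) * t1 - t1 * t2;
          (t3 + t2 + t1) * t1 - t1 * t3;
          (t3 + t2 + t1) * t2 - (t2 + t1) * t3]
| DownUp (a b : K) :
    a != 0 -> b != 0 -> ~ root_of_unity b ->
    listed_relations
      [:: x ^+ 2 * y - a *: (x * y * x) - b *: (y * x ^+ 2);
          x * y ^+ 2 - a *: (y * x * y) - b *: (y ^+ 2 * x)].

End Presentation.

Section Action.
Variables (K : fieldType) (H : fdHopfType K) (A : algType K).

Record module_algebra (act : H -> A -> A) : Prop := ModuleAlgebra {
  mact_bilinear : bilinear_map act;
  mact1 : forall a, act 1 a = a;
  mactM : forall g h a, act (g * h) a = act g (act h a);
  mact_unit : forall h, act h 1 = counit h *: 1;
  mact_mul : forall h a b,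
    act h (a * b) = tlift (fun h1 h2 => act h1 a * act h2 b) (comul h)
}.

Definition inner_faithful (act : H -> A -> A) : Prop :=
  forall I : {vspace H}, hopf_ideal I ->
    (forall h a, h \in I -> act h a = 0) -> I = 0%VS.

Definition preserves_grading (act : H -> A -> A) (n : nat) (t : 'I_n -> A) : Prop :=
  forall d h a, graded_piece t d a -> graded_piece t d (act h a).

End Action.

(* Main.v *)
Require Import Defs.
From HB Require Import structures.
From mathcomp Require Import all_boot all_order all_algebra all_fingroup all_field.
From mathcomp Require Import finmap monalg.
From mathcomp Require Import ring.

Set Implicit Arguments.
Unset Strict Implicit.
Unset Printing Implicit Defensive.

Import GRing.Theory.
Local Open Scope ring_scope.

(* The defining relations are, up to a change of basis, the left derivatives of a twisted
   superpotential w: moving the first letter of w to its end changes w by a matrix mu.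
   Moreover w is determined up to a scalar by having the relations as both left and right
   derivatives, so the coaction u of H^* on the generators rescales w by a character of H;
   reading off both ends of w shows that mu intertwines the square of the antipode with
   conjugation by that character.  By Radford's formula the square of the antipode has
   finite order, and so has the character; hence a positive power of mu commutes with u.

   In the listed algebras every positive power of mu has distinct eigenvalues or
   nontrivial Jordan blocks.  This makes u triangular, and the remaining off-diagonal
   entries of u are skew-primitive elements of H^* relative to a single group-like element,
   which vanish in characteristic zero.  The diagonal entries are characters of H; they
   commute because of the relations, and their products separate the points of H by inner
   faithfulness.  So H is commutative, and translating by these characters gives commuting
   operators of finite order, whose common eigenvectors form a basis of H made of
   group-like elements up to scalars. *)

(** * The dual algebra *)

(** The obstacle is that $H$ is not known to be semisimple, commutative or cocommutative, so that at
    first nothing is known about the matrix $u$ of its action on the generators; only $\mu$ is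
    explicit. The relation that constrains $u$ reads $\mu\,S^2(u) = (d\,u\,d^{-1})\,\mu$, with
    products in the dual of $H$ and $d$ the character that rescales $w$. In it $\mu$ plays the part
    of the Nakayama automorphism of $A$ and $d$ that of the homological codeterminant, but both come
    out of linear algebra in the degree of $w$, without Ext groups. Iterating the relation removes
    the two twists at the price of an unspecified exponent: only some $\mu^m$ is known to commute
    with $u$. This is where the excluded roots of unity matter. Up to inversion, the quotients of
    distinct eigenvalues of $\mu$ are positive powers of the excluded scalars, so they stay
    different from 1 after raising to the power $m$. In a Jordan block the power $m$ multiplies the
    superdiagonal by $m$ and an invertible factor, which is harmless in characteristic zero. *)

Section Dual.
Variables (K : fieldType) (H : fdHopfType K).

(** A type of its own, to carry the convolution product. *)
Definition hdual : Type := 'Hom(H, K^o).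
HB.instance Definition _ := Vector.copy hdual 'Hom(H, K^o).
Implicit Types (f g : hdual) (x y z : H).

Definition ev f x : K := (f : 'Hom(H, K^o)) x.

Lemma evP f a x y : ev f (a *: x + y) = a * ev f x + ev f y.
Proof. by rewrite /ev linearP. Qed.

HB.instance Definition _ f :=
  GRing.isLinear.Build K H K *%R (ev f) (evP f).

Lemma evDl f g x : ev (f + g) x = ev f x + ev g x.
Proof. by rewrite /ev lfunE. Qed.

Lemma evZl a f x : ev (a *: f) x = a * ev f x.
Proof. by rewrite /ev lfunE. Qed.

Lemma evPl a f g x : ev (a *: f + g) x = a * ev f x + ev g x.
Proof. by rewrite evDl evZl. Qed.

Lemma hdualP f g : (forall x, ev f x = ev g x) -> f = g.
Proof. by move=> e; apply/lfunP. Qed.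

Definition mkdual (f : {scalar H}) : hdual := linfun (f : {linear H -> K^o}).

Lemma mkdualE (f : {scalar H}) x : ev (mkdual f) x = f x.
Proof. by rewrite /ev lfunE. Qed.

Definition hbasis (i : 'I_(\dim {:H})) : H := (vbasis {:H})`_i.
Definition hcoord (i : 'I_(\dim {:H})) : hdual :=
  mkdual (coord (vbasis {:H}) i : {scalar H}).

Lemma hcoordE x : x = \sum_i ev (hcoord i) x *: hbasis i.
Proof.
rewrite {1}(coord_vbasis (memvf x)); apply: eq_bigr => i _.
by rewrite mkdualE.
Qed.

Lemma ev_inj x y : (forall f, ev f x = ev f y) -> x = y.
Proof.
by move=> e; rewrite (hcoordE x) (hcoordE y); apply: eq_bigr => i _; rewrite e.
Qed.

Definition hcounit : hdual := mkdual (@counit K H : {scalar H}).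

Lemma ev_counit x : ev hcounit x = counit x.
Proof. exact: mkdualE. Qed.

End Dual.

(** * Linearity of expressions in Sweedler notation *)

Section Linearity.
Variables (K : fieldType).

Lemma lin_id (U : lmodType K) : linear (fun x : U => x).
Proof. by []. Qed.

Lemma lin_comp (U V W : lmodType K) (f : V -> W) (g : U -> V) :
  linear f -> linear g -> linear (fun x => f (g x)).
Proof. by move=> lf lg a x y; rewrite lg lf. Qed.

Lemma lin_ev (H : fdHopfType K) (U V : lmodType K) (f : hdual H) (g : U -> H) (v : V) :
  linear g -> linear (fun x => ev f (g x) *: v).
Proof. by move=> lg a x y; rewrite lg linearP scalerDl scalerA. Qed.

Lemma lin_evl (H : fdHopfType K) (U V : lmodType K) (f : U -> hdual H) (x : H) (v : V) :
  linear f -> linear (fun u => ev (f u) x *: v).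
Proof. by move=> lg a u w; rewrite lg evPl scalerDl scalerA. Qed.

Lemma lin_counit (H : fdHopfType K) (U V : lmodType K) (g : U -> H) (v : V) :
  linear g -> linear (fun x => counit (g x) *: v).
Proof. by move=> lg a x y; rewrite lg linearP scalerDl scalerA. Qed.

Lemma lin_scale (U V : lmodType K) c (g : U -> V) :
  linear g -> linear (fun x => c *: g x).
Proof. by move=> lg a x y; rewrite lg scalerDr !scalerA mulrC. Qed.

Lemma lin_mull (A : algType K) (U : lmodType K) (g : U -> A) b :
  linear g -> linear (fun x => g x * b).
Proof. by move=> lg a x y; rewrite lg mulrDl scalerAl. Qed.

Lemma lin_mulr (A : algType K) (U : lmodType K) (g : U -> A) b :
  linear g -> linear (fun x => b * g x).
Proof. by move=> lg a x y; rewrite lg mulrDr scalerAr. Qed.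

Lemma lin_tlift (U V : vectType K) (W X : lmodType K) (B : U -> V -> X)
    (g : W -> tensor U V) :
  linear g -> linear (fun w => tlift B (g w)).
Proof. by move=> lg a x y; rewrite lg linearP. Qed.

Lemma lin_tensl (U V : vectType K) (W : lmodType K) (g : W -> U) (v : V) :
  linear g -> linear (fun w => tens (g w) v).
Proof. by move=> lg a x y; rewrite lg (tens_bilinear U V).2. Qed.

Lemma lin_tensr (U V : vectType K) (W : lmodType K) (g : W -> V) (u : U) :
  linear g -> linear (fun w => tens u (g w)).
Proof. by move=> lg a x y; rewrite lg (tens_bilinear U V).1. Qed.

(** Sweedler notation: [sw B x] stands for $\sum B(x_{(1)}, x_{(2)})$. *)
Definition sw (H : fdHopfType K) (X : lmodType K) (B : H -> H -> X) (x : H) : X :=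
  tlift B (comul x).

Lemma lin_sw (H : fdHopfType K) (U X : lmodType K) (B : H -> H -> X) (g : U -> H) :
  linear g -> linear (fun u => sw B (g u)).
Proof. by move=> lg a x y; rewrite /sw lg !linearP. Qed.

Lemma lin_swl (H : fdHopfType K) (U X : lmodType K) (B : U -> H -> H -> X) (x : H) :
  (forall a b, linear (fun u => B u a b)) -> linear (fun u => sw (B u) x).
Proof. exact: tlift_param_linear. Qed.

Lemma lin_linear (U V : lmodType K) (f : {linear U -> V}) : linear f.
Proof. exact: linearP. Qed.

End Linearity.

Ltac lin_hyp := first [assumption | match goal with h : _ |- _ => exact: h end].

Ltac lin :=
  lazymatch goal with
  | |- bilinear_map _ => split=> ?; lin
  | |- forall _, _ => move=> ?; lin
  | |- linear ( *%R _) => apply: (@lin_mulr _ _ _ (fun u => u)); lin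
  | |- linear ( *:%R _) => apply: (@lin_scale _ _ _ _ (fun u => u)); lin
  | |- linear (tens _) => apply: (@lin_tensr _ _ _ _ (fun u => u)); lin
  | |- linear (sw _) => apply: (@lin_sw _ _ _ _ _ (fun u => u)); lin
  | |- linear (fun x => sw _ _) =>
      first [ apply: lin_sw; lin | apply: lin_swl => ? ?; lin ]
  | |- linear (fun x => tlift _ _) =>
      first [ apply: lin_tlift; lin | apply: tlift_param_linear => ? ?; lin ]
  | |- linear (fun x => tens _ _) =>
      first [ apply: lin_tensl; lin | apply: lin_tensr; lin ]
  | |- linear (fun x => _ *: _) =>
      first [ apply: lin_ev; lin | apply: lin_evl; lin | apply: lin_counit; lin
            | apply: lin_scale; lin ]
  | |- linear (fun x => _ * _) =>
      first [ apply: lin_mull; lin | apply: lin_mulr; lin ]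
  | |- linear (fun x => x) => exact: lin_id
  | |- linear (fun x => GRing.Linear.sort ?f (@?g x)) =>
      apply: (@lin_comp _ _ _ _ (GRing.Linear.sort f) g); [exact: lin_linear | lin]
  (* One of the two arguments has to be constant in [x]; its value is recovered by evaluating it at
     0. *)
  | |- linear (fun x => ?f (@?h x) (@?g x)) =>
      first [ apply: (@lin_comp _ _ _ _ (f (h 0)) g); [lin_hyp | lin]
            | apply: (@lin_comp _ _ _ _ (fun u => f u (g 0)) h); [lin_hyp | lin] ]
  | |- linear (fun x => ?f (@?g x)) =>
      apply: (@lin_comp _ _ _ _ f g); [first [lin_hyp | exact: lin_linear | solve [lin]] | lin]
  | |- linear _ => first [assumption | exact: lin_linear | match goal with h : _ |- _ => apply: h end]
  end.

Section Sweedler.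
Variables (K : fieldType) (H : fdHopfType K).
Implicit Types (x y z : H) (X Y : lmodType K).

Lemma lin0 (U X : lmodType K) (f : U -> X) : linear f -> f 0 = 0.
Proof. by move=> lf; have := lf (-1) 0 0; rewrite !scaleN1r oppr0 addr0 addNr. Qed.

Lemma linZ (U X : lmodType K) (f : U -> X) c u : linear f -> f (c *: u) = c *: f u.
Proof. by move=> lf; rewrite -[c *: u]addr0 lf (lin0 lf) addr0. Qed.

Lemma eq_sw X (B C : H -> H -> X) x : (forall a b, B a b = C a b) -> sw B x = sw C x.
Proof.
by move=> e; apply: eq_bigr => i _; apply: eq_bigr => j _; rewrite e.
Qed.

Lemma sw_linear X Y (f : X -> Y) (B : H -> H -> X) x :
  linear f -> f (sw B x) = sw (fun a b => f (B a b)) x.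
Proof.
move=> lf; pose F := GRing.isLinear.Build K X Y *:%R f lf.
pose f' : {linear X -> Y} := HB.pack f F.
rewrite -[f]/(f' : X -> Y) /sw /tlift linear_sum; apply: eq_bigr => i _.
by rewrite linear_sum; apply: eq_bigr => j _; rewrite linearZ.
Qed.

(** Coassociativity is an equation in $H \otimes (H \otimes H)$. The map [T] is the linear map that
    the trilinear [B] induces there, and it is applied to both sides. *)
Lemma sw_assoc X (B : H -> H -> H -> X) x :
  (forall b c, linear (fun a => B a b c)) -> (forall a c, linear (fun b => B a b c)) ->
  (forall a b, linear (B a b)) ->
  sw (fun a c => sw (fun a1 a2 => B a1 a2 c) a) x =
  sw (fun a b => sw (fun b1 b2 => B a b1 b2) b) x.
Proof.
move=> B1 B2 B3.
have B23 a : bilinear_map (B a) by split.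
pose T (M : tensor H (tensor H H)) : X := tlift (fun a N => tlift (B a) N) M.
have TT a N : T (tens a N) = tlift (B a) N.
  rewrite /T tlift_tens //; split=> [u|v]; first by lin.
  by apply: tlift_param_linear.
have := congr1 T (comulA x).
have lT : linear T by move=> a M N; rewrite /T linearP.
rewrite -!/(sw _ x) !sw_linear // => e.
transitivity (sw (fun a b : H => T (sw (fun a1 a2 : H => tens a1 (tens a2 b)) a)) x).
  apply: eq_sw => a b; rewrite sw_linear //; apply: eq_sw => a1 a2.
  by rewrite TT tlift_tens.
by rewrite [LHS]e; apply: eq_sw => a b; rewrite TT.
Qed.

Lemma sw_counitl X (f : H -> X) x :
  linear f -> sw (fun a b => counit a *: f b) x = f x.
Proof.
move=> lf; rewrite -{2}(counitl x) -/(sw _ x) sw_linear //.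
by apply: eq_sw => a b; rewrite linZ.
Qed.

Lemma sw_counitr X (f : H -> X) x :
  linear f -> sw (fun a b => counit b *: f a) x = f x.
Proof.
move=> lf; rewrite -{2}(counitr x) -/(sw _ x) sw_linear //.
by apply: eq_sw => a b; rewrite linZ.
Qed.

Lemma sw1 X (B : H -> H -> X) : bilinear_map B -> sw B 1 = B 1 1.
Proof. by move=> BB; rewrite /sw comul1 tlift_tens. Qed.

Lemma swM X (B : H -> H -> X) x y : bilinear_map B ->
  sw B (x * y) = sw (fun a b => sw (fun c d => B (a * c) (b * d)) y) x.
Proof.
move=> BB; have [B1 B2] := BB; have lT : linear (tlift B) by move=> a M N; rewrite linearP.
rewrite {1}/sw comulM /tmul -/(sw _ x) sw_linear //; apply: eq_sw => a b.
rewrite -/(sw _ y) sw_linear //; apply: eq_sw => c d; exact: tlift_tens.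
Qed.

Lemma sw_antipodel X (f : H -> X) x : linear f ->
  sw (fun a b => f (antipode a * b)) x = counit x *: f 1.
Proof.
by move=> lf; rewrite -(linZ _ _ lf) -antipodel -/(sw _ x) sw_linear.
Qed.

Lemma sw_antipoder X (f : H -> X) x : linear f ->
  sw (fun a b => f (a * antipode b)) x = counit x *: f 1.
Proof.
by move=> lf; rewrite -(linZ _ _ lf) -antipoder -/(sw _ x) sw_linear.
Qed.

Lemma sw_exchange X (B : H -> H -> H -> H -> X) x y :
  sw (fun a b => sw (fun c d => B a b c d) y) x =
  sw (fun c d => sw (fun a b => B a b c d) x) y.
Proof.
pose p i j k l := (comul x : 'M_(_, _)) i j *: ((comul y : 'M_(_, _)) k l *:
  B (hbasis i) (hbasis j) (hbasis k) (hbasis l)).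
transitivity (\sum_i \sum_j \sum_k \sum_l p i j k l).
  apply: eq_bigr => i _; apply: eq_bigr => j _; rewrite scaler_sumr.
  by apply: eq_bigr => m _; rewrite scaler_sumr.
transitivity (\sum_k \sum_l \sum_i \sum_j p i j k l).
  rewrite pair_bigA /= [RHS]pair_bigA /=.
  under eq_bigr do rewrite pair_bigA /=.
  under [RHS]eq_bigr do rewrite pair_bigA /=.
  exact: exchange_big.
apply: eq_bigr => k _; apply: eq_bigr => l _; rewrite scaler_sumr.
apply: eq_bigr => i _; rewrite scaler_sumr; apply: eq_bigr => j _.
by rewrite /p !scalerA mulrC.
Qed.

End Sweedler.

(** * The hit actions and the convolution product *)

Section Convolution.
Variables (K : fieldType) (H : fdHopfType K).
Local Notation D := (hdual H).
Implicit Types (f g h : D) (x y z : H).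

(** The two hit actions of the dual on $H$: [hitr f x] is $f \rightharpoonup x$ and [hitl f x] is $x
    \leftharpoonup f$. They replace iterated Sweedler sums below, coassociativity becoming the
    commutation [hit_comm]. *)
Definition hitr f x : H := sw (fun a b => ev f b *: a) x.
Definition hitl f x : H := sw (fun a b => ev f a *: b) x.

Lemma hitrP f : linear (hitr f). Proof. by rewrite /hitr; lin. Qed.
Lemma hitlP f : linear (hitl f). Proof. by rewrite /hitl; lin. Qed.
HB.instance Definition _ f := GRing.isLinear.Build K H H *:%R (hitr f) (hitrP f).
HB.instance Definition _ f := GRing.isLinear.Build K H H *:%R (hitl f) (hitlP f).

Lemma hitrZ f c x : hitr f (c *: x) = c *: hitr f x.
Proof. exact: linZ (hitrP f). Qed.
Lemma hitlZ f c x : hitl f (c *: x) = c *: hitl f x.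
Proof. exact: linZ (hitlP f). Qed.

Lemma hitrPl x : linear (hitr^~ x). Proof. by rewrite /hitr; lin. Qed.
Lemma ev_hit f g x : ev f (hitr g x) = ev g (hitl f x).
Proof.
have lf u : @linear_for K H K^o *%R (ev u) by move=> a y z; rewrite linearP.
apply: (etrans (@sw_linear _ _ _ K^o (ev f) _ _ (lf f))); apply: esym.
apply: (etrans (@sw_linear _ _ _ K^o (ev g) _ _ (lf g))).
by apply: eq_sw => a b; rewrite !linearZ /= mulrC.
Qed.

Lemma hit_comm f g x : hitl f (hitr g x) = hitr g (hitl f x).
Proof.
transitivity (sw (fun a b => sw (fun c d => ev g b *: (ev f c *: d)) a) x).
  rewrite {1}/hitr sw_linear; last exact: hitlP.
  by apply: eq_sw => a b; rewrite hitlZ /hitl sw_linear //; lin.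
rewrite sw_assoc; try by lin.
rewrite {1}/hitl sw_linear; last exact: hitrP.
apply: eq_sw => a b; rewrite hitrZ /hitr sw_linear; last by lin.
by apply: eq_sw => c d; rewrite !scalerA mulrC.
Qed.

Definition conv f g : D := mkdual (ev f \o hitr g).

Lemma convE f g x : ev (conv f g) x = ev f (hitr g x).
Proof. by rewrite mkdualE. Qed.

Lemma hitr_conv f g x : hitr (conv f g) x = hitr f (hitr g x).
Proof.
transitivity (hitr f (sw (fun a b => ev g b *: a) x)); last by [].
rewrite sw_linear; last exact: hitrP.
transitivity (sw (fun a b => sw (fun c d => ev g b *: (ev f d *: c)) a) x).
  rewrite sw_assoc; try by lin.
  apply: eq_sw => a b; rewrite convE /hitr.
  rewrite (@sw_linear _ _ _ _ (fun u => ev f u *: a)); last by lin.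
  by apply: eq_sw => c d; rewrite linearZ /= scalerA.
by apply: eq_sw => a b; rewrite hitrZ /hitr sw_linear //; lin.
Qed.

Lemma hitr_counit x : hitr (hcounit H) x = x.
Proof.
rewrite -[RHS](@sw_counitr _ _ _ (fun x => x)); last by lin.
by apply: eq_sw => a b; rewrite ev_counit.
Qed.

Lemma hitl_counit x : hitl (hcounit H) x = x.
Proof.
rewrite -[RHS](@sw_counitl _ _ _ (fun x => x)); last by lin.
by apply: eq_sw => a b; rewrite ev_counit.
Qed.

Lemma convA : associative conv.
Proof. by move=> f g h; apply: hdualP => x; rewrite !convE hitr_conv. Qed.

Lemma conv1f : left_id (hcounit H) conv.
Proof. by move=> f; apply: hdualP => x; rewrite convE ev_hit hitl_counit. Qed.

Lemma convf1 : right_id (hcounit H) conv.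
Proof. by move=> f; apply: hdualP => x; rewrite convE hitr_counit. Qed.

Lemma convDl : left_distributive conv +%R.
Proof. by move=> f g h; apply: hdualP => x; rewrite !(convE, evDl). Qed.

Lemma convDr : right_distributive conv +%R.
Proof.
by move=> f g h; apply: hdualP => x; rewrite !(convE, evDl, ev_hit f).
Qed.

Lemma hcounit_neq0 : hcounit H != 0.
Proof.
apply/eqP=> /(congr1 (fun f => ev f 1)); rewrite ev_counit counit1 => /eqP.
by rewrite /ev lfunE oner_eq0.
Qed.

HB.instance Definition _ := GRing.Zmodule_isNzRing.Build D
  convA conv1f convf1 convDl convDr hcounit_neq0.

Lemma conv_scaleAl (a : K) f g : a *: (f * g) = (a *: f) * g.
Proof. by apply: hdualP => x; rewrite evZl !convE evZl. Qed.

HB.instance Definition _ := GRing.Lmodule_isLalgebra.Build K D conv_scaleAl.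

Lemma conv_scaleAr (a : K) f g : a *: (f * g) = f * (a *: g).
Proof. by apply: hdualP => x; rewrite evZl !convE !ev_hit evZl. Qed.

HB.instance Definition _ := GRing.Lalgebra_isAlgebra.Build K D conv_scaleAr.

Lemma evM f g x : ev (f * g) x = ev f (hitr g x).
Proof. exact: convE. Qed.

Lemma ev1 x : ev 1 x = counit x.
Proof. exact: ev_counit. Qed.

Lemma hitrM f g x : hitr (f * g) x = hitr f (hitr g x).
Proof. exact: hitr_conv. Qed.

Lemma hitlM f g x : hitl (f * g) x = hitl g (hitl f x).
Proof.
by apply: ev_inj => h; rewrite -!ev_hit evM -hit_comm -ev_hit.
Qed.

End Convolution.

(** * The antipode reverses products and coproducts *)

Section Antipode.
Variables (K : fieldType) (H : fdHopfType K).
Implicit Types (x y z : H).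
Local Notation S := (@antipode K H).

(** Both sides are convolution inverses of the multiplication $H \otimes H \to H$. The sum $S(x_1
    y_1)\,x_2 y_2\,S(y_3)\,S(x_3)$ collapses to either of them, according to which pair is
    contracted first. *)
Lemma antipodeM x y : S (x * y) = S y * S x.
Proof.
transitivity (sw (fun x1 x' => sw (fun x2 x3 => sw (fun y1 y' => sw (fun y2 y3 =>
  S (x1 * y1) * (x2 * (y2 * S y3) * S x3)) y') y) x') x).
  transitivity (sw (fun x1 x' => sw (fun x2 x3 => S (x1 * y) * (x2 * S x3)) x') x).
    transitivity (sw (fun x1 x' => counit x' *: S (x1 * y)) x).
      by rewrite sw_counitr //; lin.
    apply: eq_sw => x1 x'.
    by rewrite (@sw_antipoder _ _ _ (fun u => S (x1 * y) * u)) ?mulr1 //; lin.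
  apply: eq_sw => x1 x'; apply: eq_sw => x2 x3.
  transitivity (sw (fun y1 y' => counit y' *: (S (x1 * y1) * (x2 * S x3))) y).
    by rewrite (@sw_counitr _ _ _ (fun u => S (x1 * u) * _)) //; lin.
  apply: eq_sw => y1 y'.
  by rewrite (@sw_antipoder _ _ _ (fun u => S (x1 * y1) * (x2 * u * S x3))) ?mulr1 //; lin.
rewrite -sw_assoc; try by lin.
transitivity (sw (fun a x3 => counit a *: (S y * S x3)) x); last first.
  by rewrite (@sw_counitl _ _ _ (fun u => S y * S u)) //; lin.
apply: eq_sw => a x3.
under eq_sw => x1 x2.
  rewrite -sw_assoc; try by lin.
  over.
rewrite (@sw_exchange _ _ _ (fun x1 x2 b y3 =>
  sw (fun y1 y2 => S (x1 * y1) * (x2 * (y2 * S y3) * S x3)) b)).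
transitivity (sw (fun b y3 => counit b *: (counit a *: (S y3 * S x3))) y); last first.
  by rewrite (@sw_counitl _ _ _ (fun u => counit a *: (S u * S x3))) //; lin.
apply: eq_sw => b y3.
transitivity (sw (fun u v => (S u * v) * (S y3 * S x3)) (a * b)).
  rewrite swM; last by lin.
  by do 2![apply: eq_sw => ? ?]; rewrite !mulrA.
rewrite (@sw_antipodel _ _ _ (fun u => u * (S y3 * S x3))) ?mul1r; last by lin.
by rewrite counitM scalerA mulrC.
Qed.

Lemma antipode1 : S 1 = 1.
Proof.
have /= := @antipodel _ H 1; rewrite -/(sw _ _) sw1; last by lin.
by rewrite mulr1 counit1 scale1r.
Qed.

(** Both sides come from convolution inverses of $\Delta$. Here [E] is $\Delta(S(x_1)\,x_2)\,(S(x_4)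
    \otimes S(x_3))$ followed by [B]; contracting $S(x_1)\,x_2$ gives the right-hand side,
    contracting $x_2, x_3$ with the antipodes of $x_4$ gives the left-hand one. *)
Lemma sw_antipode (X : lmodType K) (B : H -> H -> X) x : bilinear_map B ->
  sw B (S x) = sw (fun a b => B (S b) (S a)) x.
Proof.
move=> [B1 B2].
pose E := sw (fun a b => sw (fun x1 v => sw (fun p q => sw (fun x4 x5 =>
  B (p * S x5) (q * S x4)) b) (S x1 * v)) a) x.
transitivity E; last first.
  transitivity (sw (fun a b => counit a *: sw (fun x4 x5 => B (S x5) (S x4)) b) x).
    apply: eq_sw => a b.
    rewrite (@sw_antipodel _ _ _ (fun u => sw (fun p q => sw (fun x4 x5 =>
      B (p * S x5) (q * S x4)) b) u)); last by lin.
    rewrite sw1; last by split=> u; apply: lin_swl => ? ?; lin.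
    by congr (_ *: _); apply: eq_sw => c d; rewrite !mul1r.
  by rewrite sw_counitl //; lin.
transitivity (sw (fun x1 c => sw (fun v b => sw (fun p q => sw (fun x2 x3 =>
   sw (fun x4 x5 => B (p * x2 * S x5) (q * x3 * S x4)) b) v) (S x1)) c) x); last first.
  rewrite -sw_assoc; first last.
  - by lin.
  - by lin.
  - by lin.
  apply: eq_sw => a b; apply: eq_sw => x1 v; rewrite swM //.
  by split=> u; apply: lin_swl => ? ?; lin.
transitivity (sw (fun x1 c => counit c *: sw B (S x1)) x).
  by rewrite sw_counitr //; lin.
apply: eq_sw => x1 c; rewrite sw_exchange sw_linear; last by lin.
apply: eq_sw => p q.
transitivity (sw (fun x2 d => B (p * (x2 * S d)) q) c).
  by rewrite (@sw_antipoder _ _ _ (fun u => B (p * u) q)) ?mulr1 //; lin.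
rewrite sw_assoc; try by lin.
apply: eq_sw => x2 d; rewrite -sw_assoc; try by lin.
transitivity (sw (fun e x5 => counit e *: B (p * x2 * S x5) q) d).
  by rewrite (@sw_counitl _ _ _ (fun u => B (p * x2 * S u) q)) ?mulrA //; lin.
apply: eq_sw => e x5.
transitivity (sw (fun x3 x4 => B (p * x2 * S x5) (q * (x3 * S x4))) e); last first.
  by apply: eq_sw => x3 x4; rewrite mulrA.
by rewrite (@sw_antipoder _ _ _ (fun u => B (p * x2 * S x5) (q * u))) ?mulr1 //; lin.
Qed.

Lemma counit_antipode x : counit (S x) = counit x.
Proof.
have lc : linear (fun u : H => counit u *: (1 : H)) by lin.
have e : injective (fun c : K => c *: (1 : H)).
  by move=> a b /eqP; rewrite -subr_eq0 -scalerBl scaler_eq0 oner_eq0 orbF subr_eq0 => /eqP.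
apply: e => /=.
transitivity (sw (fun a b => counit (S a * b) *: (1 : H)) x); last first.
  by rewrite (@sw_antipodel _ _ _ (fun u : H => counit u *: (1 : H))) // counit1 scale1r.
transitivity (sw (fun a b => counit b *: (counit (S a) *: (1:H))) x).
  by rewrite (@sw_counitr _ _ _ (fun u : H => counit (S u) *: (1 : H))) //; lin.
by apply: eq_sw => a b; rewrite counitM scalerA mulrC.
Qed.

End Antipode.

(** * Translations of functionals and the transposed antipode *)

Section Translations.
Variables (K : fieldType) (H : fdHopfType K).
Local Notation D := (hdual H).
Local Notation S := (@antipode K H).
Implicit Types (f g h : D) (x y z : H).

(** Agrees with [F] only when [F] is linear ([dualfunE]); taking a bare function avoids building a
    linear structure for every functional. *)
Definition dualfun (F : H -> K) : D := \sum_i F (hbasis i) *: hcoord i.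

Lemma ev_sum (I : Type) (r : seq I) (P : pred I) (F : I -> D) x :
  ev (\sum_(i <- r | P i) F i) x = \sum_(i <- r | P i) ev (F i) x.
Proof.
apply: (big_morph (fun f => ev f x)) => [f g|]; first exact: evDl.
by rewrite /ev lfunE.
Qed.

Lemma dualfunE (F : H -> K) x : scalar F -> ev (dualfun F) x = F x.
Proof.
move=> lF; rewrite {2}(hcoordE x) (@linear_comb _ H K^o F _ _ _ _ lF) ev_sum.
by apply: eq_bigr => i _; rewrite evZl mulrC.
Qed.

Lemma hdual_expand f : f = \sum_i ev f (hbasis i) *: hcoord i.
Proof. by apply: hdualP => x; rewrite -/(dualfun (ev f)) dualfunE //; exact: linearP. Qed.

Definition rtr f y : D := dualfun (fun x => ev f (x * y)).
Definition ltr f y : D := dualfun (fun x => ev f (y * x)).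
Definition dS f : D := dualfun (fun x => ev f (S x)).

Lemma rtrE f y x : ev (rtr f y) x = ev f (x * y).
Proof. by rewrite dualfunE // => a u v; rewrite mulrDl -scalerAl linearP. Qed.
Lemma ltrE f y x : ev (ltr f y) x = ev f (y * x).
Proof. by rewrite dualfunE // => a u v; rewrite mulrDr -scalerAr linearP. Qed.
Lemma dSE f x : ev (dS f) x = ev f (S x).
Proof. by rewrite dualfunE // => a u v; rewrite !linearP. Qed.

Lemma rtr_linear f : linear (rtr f).
Proof.
move=> a u v; apply: hdualP => x.
by rewrite evPl !rtrE mulrDr -scalerAr linearP.
Qed.
Lemma rtr_linearl y : linear (rtr^~ y).
Proof. by move=> a u v; apply: hdualP => x; rewrite evPl !rtrE evPl. Qed.
Lemma ltr_linear f : linear (ltr f).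
Proof.
move=> a u v; apply: hdualP => x.
by rewrite evPl !ltrE mulrDl -scalerAl linearP.
Qed.
Lemma dS_linear : linear dS.
Proof. by move=> a u v; apply: hdualP => x; rewrite evPl !dSE evPl. Qed.

Lemma hitr_antipode f x : hitr f (S x) = S (hitl (dS f) x).
Proof.
rewrite /hitr sw_antipode; last by lin.
rewrite /hitl sw_linear; last by lin.
by apply: eq_sw => a b; rewrite linearZ dSE.
Qed.

Lemma hitl_antipode f x : hitl f (S x) = S (hitr (dS f) x).
Proof.
rewrite /hitl sw_antipode; last by lin.
rewrite /hitr sw_linear; last by lin.
by apply: eq_sw => a b; rewrite linearZ dSE.
Qed.

Lemma dSM f g : dS (f * g) = dS g * dS f.
Proof.
apply: hdualP => x.
by rewrite dSE evM hitr_antipode -dSE evM ev_hit.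
Qed.

Lemma dS1 : dS 1 = 1.
Proof. by apply: hdualP => x; rewrite dSE !ev1 counit_antipode. Qed.

Lemma dSX f n : dS (f ^+ n) = dS f ^+ n.
Proof. by elim: n => [|n IH]; rewrite ?dS1 // exprSr dSM IH -exprS. Qed.

Lemma sw_sum (X : lmodType K) (I : Type) (r : seq I) (B : I -> H -> H -> X) x :
  sw (fun a b => \sum_(i <- r) B i a b) x = \sum_(i <- r) sw (B i) x.
Proof.
rewrite /sw /tlift [RHS]exchange_big; apply: eq_bigr => i _ /=.
rewrite [RHS]exchange_big; apply: eq_bigr => j _; exact: scaler_sumr.
Qed.

Lemma lin_sum (U X : lmodType K) (F : U -> X) (I : Type) (r : seq I) (c : I -> K) (u : I -> U) :
  linear F -> F (\sum_(i <- r) c i *: u i) = \sum_(i <- r) c i *: F (u i).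
Proof. exact: linear_comb. Qed.

Lemma sw_hitl (X : lmodType K) (B : H -> H -> X) x : bilinear_map B ->
  sw B x = \sum_i B (hbasis i) (hitl (hcoord i) x).
Proof.
case=> B1 B2; transitivity (sw (fun a b => \sum_i ev (hcoord i) a *: B (hbasis i) b) x).
  by apply: eq_sw => a b; rewrite {1}(hcoordE a) (lin_sum _ _ _ (B2 b)).
rewrite sw_sum; apply: eq_bigr => i _; rewrite /hitl sw_linear //.
by apply: eq_sw => a b; rewrite linZ.
Qed.

Lemma sw_hitr (X : lmodType K) (B : H -> H -> X) x : bilinear_map B ->
  sw B x = \sum_i B (hitr (hcoord i) x) (hbasis i).
Proof.
case=> B1 B2; transitivity (sw (fun a b => \sum_i ev (hcoord i) b *: B a (hbasis i)) x).
  by apply: eq_sw => a b; rewrite {1}(hcoordE b) (lin_sum _ _ _ (B1 a)).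
rewrite sw_sum; apply: eq_bigr => i _; rewrite /hitr (sw_linear _ _ (B2 _)).
by apply: eq_sw => a b; rewrite (linZ _ _ (B2 _)).
Qed.

(** The sum of the [hcoord i] tensored with the [hbasis i] is the canonical element of $H^* \otimes
    H$, on which an endomorphism of $H$ and its transpose act alike. *)
Lemma casimir (X : lmodType K) (G : D -> H -> X) (A : H -> H) (A' : D -> D) :
  (forall f, linear (G f)) -> (forall x, linear (G^~ x)) ->
  (forall f x, ev (A' f) x = ev f (A x)) ->
  \sum_i G (A' (hcoord i)) (hbasis i) = \sum_i G (hcoord i) (A (hbasis i)).
Proof.
move=> G1 G2 AA.
transitivity (\sum_i \sum_j ev (hcoord i) (A (hbasis j)) *: G (hcoord j) (hbasis i)).
  apply: eq_bigr => i _; rewrite {1}[A' _]hdual_expand (lin_sum _ _ _ (G2 _)).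
  by apply: eq_bigr => j _; rewrite AA.
rewrite exchange_big; apply: eq_bigr => j _ /=.
by rewrite {2}[A _]hcoordE (lin_sum _ _ _ (G1 _)).
Qed.

(* The Hopf module compatibility behind the fundamental theorem for [H^*]. *)
Lemma hitr_rtr f x y :
  hitr (rtr f (S y)) x = sw (fun a b => hitr f (x * S a) * b) y.
Proof.
transitivity (sw (fun a b => sw (fun x1 x2 => sw (fun a1 a2 =>
   ev f (x2 * S a1) *: (x1 * S a2 * b)) a) x) y); last first.
  apply: eq_sw => a b; rewrite /hitr swM; last by lin.
  rewrite (sw_linear _ _ (@lin_mull _ _ _ (fun u => u) b (@lin_id _ _))).
  apply: eq_sw => x1 x2; rewrite sw_antipode; last by lin.
  rewrite (sw_linear _ _ (@lin_mull _ _ _ (fun u => u) b (@lin_id _ _))).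
  by apply: eq_sw => a1 a2; rewrite scalerAl.
under [RHS]eq_sw do rewrite sw_exchange.
rewrite sw_assoc; try by lin.
transitivity (sw (fun a b => counit b *: sw (fun x1 x2 => ev f (x2 * S a) *: x1) x) y).
  rewrite sw_counitr; last by lin.
  by apply: eq_sw => x1 x2; rewrite rtrE.
apply: eq_sw => a c.
pose F u := sw (fun x1 x2 => ev f (x2 * S a) *: (x1 * u)) x.
transitivity (sw (fun a2 b => F (S a2 * b)) c).
  rewrite sw_antipodel /F; last by lin.
  by congr (_ *: _); apply: eq_sw => x1 x2; rewrite mulr1.
by apply: eq_sw => a2 b; apply: eq_sw => x1 x2; rewrite mulrA.
Qed.

End Translations.

(** * Integrals and Radford's formula *)

Section Integrals.
Variables (K : fieldType) (H : fdHopfType K).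
Local Notation D := (hdual H).
Local Notation S := (@antipode K H).
Implicit Types (f g h : D) (x y z : H).

Lemma lin_rtr (U : lmodType K) f (v : U -> H) :
  linear v -> linear (fun u => rtr f (v u)).
Proof. by move=> lv; exact: lin_comp (rtr_linear f) lv. Qed.
Lemma lin_rtrl (U : lmodType K) (f : U -> D) x :
  linear f -> linear (fun u => rtr (f u) x).
Proof. by move=> lv a u w; rewrite lv; exact: rtr_linearl. Qed.

Lemma rtr_suml (I : Type) (r : seq I) (F : I -> D) x :
  rtr (\sum_(i <- r) F i) x = \sum_(i <- r) rtr (F i) x.
Proof.
by apply: hdualP => z; rewrite rtrE !ev_sum; apply: eq_bigr => i _; rewrite rtrE.
Qed.

Definition left_integral f := forall h, h * f = ev h 1 *: f.

Lemma rtr1 f : rtr f 1 = f.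
Proof. by apply: hdualP => x; rewrite rtrE mulr1. Qed.

Lemma rtr_rtr f y z : rtr (rtr f y) z = rtr f (z * y).
Proof. by apply: hdualP => x; rewrite !rtrE mulrA. Qed.

(** This makes the dual a Hopf module: $H$ acts on the right by $f \cdot y =$ [rtr f (S y)], and
    left multiplication in the dual encodes a coaction. *)
Lemma mul_rtr_antipode h f y :
  h * rtr f (S y) = sw (fun a b => rtr (rtr h b * f) (S a)) y.
Proof.
apply: hdualP => x; rewrite evM hitr_rtr.
rewrite !sw_hitr; first last.
- by split=> u; [apply: lin_mulr; lin | apply: lin_mull; apply: (lin_comp (hitrP f)); lin].
- split=> u; first by apply: lin_rtrl; apply: lin_mull; apply: rtr_linear.
  by apply: lin_rtr; lin.
rewrite linear_sum ev_sum; apply: eq_bigr => i _.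
by rewrite rtrE evM rtrE.
Qed.

(** The projection $P(f) = \sum f_{(0)} \cdot S(f_{(1)})$ of the Hopf module onto its coinvariants,
    which here are the left integrals; one antipode belongs to the action, the other to the
    projection. *)
Definition integral_of f : D := \sum_i rtr (hcoord i * f) (S (S (hbasis i))).

Lemma ev_convl f g x : ev (f * g) x = ev g (hitl f x).
Proof. by rewrite evM ev_hit. Qed.

Lemma integral_of_left f : left_integral (integral_of f).
Proof.
move=> h; rewrite /integral_of mulr_sumr.
transitivity (\sum_i \sum_j rtr (rtr h (S (hbasis j)) * ((hcoord j * hcoord i) * f))
                (S (S (hbasis i)))).
  transitivity (\sum_i \sum_j rtr (rtr h (S (hbasis j)) * (hcoord i * f))
                (S (S (hitl (hcoord j) (hbasis i))))).
    apply: eq_bigr => i _; rewrite mul_rtr_antipode sw_antipode; last first.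
      split=> u; first by apply: lin_rtrl; apply: lin_mull; apply: rtr_linear.
      by apply: lin_rtr; lin.
    rewrite sw_hitl // ; split=> u; first by apply: lin_rtr; lin.
    by apply: lin_rtrl; apply: lin_mull; apply: lin_rtr; lin.
  rewrite exchange_big [RHS]exchange_big; apply: eq_bigr => j _ /=.
  rewrite -(@casimir _ _ _ (fun p x => rtr (rtr h (S (hbasis j)) * (p * f)) (S (S x)))
     (hitl (hcoord j)) (fun p => hcoord j * p)) //.
  - by move=> p; apply: lin_rtr; lin.
  - by move=> x; apply: lin_rtrl; apply: lin_mulr; lin.
  - exact: ev_convl.
rewrite scaler_sumr; apply: eq_bigr => i _.
rewrite -(linZ _ _ (rtr_linearl _)) -rtr_suml; congr rtr.
transitivity ((\sum_j rtr h (S (hbasis j)) * hcoord j) * (hcoord i * f)).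
  by rewrite mulr_suml; apply: eq_bigr => j _; rewrite !mulrA.
suff -> : \sum_j rtr h (S (hbasis j)) * hcoord j = ev h 1 *: 1.
  by rewrite -scalerAl mul1r.
apply: hdualP => x; rewrite ev_sum evZl ev1 mulrC.
have <- : ev h (sw (fun a b => a * S b) x) = counit x * ev h 1.
  by rewrite (@sw_antipoder _ _ _ (fun u => u)) ?linearZ //; lin.
rewrite sw_hitr ?linear_sum; last by lin.
by apply: eq_bigr => j _; rewrite evM rtrE.
Qed.

(** Every element of a Hopf module satisfies $m = \sum P(m_{(0)}) \cdot m_{(1)}$. At $m = 1$ the
    coaction produces the elements [hcoord i * 1], so $P$ cannot vanish on all of them. *)
Lemma integral_nonzero : exists f, left_integral f /\ f != 0.
Proof.
have [e|] := boolP [forall i, integral_of (hcoord i * 1) == 0]; last first.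
  by case/forallPn=> i ne; exists (integral_of (hcoord i * 1)); split=> //; apply: integral_of_left.
have /eqP[] : (1 : D) != 0 by apply: oner_neq0.
rewrite -[LHS]rtr1 -[1 in LHS]mulr1.
pose T p x := rtr (p * 1) (S x).
have T1 p : linear (T p) by apply: lin_rtr; lin.
have T2 x : linear (T^~ x) by apply: lin_rtrl; lin.
transitivity (\sum_i \sum_j T (hcoord j * hcoord i) (S (hbasis j) * hbasis i)).
  rewrite exchange_big /=.
  transitivity (\sum_j \sum_i T (hcoord i) (S (hbasis j) * hitl (hcoord j) (hbasis i))); last first.
    apply: eq_bigr => j _; rewrite -(@casimir _ _ _ (fun p x => T p (S (hbasis j) * x))
     (hitl (hcoord j)) (fun p => hcoord j * p)) //.
    - by move=> p; apply: (lin_comp (T1 p)); lin.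
    - exact: ev_convl.
  rewrite exchange_big /=.
  transitivity (\sum_i T (hcoord i) (counit (hbasis i) *: 1)); last first.
    apply: eq_bigr => i _.
    have := @sw_antipodel _ _ _ (T (hcoord i)) (hbasis i) (T1 _).
    rewrite sw_hitl; last by split=> u; apply: (lin_comp (T1 _)); lin.
    by move=> ->; rewrite (linZ _ _ (T1 _)).
  under eq_bigr do rewrite (linZ _ _ (T1 _)).
  rewrite -(lin_sum _ _ _ (T2 _)) /T antipode1; congr (rtr (_ * _) _).
  rewrite [LHS]hdual_expand; apply: eq_bigr => i _; by rewrite ev1.
apply: big1 => i _; rewrite /T.
have /forallP/(_ i)/eqP := e; rewrite /integral_of => z.
transitivity (rtr (\sum_j rtr (hcoord j * (hcoord i * 1)) (S (S (hbasis j)))) (S (hbasis i))).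
  rewrite rtr_suml; apply: eq_bigr => j _; rewrite rtr_rtr antipodeM.
  by rewrite !mulr1.
by rewrite z (lin0 (rtr_linearl _)).
Qed.

End Integrals.

(** * Group-like elements, characters and their finite order *)

Section GroupLike.
Variable K : fieldType.

(* Dedekind: [E t v] is the value of the multiplicative function [v] at [t]. *)
Lemma multiplicative_free (V : vectType K) (T : Type) (op : T -> T -> T)
    (E : T -> V -> K) (s : seq V) :
  (forall t, scalar (E t)) -> (forall u v, (forall t, E t u = E t v) -> u = v) ->
  (forall v, v \in s -> v != 0 /\ forall t t', E (op t t') v = E t v * E t' v) ->
  uniq s -> free s.
Proof.
move=> lE inj; elim: s => [|v s IH] ms; first by rewrite nil_free.
rewrite cons_uniq => /andP[vs us].
have fs : free s by apply: IH => // w ws; apply: ms; rewrite inE ws orbT.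
rewrite free_cons fs andbT; apply: contra vs => vs.
have [v0 mv] := ms v (mem_head _ _).
pose c (i : 'I_(size s)) : K := coord (in_tuple s) i v.
have ev : v = \sum_(i < size s) c i *: s`_i := coord_span (X := in_tuple s) vs.
have Ev t : E t v = \sum_(i < size s) c i * E t s`_i.
  by rewrite {1}ev (@linear_comb _ V K^o (E t)).
have [i ci0|c0] := pickP (fun i => c i != 0); last first.
  move: v0; rewrite ev big1 ?eqxx // => i _.
  by rewrite -/(c i); have /negbFE/eqP-> := c0 i; rewrite scale0r.
suff -> : v = s`_i by apply: mem_nth.
apply: (inj) => t.
have: \sum_(i < size s) (c i * (E t s`_i - E t v)) *: s`_i = 0.
  apply: (inj) => t'; have -> : E t' 0 = 0 by exact: (@lin0 K V K^o _ (lE t')).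
  rewrite (@linear_comb _ V K^o (E t')) //.
  transitivity (\sum_(j < size s) c j * (E t s`_j - E t v) * E t' s`_j); first by [].
  transitivity (E (op t t') v - E t v * E t' v); last by rewrite mv subrr.
  rewrite (Ev (op t t')) (Ev t') mulr_sumr -sumrB; apply: eq_bigr => j _.
  have [_ ->] : s`_j != 0 /\ forall t t', E (op t t') s`_j = E t s`_j * E t' s`_j.
    by apply: ms; rewrite inE mem_nth ?orbT.
  by rewrite mulrBr mulrBl mulrA; congr (_ - _); rewrite mulrCA mulrA.
move=> z; have /eqP := elimT freeP (fs : free (in_tuple s)) _ z i; rewrite mulf_eq0 (negPf ci0) subr_eq0.
by move/eqP.
Qed.

(** Pigeonhole: independence allows at most $\dim V$ distinct powers of [x], so two powers coincide,
    and the left inverse [y] cancels the smaller one. *)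
Lemma uniq_expr (R : nzRingType) (V : vectType K) (F : R -> V) (x y : R) :
  injective F -> y * x = 1 ->
  (forall s, uniq s -> (forall v, v \in s -> exists n, v = F (x ^+ n)) -> free s) ->
  exists2 m, (0 < m)%N & x ^+ m = 1.
Proof.
move=> injF yx fr; pose s := [seq F (x ^+ n) | n <- iota 0 (\dim {:V}).+1].
have : ~~ uniq s.
  apply/negP=> us; have fs : free s.
    by apply: fr => // v /mapP[n _ ->]; exists n.
  have := dimvS (subvf <<s>>%VS); move: fs; rewrite /free => /eqP->.
  by rewrite size_map size_iota ltnn.
case/(uniqPn 0) => i [j [ij]]; rewrite size_map size_iota => js.
rewrite !(nth_map 0%N) ?size_iota ?(ltn_trans ij) // !nth_iota ?(ltn_trans ij) //.
move/injF; rewrite !add0n => e; exists (j - i)%N; first by rewrite subn_gt0.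
have yxn n : y ^+ n * x ^+ n = 1.
  by elim: n => [|n IH]; rewrite ?mulr1 // exprSr exprS mulrA -(mulrA (y ^+ n)) yx mulr1.
by rewrite -[LHS]mul1r -(yxn i) -mulrA -exprD subnKC ?(ltnW ij) // -e yxn.
Qed.

Variable H : fdHopfType K.
Local Notation D := (hdual H).
Local Notation S := (@antipode K H).
Implicit Types (f g h : D) (x y z : H).

(** Stated through the dual, as multiplicativity of the evaluation at [x], so that it mirrors
    [character]; [grouplike_sw] recovers $\Delta(x) = x \otimes x$. *)
Definition grouplike x := counit x = 1 /\ forall f g, ev (f * g) x = ev f x * ev g x.
Definition character f := ev f 1 = 1 /\ forall x y, ev f (x * y) = ev f x * ev f y.

Lemma grouplike_neq0 x : grouplike x -> x != 0.
Proof. by case=> e _; apply/eqP=> x0; move/eqP: e; rewrite x0 linear0 eq_sym oner_eq0. Qed.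

Lemma character_neq0 f : character f -> f != 0.
Proof.
case=> e _; apply/eqP=> x0; move/eqP: e.
by rewrite x0 /ev lfunE eq_sym oner_eq0.
Qed.

Lemma grouplike_hitr x f : grouplike x -> hitr f x = ev f x *: x.
Proof. by move=> [_ gx]; apply: ev_inj => g; rewrite -evM gx linearZ mulrC. Qed.

Lemma grouplike_hitl x f : grouplike x -> hitl f x = ev f x *: x.
Proof. by move=> [_ gx]; apply: ev_inj => g; rewrite -ev_hit -evM gx linearZ. Qed.

Lemma grouplike_sw (X : lmodType K) (B : H -> H -> X) x :
  grouplike x -> bilinear_map B -> sw B x = B x x.
Proof.
move=> gx BB; have [B1 B2] := BB; rewrite sw_hitl //.
under eq_bigr do rewrite grouplike_hitl // (linZ _ _ (B1 _)).
by rewrite -(lin_sum _ _ _ (B2 x)) -hcoordE.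
Qed.

Lemma grouplike_antipodel x : grouplike x -> S x * x = 1.
Proof.
move=> gx; rewrite -(@grouplike_sw _ (fun a b => S a * b)) //; last by lin.
by rewrite (@sw_antipodel _ _ _ (fun u => u)) ?gx.1 ?scale1r //; lin.
Qed.

Lemma grouplike_antipoder x : grouplike x -> x * S x = 1.
Proof.
move=> gx; rewrite -(@grouplike_sw _ (fun a b => a * S b)) //; last by lin.
by rewrite (@sw_antipoder _ _ _ (fun u => u)) ?gx.1 ?scale1r //; lin.
Qed.

Lemma hitrMl f x y : hitr f (x * y) = sw (fun a b => a * hitr (ltr f b) y) x.
Proof.
rewrite /hitr swM; last by lin.
apply: eq_sw => a b; rewrite (sw_linear _ _ (@lin_mulr _ _ _ (fun u => u) a (@lin_id _ _))).
by apply: eq_sw => c d; rewrite ltrE scalerAr.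
Qed.

Lemma bil_hitr_ltr f y : bilinear_map (fun a b => a * hitr (ltr f b) y).
Proof.
split=> u; last by lin.
by apply: lin_mulr => a v w; rewrite ltr_linear hitrPl.
Qed.

Lemma grouplike_hitrM x y f : grouplike x -> hitr f (x * y) = x * hitr (ltr f x) y.
Proof.
by move=> gx; rewrite hitrMl grouplike_sw //; exact: bil_hitr_ltr.
Qed.

Lemma grouplikeM x y : grouplike x -> grouplike y -> grouplike (x * y).
Proof.
move=> gx gy; split=> [|f g]; first by rewrite counitM gx.1 gy.1 mulr1.
rewrite evM grouplike_hitrM // grouplike_hitr // -scalerAr linearZ /= ltrE.
by rewrite mulrC.
Qed.

Lemma grouplike1 : grouplike 1.
Proof.
split=> [|f g]; first exact: counit1.
rewrite evM /hitr sw1; last by lin.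
by rewrite linearZ mulrC.
Qed.

Lemma grouplikeX x n : grouplike x -> grouplike (x ^+ n).
Proof.
move=> gx; elim: n => [|n IH]; first exact: grouplike1.
by rewrite exprS; exact: grouplikeM.
Qed.

Lemma grouplike_free (s : seq H) :
  uniq s -> (forall x, x \in s -> grouplike x) -> free s.
Proof.
move=> us gs; apply: (@multiplicative_free H D *%R (@ev K H)) => //.
- by move=> t a u v; rewrite linearP.
- exact: ev_inj.
- by move=> v /gs gv; split; [exact: grouplike_neq0 | exact: gv.2].
Qed.

Lemma grouplike_order x : grouplike x -> exists2 m, (0 < m)%N & x ^+ m = 1.
Proof.
move=> gx; apply: (@uniq_expr H H id x (S x)) => //.
  exact: grouplike_antipodel.
move=> s us se; apply: grouplike_free => // v /se[n ->]; exact: grouplikeX.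
Qed.

Lemma character_hitr f x y : character f -> hitr f (x * y) = hitr f x * hitr f y.
Proof.
move=> cf; rewrite hitrMl.
transitivity (sw (fun a b => ev f b *: (a * hitr f y)) x); last first.
  rewrite {2}/hitr (sw_linear _ _ (@lin_mull _ _ _ (fun u => u) (hitr f y) (@lin_id _ _))).
  by apply: eq_sw => a b; rewrite scalerAl.
apply: eq_sw => a b; rewrite scalerAr; congr (_ * _).
have -> : ltr f b = ev f b *: f by apply: hdualP => z; rewrite ltrE evZl cf.2.
exact: (linZ _ _ (hitrPl y)).
Qed.

Lemma characterM f g : character f -> character g -> character (f * g).
Proof.
move=> cf cg; split.
  rewrite evM /hitr sw1; last by lin.
  by rewrite linearZ /= cg.1 cf.1 mulr1.
by move=> x y; rewrite !evM character_hitr // cf.2.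
Qed.

Lemma character1 : character 1.
Proof. by split=> [|x y]; rewrite !ev1 ?counit1 ?counitM. Qed.

Lemma characterX f n : character f -> character (f ^+ n).
Proof.
move=> cf; elim: n => [|n IH]; first exact: character1.
by rewrite exprS; exact: characterM.
Qed.

Lemma character_dS f : character f -> character (dS f).
Proof.
move=> cf; split=> [|x y]; first by rewrite dSE antipode1 cf.1.
by rewrite !dSE antipodeM cf.2 mulrC.
Qed.

Lemma character_free (s : seq D) :
  uniq s -> (forall f, f \in s -> character f) -> free s.
Proof.
move=> us cs; apply: (@multiplicative_free D H *%R (fun x f => ev f x)) => //.
- by move=> t a u v; rewrite evPl.
- by move=> u v e; exact: hdualP.
- by move=> v /cs cv; split; [exact: character_neq0 | exact: cv.2].
Qed.

Lemma character_sw f f' (A B : H -> H) x :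
    character f -> linear A -> linear B -> (forall y, ev f' y = ev f (B y)) ->
  ev f (sw (fun a b => A a * B b) x) = ev f (A (hitr f' x)).
Proof.
move=> cf lA lB fB; have l : linear (fun y => A (hitr f' y)).
  exact: lin_comp lA (hitrP f').
rewrite sw_hitr; last by split=> u; [apply: lin_mulr | apply: lin_mull].
rewrite linear_sum /= [f' in RHS]hdual_expand (lin_sum _ _ _ (hitrPl x)).
rewrite (lin_sum _ _ _ lA) linear_sum /=; apply: eq_bigr => i _.
by rewrite cf.2 linearZ /= fB mulrC.
Qed.

Lemma character_antipodel f : character f -> dS f * f = 1.
Proof.
move=> cf; apply: hdualP => x; rewrite evM ev1 dSE.
rewrite -(@character_sw f f S id); [|exact: cf|by lin|by lin|by []].
by rewrite (@sw_antipodel _ _ _ (fun u => u)) ?linearZ /= ?cf.1 ?mulr1 //; lin.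
Qed.

Lemma character_antipoder f : character f -> f * dS f = 1.
Proof.
move=> cf; apply: hdualP => x; rewrite evM ev1.
rewrite -(@character_sw f (dS f) id S); [|exact: cf|by lin|by lin|exact: dSE].
by rewrite (@sw_antipoder _ _ _ (fun u => u)) ?linearZ /= ?cf.1 ?mulr1 //; lin.
Qed.

Lemma character_order f : character f -> exists2 m, (0 < m)%N & f ^+ m = 1.
Proof.
move=> cf; apply: (@uniq_expr D D id f (dS f)) => //.
  exact: character_antipodel.
move=> s us se; apply: character_free => // v /se[n ->]; exact: characterX.
Qed.

End GroupLike.

(** * Uniqueness of integrals and the fourth power of the antipode *)

Section Radford.
Variables (K : fieldType) (H : fdHopfType K).
Local Notation D := (hdual H).
Local Notation S := (@antipode K H).
Implicit Types (f g h : D) (x y z : H).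

Lemma dim_hdual : (\dim {: D} <= \dim {:H})%N.
Proof.
have sp : ({:D} <= <<[seq hcoord i | i <- enum 'I_(\dim {:H})]>>)%VS.
  apply/subvP=> f _; rewrite (hdual_expand f); apply: memv_suml => i _.
  by rewrite memvZ // memv_span // map_f ?mem_enum.
apply: leq_trans (dimvS sp) _.
by apply: leq_trans (dim_span _) _; rewrite size_map size_enum_ord.
Qed.

Lemma linear_inj_surj (F : H -> D) : linear F -> (forall x, F x = 0 -> x = 0) ->
  forall f, exists x, f = F x.
Proof.
move=> lF F0; pose Fl : {linear H -> D} := HB.pack F (GRing.isLinear.Build K H D *:%R F lF).
have k0 : lker (linfun Fl) == 0%VS.
  rewrite -subv0; apply/subvP=> x; rewrite memv_ker lfunE => /eqP/F0->.
  exact: mem0v.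
have e : limg (linfun Fl) = fullv.
  apply/eqP; rewrite eqEdim subvf /=; apply: leq_trans dim_hdual _.
  by rewrite limg_dim_eq // (eqP k0) capv0.
move=> f; have /memv_imgP[x _ ->] : f \in limg (linfun Fl) by rewrite e memvf.
by exists x; rewrite lfunE.
Qed.

Lemma linear_inj_surjH (F : H -> H) : linear F -> (forall x, F x = 0 -> x = 0) ->
  forall y, exists x, y = F x.
Proof.
move=> lF F0; pose Fl : {linear H -> H} := HB.pack F (GRing.isLinear.Build K H H *:%R F lF).
have k0 : lker (linfun Fl) == 0%VS.
  rewrite -subv0; apply/subvP=> x; rewrite memv_ker lfunE => /eqP/F0->.
  exact: mem0v.
have e : limg (linfun Fl) = fullv.
  by apply/eqP; rewrite eqEdim subvf /= limg_dim_eq // (eqP k0) capv0.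
move=> f; have /memv_imgP[x _ ->] : f \in limg (linfun Fl) by rewrite e memvf.
by exists x; rewrite lfunE.
Qed.

Variables (lam : D).
Hypotheses (lamI : left_integral lam) (lam0 : lam != 0).

Lemma lam_hitr x : hitr lam x = ev lam x *: 1.
Proof. by apply: ev_inj => f; rewrite -evM lamI evZl linearZ mulrC. Qed.

Lemma mul_rtr_lam f x : f * rtr lam (S x) = rtr lam (S (hitr f x)).
Proof.
rewrite mul_rtr_antipode sw_hitr; last first.
  split=> u; first by apply: lin_rtrl; apply: lin_mull; apply: rtr_linear.
  by apply: lin_rtr; lin.
have l : linear (fun y => rtr lam (S y)) by apply: lin_rtr; lin.
rewrite [in RHS](hdual_expand f) (lin_sum _ _ _ (hitrPl x)) (lin_sum _ _ _ l).
by apply: eq_bigr => i _; rewrite lamI rtrE mul1r (linZ _ _ (rtr_linearl _)).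
Qed.

(** By [mul_rtr_lam] the kernel is stable under every [hitr f], so it is enough that the counit
    vanishes on it: then $f(x) = \varepsilon(f \rightharpoonup x) = 0$ for all $f$. That holds
    because $\varepsilon(y)\,\lambda = \sum \lambda \cdot (y_1 S(y_2))$ and the right-hand side only
    involves the products [f * rtr lam (S y)]. *)
Lemma rtr_lamS_inj x : rtr lam (S x) = 0 -> x = 0.
Proof.
have eps0 y : rtr lam (S y) = 0 -> counit y = 0.
  move=> z; suff : counit y *: lam = 0.
    by move/eqP; rewrite scaler_eq0 (negPf lam0) orbF => /eqP.
  transitivity (sw (fun a b => rtr (rtr lam (S a)) (S (S b))) y); last first.
    rewrite sw_hitr; last first.
      split=> u; first by apply: lin_rtr; lin.
      by apply: lin_rtrl; apply: lin_rtr; lin.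
    by apply: big1 => i _; rewrite -mul_rtr_lam z mulr0 (lin0 (rtr_linearl _)).
  have l : linear (fun u => rtr lam (S u)) by apply: lin_rtr; lin.
  rewrite -{1}(rtr1 lam) -{1}antipode1 -(@sw_antipoder _ _ _ _ _ l).
  by apply: eq_sw => a b; rewrite rtr_rtr antipodeM.
move=> z; apply: ev_inj => f; rewrite linear0.
have := eps0 (hitr f x); rewrite -mul_rtr_lam z mulr0 => /(_ erefl).
by rewrite -ev1 -evM mul1r.
Qed.

Lemma antipode_inj : injective S.
Proof.
move=> x y /eqP; rewrite -subr_eq0 -linearB => /eqP e; apply/eqP.
by rewrite -subr_eq0; apply/eqP/rtr_lamS_inj; rewrite e (lin0 (rtr_linear _)).
Qed.

Lemma antipode_surj y : exists x, y = S x.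
Proof.
apply: linear_inj_surjH; first by lin.
by move=> x Sx0; apply: antipode_inj; rewrite linear0.
Qed.

Lemma dS_surj f : exists g, f = dS g.
Proof.
have k0 : lker (linfun S) == 0%VS.
  rewrite -subv0; apply/subvP=> x; rewrite memv_ker lfunE => /eqP e.
  by rewrite (_ : x = 0) ?mem0v //; apply: antipode_inj; rewrite linear0.
exists (dualfun (fun x => ev f ((linfun S)^-1%VF x))); apply: hdualP => x.
rewrite dSE dualfunE; last by move=> a u v; rewrite !linearP.
have -> : S x = linfun S x by rewrite lfunE.
by rewrite lker0_lfunK.
Qed.

Lemma rtr_lam_inj x y : rtr lam x = rtr lam y -> x = y.
Proof.
have [x' ->] := antipode_surj x; have [y' ->] := antipode_surj y => e.
apply: congr1; apply/eqP; rewrite -subr_eq0; apply/eqP/rtr_lamS_inj.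
apply: hdualP => z; move/(congr1 (fun f => ev f z)): e.
rewrite !rtrE linearB mulrBr linearB /= => ->.
by rewrite subrr /ev lfunE.
Qed.

Lemma rtr_lam_surj f : exists x, f = rtr lam x.
Proof.
have l : linear (fun u => rtr lam (S u)) by apply: lin_rtr; lin.
by have [x ->] := linear_inj_surj l rtr_lamS_inj f; exists (S x).
Qed.

Lemma left_integral_unique f : left_integral f -> exists c, f = c *: lam.
Proof.
have l : linear (fun u => rtr lam (S u)) by apply: lin_rtr; lin.
have [x ->] := linear_inj_surj l rtr_lamS_inj f => fI.
have e : x = counit x *: 1.
  apply: ev_inj => g; rewrite linearZ /=.
  have : rtr lam (S (hitr g x)) = rtr lam (S (ev g 1 *: x)).
    by rewrite -mul_rtr_lam fI linearZ (linZ _ _ (rtr_linear _)).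
  move/rtr_lam_inj/antipode_inj/(congr1 (ev 1)).
  by rewrite -evM mul1r linearZ /= ev1 mulrC.
by exists (counit x); rewrite {1}e linearZ (linZ _ _ (rtr_linear _)) antipode1 rtr1.
Qed.

(** By [Lam_left] and [ev_lam_Lam], this is the left integral of $H$ normalised by $\lambda(\Lambda)
    = 1$. *)
Variable Lam : H.
Hypothesis LamE : rtr lam Lam = 1.

Lemma ev_lam_mulLam x : ev lam (x * Lam) = counit x.
Proof. by rewrite -rtrE LamE ev1. Qed.

Lemma ev_lam_Lam : ev lam Lam = 1.
Proof. by rewrite -[Lam]mul1r ev_lam_mulLam counit1. Qed.

Lemma Lam_left x : x * Lam = counit x *: Lam.
Proof.
apply: rtr_lam_inj; rewrite (linZ _ _ (rtr_linear _)) LamE.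
by apply: hdualP => y; rewrite rtrE mulrA ev_lam_mulLam counitM evZl ev1 mulrC.
Qed.

(** The distinguished character (modular function) of $H$, as [Lam_right] shows. *)
Let al := ltr lam Lam.

Lemma Lam_right x : Lam * x = ev al x *: Lam.
Proof.
apply: rtr_lam_inj; rewrite (linZ _ _ (rtr_linear _)) LamE.
apply: hdualP => y; rewrite rtrE mulrA Lam_left -scalerAl linearZ evZl ev1.
by rewrite ltrE mulrC.
Qed.

Lemma al_character : character al.
Proof.
split=> [|x y]; first by rewrite ltrE mulr1 ev_lam_Lam.
by rewrite ltrE mulrA Lam_right -scalerAl linearZ /= -ltrE.
Qed.

(** The antipode in terms of the integrals, $S(y) = \sum \Lambda_1\,\lambda(y \Lambda_2)$. It comes
    from $\sum S(y_1)\,(\lambda \rightharpoonup y_2\Lambda)$, computed once with $y_2\Lambda =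
    \varepsilon(y_2)\Lambda$ and once by expanding the coproduct of $y_2\Lambda$. *)
Lemma antipodeE y : S y = hitr (ltr lam y) Lam.
Proof.
transitivity (sw (fun a b => S a * hitr lam (b * Lam)) y).
  transitivity (sw (fun a b => counit b *: S a) y); first by rewrite sw_counitr //; lin.
  apply: eq_sw => a b.
  by rewrite Lam_left hitrZ lam_hitr ev_lam_Lam scale1r -scalerAr mulr1.
transitivity (sw (fun a b => sw (fun a1 a2 => S a * (a1 * hitr (ltr lam a2) Lam)) b) y).
  apply: eq_sw => a b; rewrite hitrMl (sw_linear _ _ (@lin_mulr _ _ _ (fun u => u) _ (@lin_id _ _))).
  by [].
have l (U : lmodType K) (v : U -> H) c : linear v -> linear (fun u => c * hitr (ltr lam (v u)) Lam).
  by move=> lv; apply: lin_mulr => a u w; rewrite lv ltr_linear hitrPl.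
rewrite -sw_assoc; first last.
- by move=> a b; apply: (lin_comp (f := *%R (S a)) (g := fun c => b * hitr (ltr lam c) Lam)); [lin | apply: l; lin].
- by lin.
- by lin.
transitivity (sw (fun a b => counit a *: hitr (ltr lam b) Lam) y); last first.
  rewrite (@sw_counitl _ _ _ (fun u => hitr (ltr lam u) Lam)) // => a u w.
  by rewrite ltr_linear hitrPl.
apply: eq_sw => a b.
transitivity (sw (fun a1 a2 => S a1 * a2 * hitr (ltr lam b) Lam) a).
  by apply: eq_sw => ? ?; rewrite mulrA.
by rewrite (@sw_antipodel _ _ _ (fun u => u * hitr (ltr lam b) Lam)) ?mul1r //; lin.
Qed.

Lemma hitr_rtrS_Lam z : hitr (rtr lam (S z)) Lam = hitl (dS al) z.
Proof.
rewrite hitr_rtr; apply: eq_sw => a b.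
by rewrite lam_hitr -scalerAl mul1r dSE ltrE.
Qed.

(** The element [z] is the image of [y] under the Nakayama automorphism of the Frobenius form [lam].
    It exists because [ltr lam] is injective: by [antipodeE] it determines $S$. *)
Lemma nakayama y : exists z, rtr lam y = ltr lam z.
Proof.
apply: linear_inj_surj; first exact: ltr_linear.
move=> x e; apply: antipode_inj; rewrite antipodeE e linear0.
exact: (lin0 (hitrPl Lam)).
Qed.

(** The distinguished group-like element of $H$, see [lam_mul]. *)
Let g := hitl lam Lam.

Lemma lam_mul f : lam * f = ev f g *: lam.
Proof.
have [c ec] : exists c, lam * f = c *: lam.
  by apply: left_integral_unique => h; rewrite mulrA lamI scalerAl.
move: (congr1 (fun u => ev u Lam) ec).
by rewrite /= evZl ev_lam_Lam mulr1 evM ev_hit ec => ->.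
Qed.

Lemma g_grouplike : grouplike g.
Proof.
have e c c' : c *: lam = c' *: lam -> c = c'.
  move/eqP; rewrite -subr_eq0 -scalerBl scaler_eq0 (negPf lam0) orbF subr_eq0.
  by move/eqP.
split=> [|f h]; apply: e; first by rewrite -ev1 -lam_mul mulr1 scale1r.
by rewrite -lam_mul mulrA lam_mul -scalerAl lam_mul scalerA.
Qed.

(** Both [dS lam] and [rtr lam g] are right integrals. The transposed antipode sends right integrals
    to left ones, whose uniqueness makes the two proportional. *)
Lemma lamS : exists2 c, c != 0 & dS lam = c *: rtr lam g.
Proof.
have gg := g_grouplike.
pose rho := rtr lam g.
have rhoI f : rho * f = ev f 1 *: rho.
  apply: hdualP => x; rewrite evM evZl !rtrE.
  have [f' ->] : exists f', f = rtr f' g.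
    exists (rtr f (S g)); rewrite rtr_rtr.
    by rewrite grouplike_antipoder // rtr1.
  rewrite rtrE mul1r.
  have -> : hitr (rtr f' g) x * g = hitr f' (x * g).
    rewrite /hitr swM; last by lin.
    rewrite (sw_linear _ _ (@lin_mull _ _ _ (fun u => u) _ (@lin_id _ _))).
    apply: eq_sw => a b; rewrite grouplike_sw //; last by lin.
    by rewrite rtrE scalerAl.
  by rewrite -evM lam_mul evZl.
have [c ec] : exists c, dS rho = c *: lam.
  apply: left_integral_unique => f; have [f' ->] := dS_surj f.
  by rewrite -dSM rhoI (linZ _ _ (@dS_linear K H)) dSE antipode1.
have [c' ec'] : exists c', dS (dS lam) = c' *: lam.
  apply: left_integral_unique => f; have [f' ->] := dS_surj f.
  have [f'' ->] := dS_surj f'.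
  by rewrite -!dSM lamI !(linZ _ _ (@dS_linear K H)) !dSE !antipode1.
have dSinj (u v : D) : dS u = dS v -> u = v.
  move=> e; apply: hdualP => x; have [x' ->] := antipode_surj x.
  by rewrite -!dSE e.
have c'0 : c' != 0.
  apply/eqP=> c0; move/eqP: lam0; apply; do 2!apply: (dSinj).
  by rewrite ec' c0 scale0r !(lin0 (@dS_linear K H)).
have rho0 : rho != 0.
  apply/eqP=> r0; move: gg.2 (grouplike_neq0 gg) => _ /eqP; apply.
  by apply: rtr_lam_inj; rewrite -/rho r0 (lin0 (rtr_linear _)).
have c0 : c != 0.
  apply/eqP=> c0; move/eqP: rho0; apply; apply: (dSinj).
  by rewrite ec c0 scale0r (lin0 (@dS_linear K H)).
exists (c' / c); first by rewrite mulf_neq0 ?invr_eq0.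
apply: (dSinj); rewrite (linZ _ _ (@dS_linear K H)) ec ec' scalerA.
by rewrite divfK.
Qed.

(** The Nakayama automorphism $\nu$ of [lam] is computed in two ways. By [R1], which uses $\Lambda$,
    it is a translation by [al] up to antipodes. By [thg], which uses $\lambda \circ S =
    c\,\lambda(\cdot\, g)$, the conjugate $S^{-1}\nu S$ is $\nu^{-1}$ followed by conjugation by
    $g$. Eliminating $\nu$ leaves $S^4$. *)
Lemma radford u : g * S (S (S (S u))) * S g = hitr al (hitl (dS al) u).
Proof.
have gg := g_grouplike.
have [c c0 ec] := lamS.
have gSg := grouplike_antipoder gg; have Sgg := grouplike_antipodel gg.
have R1 z t : rtr lam (S z) = ltr lam t -> S t = hitl (dS al) z.
  by move=> e; rewrite antipodeE -e hitr_rtrS_Lam.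
(* th is S^-1 nu S, for the Nakayama automorphism nu of lam. *)
have th x : exists2 w, rtr lam (S x) = ltr lam (S w) & S (S w) = hitl (dS al) x.
  have [z ez] := nakayama (S x); have [w ew] := antipode_surj z.
  by exists w; rewrite -ew // (R1 _ _ ez).
have Sg2 : S (S g) = g.
  by rewrite -[LHS]mulr1 -Sgg mulrA -antipodeM gSg antipode1 mul1r.
have thg y z w : rtr lam y = ltr lam z -> rtr lam (S z) = ltr lam (S w) -> w * g = g * y.
  move=> e1 e2; apply: rtr_lam_inj; apply: hdualP => v; rewrite !rtrE.
  have -> : ev lam (v * (g * y)) = ev lam (z * (v * g)).
    by rewrite mulrA -[RHS]ltrE -e1 rtrE.
  have lS s : ev lam (S s) = c * ev lam (s * g) by rewrite -dSE ec evZl rtrE.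
  apply: (mulfI c0); rewrite !mulrA -!lS !antipodeM.
  by rewrite -ltrE -e2 rtrE.
have [w1 e1 e1'] := th u; have [w2 e2 e2'] := th (S w1).
have w2E : w2 = g * S u * S g by rewrite -(thg _ _ _ e1 e2) -mulrA gSg mulr1.
rewrite -e1' hitr_antipode -e2' w2E !antipodeM.
by rewrite !Sg2 mulrA.
Qed.

Lemma character_hitl f x y : character f -> hitl f (x * y) = hitl f x * hitl f y.
Proof.
have [x' ->] := antipode_surj x; have [y' ->] := antipode_surj y => cf.
rewrite -antipodeM !hitl_antipode -antipodeM character_hitr //.
exact: character_dS.
Qed.

Lemma grouplike_antipode x : grouplike x -> grouplike (S x).
Proof.
move=> gx; split=> [|f h]; first by rewrite counit_antipode gx.1.
by rewrite -!dSE dSM gx.2 mulrC.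
Qed.

Lemma antipodeX x n : S (x ^+ n) = S x ^+ n.
Proof. by elim: n => [|n IH]; rewrite ?antipode1 // exprSr antipodeM IH -exprS. Qed.

Lemma radford_order : exists2 m, (0 < m)%N & forall x, iter m (fun y => S (S (S (S y)))) x = x.
Proof.
have gg := g_grouplike; have ca := al_character; have cb := character_dS ca.
have Sgg := grouplike_antipodel gg; have gs := grouplike_antipode gg.
have S4 u : S (S (S (S u))) = S g * hitr al (hitl (dS al) u) * g.
  by rewrite -radford !mulrA Sgg mul1r -mulrA Sgg mulr1.
have conj1 f n : character f -> ev f (S g ^+ n) * ev f (g ^+ n) = 1.
  move=> cf; rewrite -cf.2 -antipodeX grouplike_antipodel ?cf.1 //.
  exact: grouplikeX.
(* Passing the translations by [al] across $g$ produces scalars, which [conj1] cancels; hence the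
   two kinds of twist in $S^4$ can be iterated separately. *)
have step n u : iter n (fun y => S (S (S (S y)))) u =
    S g ^+ n * hitr (al ^+ n) (hitl (dS al ^+ n) u) * g ^+ n.
  elim: n => [|n IH]; first by rewrite !expr0 mul1r mulr1 hitl_counit hitr_counit.
  rewrite iterS IH S4 !character_hitl // !(grouplike_hitl _ (grouplikeX n _)) //.
  rewrite -!(scalerAl, scalerAr) scalerA mulrC conj1 // scale1r.
  rewrite !character_hitr // !(grouplike_hitr _ (grouplikeX n _)) //.
  rewrite -!(scalerAl, scalerAr) scalerA mulrC conj1 // scale1r.
  rewrite hit_comm -hitrM -hitlM -[al * _]exprS -[_ * dS al]exprSr.
  by rewrite [S g ^+ n.+1]exprS [g ^+ n.+1]exprSr !mulrA.
have [m1 m10 e1] := character_order ca; have [m2 m20 e2] := grouplike_order gg.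
exists (m1 * m2)%N => [|x]; first by rewrite muln_gt0 m10.
have e1' : al ^+ (m1 * m2) = 1 by rewrite exprM e1 expr1n.
have e2' : g ^+ (m1 * m2) = 1 by rewrite mulnC exprM e2 expr1n.
rewrite step -dSX -antipodeX e1' e2' dS1 hitl_counit hitr_counit.
by rewrite antipode1 mul1r mulr1.
Qed.

End Radford.

Theorem antipode_order (K : fieldType) (H : fdHopfType K) :
  exists2 m, (0 < m)%N & forall x : H, iter m (fun y => antipode (antipode y)) x = x.
Proof.
have [lam [lI l0]] := integral_nonzero H.
have [Lam eL] := rtr_lam_surj lI l0 1.
have [m m0 e] := radford_order lI l0 (esym eL).
exists (m + m)%N => [|x]; first by rewrite addn_gt0 m0.
rewrite -[RHS]e; elim: m {m0 e} => [//|m IH].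
by rewrite addSn addnS !iterS IH.
Qed.

(** * Twisted superpotentials *)

Section Corepresentation.
Variables (K : fieldType) (H : fdHopfType K).
Local Notation D := (hdual H).
Local Notation S := (@antipode K H).
Implicit Types (x y z : H).

(** Matrix coefficients of a representation of $H$, that is, a matrix corepresentation of the
    dual. *)
Definition corep (I : finType) (a : I -> I -> D) :=
  (forall i j, ev (a i j) 1 = (i == j)%:R) /\
  (forall i j x y, ev (a i j) (x * y) = \sum_k ev (a i k) x * ev (a k j) y).

Lemma corep_ltr (I : finType) (a : I -> I -> D) i j x : corep a ->
  ltr (a i j) x = \sum_k ev (a i k) x *: a k j.
Proof.
move=> [_ ca]; apply: hdualP => z; rewrite ltrE ca ev_sum.
by apply: eq_bigr => k _; rewrite evZl.
Qed.

Lemma corep_hitr (I : finType) (a : I -> I -> D) i j x y : corep a ->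
  hitr (a i j) (x * y) = \sum_k hitr (a i k) x * hitr (a k j) y.
Proof.
move=> ca; rewrite hitrMl.
transitivity (sw (fun u v => \sum_k ev (a i k) v *: (u * hitr (a k j) y)) x).
  apply: eq_sw => u v; rewrite (corep_ltr _ _ _ ca) (lin_sum _ _ _ (hitrPl y)).
  by rewrite mulr_sumr; apply: eq_bigr => k _; rewrite scalerAr.
rewrite sw_sum; apply: eq_bigr => k _; rewrite {2}/hitr.
rewrite (sw_linear _ _ (@lin_mull _ _ _ (fun u => u) _ (@lin_id _ _))).
by apply: eq_sw => u v; rewrite scalerAl.
Qed.

Lemma corep_tensor (I T : finType) (a : I -> I -> D) (b : T -> T -> D) :
  corep a -> corep b ->
  corep (fun p q : I * T => a p.1 q.1 * b p.2 q.2).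
Proof.
move=> ca cb; split=> [p q|p q x y].
  rewrite evM /hitr sw1; last by lin.
  by rewrite linearZ /= ca.1 cb.1 -natrM mulnb andbC -xpair_eqE -!surjective_pairing.
rewrite evM (corep_hitr _ _ _ _ cb) linear_sum /=.
rewrite -(pair_bigA _ (fun l k => ev (a p.1 l * b p.2 k) x * ev (a l q.1 * b k q.2) y)) /=.
rewrite exchange_big; apply: eq_bigr => k _ /=; rewrite ca.2.
by apply: eq_bigr => l _; rewrite !evM.
Qed.

Lemma corep_antipoder (I : finType) (a : I -> I -> D) i j : corep a ->
  \sum_k a i k * dS (a k j) = (i == j)%:R.
Proof.
move=> ca; apply: hdualP => x; rewrite ev_sum.
transitivity (ev (a i j) (sw (fun u v => u * S v) x)); last first.
  rewrite (@sw_antipoder _ _ _ (fun u => u)); last by lin.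
  by rewrite linearZ /= ca.1; case: eqP => _; rewrite ?mulr1 ?mulr0 ?ev1 // /ev lfunE.
rewrite sw_hitr; last by lin.
rewrite linear_sum /=; under [RHS]eq_bigr do rewrite ca.2.
rewrite exchange_big; apply: eq_bigr => k _ /=; rewrite evM.
rewrite {1}[dS _]hdual_expand (lin_sum _ _ _ (hitrPl x)) linear_sum.
by apply: eq_bigr => l _; rewrite linearZ /= dSE mulrC.
Qed.

Lemma corep_antipodel (I : finType) (a : I -> I -> D) i j : corep a ->
  \sum_k dS (a i k) * a k j = (i == j)%:R.
Proof.
move=> ca; apply: hdualP => x; rewrite ev_sum.
transitivity (ev (a i j) (sw (fun u v => S u * v) x)); last first.
  rewrite (@sw_antipodel _ _ _ (fun u => u)); last by lin.
  by rewrite linearZ /= ca.1; case: eqP => _; rewrite ?mulr1 ?mulr0 ?ev1 // /ev lfunE.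
rewrite sw_hitr; last by lin.
rewrite linear_sum /=; under [RHS]eq_bigr do rewrite ca.2.
rewrite exchange_big; apply: eq_bigr => k _ /=; rewrite evM.
rewrite {1}[a k j]hdual_expand (lin_sum _ _ _ (hitrPl x)) linear_sum.
by apply: eq_bigr => l _; rewrite linearZ /= dSE mulrC.
Qed.

Lemma dS_sum (I : Type) (r : seq I) (F : I -> D) :
  dS (\sum_(i <- r) F i) = \sum_(i <- r) dS (F i).
Proof.
by apply: hdualP => x; rewrite dSE !ev_sum; apply: eq_bigr => i _; rewrite dSE.
Qed.

Lemma dSZ c (f : D) : dS (c *: f) = c *: dS f.
Proof. exact: (linZ _ _ (@dS_linear K H)). Qed.

Lemma character_dSdS (d : D) : character d -> dS (dS d) = d.
Proof.
move=> cd; have := congr1 (@dS K H) (character_antipodel cd); rewrite dSM dS1 => e.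
by rewrite -[LHS]mul1r -(character_antipoder cd) -mulrA e mulr1.
Qed.

(* [mu] intertwines the square of the antipode with a winding automorphism. *)
Lemma antipode_square_intertwine (I : finType) (a u : I -> I -> D) (mu : I -> I -> K) (d : D) :
    corep a -> character d ->
    (forall l s, \sum_i a l i * u s i = (l == s)%:R *: d) ->
    (forall n s, \sum_k (\sum_k' mu k k' *: u s k') * a n k = mu n s *: d) ->
  forall n s, \sum_k mu n k *: dS (dS (a k s)) = \sum_k mu k s *: (d * a n k * dS d).
Proof.
move=> ca cd hA hB.
have uE s i : u s i = dS (a i s) * d.
  transitivity (\sum_l dS (a i l) * (\sum_k a l k * u s k)).
    under eq_bigr do rewrite mulr_sumr; rewrite exchange_big /=.
    transitivity (\sum_j (\sum_k dS (a i k) * a k j) * u s j).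
      rewrite (bigD1 i) //= corep_antipodel // eqxx mul1r big1 ?addr0 // => j ne.
      by rewrite corep_antipodel // eq_sym (negPf ne) mul0r.
    by apply: eq_bigr => j _; rewrite mulr_suml; apply: eq_bigr => k _; rewrite mulrA.
  rewrite (bigD1 s) //= hA eqxx scale1r big1 ?addr0 // => l ne.
  by rewrite hA (negPf ne) scale0r mulr0.
have dd := character_antipoder cd; have dSd := character_dSdS cd.
(* The antipode applied to [hB]. Since $d\,a\,d^{-1}$ and $d\,S(a)\,d^{-1}$ are inverse matrices,
   this is the claim multiplied on the left by the second one. *)
have hC n s : \sum_k d * dS (a n k) * dS d * (\sum_k' mu k k' *: dS (dS (a k' s))) = (mu n s)%:A.
  have := congr1 (fun f => dS (f * dS d)) (hB n s).
  rewrite -scalerAl dd dSZ dS1 => <-; rewrite mulr_suml dS_sum; apply: eq_bigr => k _.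
  rewrite -[in RHS]mulrA dSM (dSM (a n k)) dSd dS_sum -mulrA; congr (_ * _).
  by rewrite mulr_sumr; apply: eq_bigr => l _; rewrite uE dSZ dSM scalerAr.
move=> n s; pose X n s := \sum_k' mu n k' *: dS (dS (a k' s)).
rewrite -/(X n s).
transitivity (\sum_m d * a n m * dS d * \sum_k d * dS (a m k) * dS d * X k s); last first.
  by apply: eq_bigr => m _; rewrite hC -scalerAr mulr1.
under [RHS]eq_bigr do rewrite mulr_sumr.
rewrite exchange_big /=.
transitivity (\sum_k d * (\sum_m a n m * dS (a m k)) * dS d * X k s).
  rewrite (bigD1 n) //= corep_antipoder // eqxx mulr1 dd mul1r big1 ?addr0 // => k ne.
  by rewrite corep_antipoder // eq_sym (negPf ne) mulr0 !mul0r.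
apply: eq_bigr => k _; rewrite mulr_sumr !mulr_suml; apply: eq_bigr => m _.
by rewrite !mulrA -[d * a n m * dS d * d]mulrA (character_antipodel cd) mulr1.
Qed.

Lemma iter_hit (d : D) m x :
  iter m (fun y => hitl d (hitr (dS d) y)) x = hitl (d ^+ m) (hitr (dS d ^+ m) x).
Proof.
elim: m => [|m IH]; first by rewrite hitl_counit hitr_counit.
by rewrite iterS IH -hit_comm -hitrM -hitlM -exprS -exprSr.
Qed.

(** With $\psi$ dual to conjugation by $d$, the hypothesis is $\mu A(S^2 x) = A(\psi x)\mu$. As
    $S^2(d) = d$, the maps $\psi$ and $S^2$ commute, so $\mu^m A(S^{2m} x) = A(\psi^m x)\mu^m$, and
    both twists disappear when $m$ is a common multiple of the orders of $S^2$ and $d$. *)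
Lemma corep_commutes (n : nat) (a : 'I_n -> 'I_n -> D) (mu : 'M[K]_n) (d : D) :
    character d ->
    (forall i s, \sum_k mu i k *: dS (dS (a k s)) = \sum_k mu k s *: (d * a i k * dS d)) ->
  exists2 m, (0 < m)%N &
    forall x, let A := \matrix_(i, j) ev (a i j) x in
      (iter m (mulmx mu) 1%:M) *m A = A *m (iter m (mulmx mu) 1%:M).
Proof.
move=> cd e.
pose SS y := S (S y); pose psi y := hitl d (hitr (dS d) y).
pose A x := \matrix_(i, j) ev (a i j) x; pose M m := iter m (mulmx mu) 1%:M.
have MC m : M m *m mu = mu *m M m.
  by elim: m => [|m IH]; rewrite /M /= ?mul1mx ?mulmx1 // -mulmxA IH.
have e1 x : mu *m A (SS x) = A (psi x) *m mu.
  apply/matrixP=> i s; rewrite !mxE; have := congr1 (fun f => ev f x) (e i s).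
  rewrite !ev_sum; under eq_bigr do rewrite evZl !dSE.
  move=> E; under eq_bigr do rewrite mxE; rewrite E.
  by apply: eq_bigr => k _; rewrite mxE evZl mulrC evM evM ev_hit.
have psiSS x : psi (SS x) = SS (psi x).
  by rewrite /psi /SS hitr_antipode hitl_antipode hitl_antipode hitr_antipode !character_dSdS // character_dSdS.
have eM m x : M m *m A (iter m SS x) = A (iter m psi x) *m M m.
  elim: m x => [|m IH] x; first by rewrite mul1mx mulmx1.
  have sw m' z : psi (iter m' SS z) = iter m' SS (psi z).
    by elim: m' => [//|m' IHm]; rewrite !iterS -IHm psiSS.
  rewrite [in LHS]/M iterS -/(M m) -MC -mulmxA iterS e1 sw mulmxA IH -iterSr -mulmxA MC.
  by [].
have [m1 m10 E1] := antipode_order H; have [m2 m20 E2] := character_order cd.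
exists (m1 * m2)%N => [|x /=]; first by rewrite muln_gt0 m10.
rewrite -/(A x) -/(M _); have := eM (m1 * m2)%N x.
have -> : iter (m1 * m2) SS x = x.
  by rewrite mulnC; elim: {E2 m20} m2 => [//|m2 IH]; rewrite mulSn iterD IH; apply: E1.
rewrite iter_hit mulnC exprM E2 expr1n hitl_counit -dSX exprM E2 expr1n dS1.
by rewrite hitr_counit.
Qed.

End Corepresentation.

(** * The coaction on a twisted superpotential *)

Section Superpotential.
Variables (K : fieldType) (H : fdHopfType K).
Local Notation D := (hdual H).

(* [w] is a twisted superpotential: [w s] is its left derivative by the letter
   [s], [phi] moves the splitting point of a word from after its first letter
   to before its last one. *)
Record superpotential (n : nat) (T : finType) (phi : 'I_n * T -> T * 'I_n)
    (w : 'I_n -> T -> K) (mu : 'M[K]_n) : Prop := Superpotential {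
  sp_cyclic : forall p, w p.1 p.2 = \sum_k mu (phi p).2 k * w k (phi p).1;
  sp_free : exists v : T -> 'I_n -> K, forall s r, \sum_t w s t * v t r = (s == r)%:R;
  sp_unique : forall x y : 'M[K]_n,
    (forall p, \sum_r w r (phi p).1 * x r (phi p).2 = \sum_r y p.1 r * w r p.2) ->
    exists e, y = e%:M
}.

(** The transform [M] of $w$ is expanded in two ways: after splitting off the first letter ([My])
    and, through [sp_cyclic], the last one ([Mx]). By [sp_unique] the two expansions agree only if
    $w$ is multiplied by one functional $d$; the two ends then supply the hypotheses of
    [antipode_square_intertwine]. *)
Lemma superpotential_commutes (n : nat) (T : finType)
    (phi : 'I_n.+1 * T -> T * 'I_n.+1) w mu
    (a : 'I_n.+1 -> 'I_n.+1 -> D) (A : T -> T -> D) :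
    superpotential phi w mu -> bijective phi -> corep a -> corep A ->
    (forall p q, a p.1 q.1 * A p.2 q.2 =
                 A (phi p).1 (phi q).1 * a (phi p).2 (phi q).2) ->
    (forall z i, exists b : 'I_n.+1 -> K, forall t,
       \sum_t' w i t' * ev (A t t') z = \sum_s w s t * b s) ->
  exists2 m, (0 < m)%N &
    forall x, let M := \matrix_(i, j) ev (a i j) x in
      (iter m (mulmx mu) 1%:M) *m M = M *m (iter m (mulmx mu) 1%:M).
Proof.
case=> cyc [v vE] uniq bphi ca cA hA stable.
have lsum (b : 'I_n.+1 -> K) r : \sum_t v t r * (\sum_s w s t * b s) = b r.
  under eq_bigr do rewrite mulr_sumr; rewrite exchange_big /=.
  transitivity (\sum_s (\sum_t w s t * v t r) * b s).
    by apply: eq_bigr => s _; rewrite mulr_suml; apply: eq_bigr => t _; rewrite mulrA [v t r * _]mulrC.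
  under eq_bigr do rewrite vE.
  by rewrite (bigD1 r) //= eqxx mul1r big1 ?addr0 // => s /negPf->; rewrite mul0r.
(* The coaction on the derivatives $w_i$; the right inverse [v] of [w] extracts the coefficients. *)
pose u s i : D := \sum_t v t s *: \sum_t' w i t' *: A t t'.
have stab i t : \sum_t' w i t' *: A t t' = \sum_s w s t *: u s i.
  apply: hdualP => z; have [b hb] := stable z i.
  rewrite !ev_sum; under eq_bigr do rewrite evZl.
  rewrite hb; apply: eq_bigr => s _; rewrite evZl; congr (_ * _).
  rewrite -[LHS]lsum /u ev_sum; apply: eq_bigr => t1 _; rewrite evZl ev_sum -hb.
  by congr (_ * _); apply: eq_bigr => t2 _; rewrite evZl.
clearbody u.
pose M p : D := \sum_q w q.1 q.2 *: (a p.1 q.1 * A p.2 q.2).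
pose y l s : D := \sum_i a l i * u s i.
pose x r k : D := \sum_k' (\sum_k'' mu k' k'' *: u r k'') * a k k'.
have My p : M p = \sum_s w s p.2 *: y p.1 s.
  rewrite /M -(pair_bigA _ (fun i t => w i t *: (a p.1 i * A p.2 t))) /=.
  transitivity (\sum_i a p.1 i * \sum_s w s p.2 *: u s i).
    apply: eq_bigr => i _; rewrite -stab mulr_sumr; apply: eq_bigr => t _.
    by rewrite scalerAr.
  under [LHS]eq_bigr do rewrite mulr_sumr; rewrite exchange_big; apply: eq_bigr => s _ /=.
  by rewrite scaler_sumr; apply: eq_bigr => i _; rewrite scalerAr.
have [psi phiK psiK] := bphi.
have Mx p : M p = \sum_r w r (phi p).1 *: x r (phi p).2.
  transitivity (\sum_(q : T * 'I_n.+1) \sum_k mu q.2 k *: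
      (w k q.1 *: (A (phi p).1 q.1 * a (phi p).2 q.2))).
    rewrite [RHS](reindex phi) /=; last by exists psi => q _.
    apply: eq_bigr => q _; rewrite hA cyc scaler_suml.
    by apply: eq_bigr => k _; rewrite scalerA.
  rewrite -(pair_bigA _ (fun t i => \sum_k mu i k *:
      (w k t *: (A (phi p).1 t * a (phi p).2 i)))) /= exchange_big /=.
  transitivity (\sum_k' \sum_k'' (mu k' k'' *: \sum_r w r (phi p).1 *: u r k'') * a (phi p).2 k').
    apply: eq_bigr => k' _; rewrite exchange_big; apply: eq_bigr => k'' _ /=.
    rewrite -stab scaler_sumr mulr_suml; apply: eq_bigr => t _.
    by rewrite !scalerAl.
  rewrite /x; under [RHS]eq_bigr do rewrite scaler_sumr.
  rewrite [RHS]exchange_big; apply: eq_bigr => k' _ /=.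
  rewrite -mulr_suml; under [RHS]eq_bigr do rewrite scalerAl.
  rewrite -mulr_suml; congr (_ * _).
  under [RHS]eq_bigr do rewrite scaler_sumr.
  rewrite [RHS]exchange_big; apply: eq_bigr => k'' _ /=.
  rewrite scaler_sumr; apply: eq_bigr => r _. by rewrite !scalerA mulrC.
pose d := y ord0 ord0.
have yd l s : y l s = (l == s)%:R *: d.
  apply: hdualP => z.
  have [|e ee] := uniq (\matrix_(r, k) ev (x r k) z) (\matrix_(r, k) ev (y r k) z).
    move=> p'; have := congr1 (fun f => ev f z) (etrans (esym (Mx p')) (My p')).
    rewrite !ev_sum; under eq_bigr do rewrite evZl.
    under [X in _ = X -> _]eq_bigr do rewrite evZl. move=> E.
    under eq_bigr do rewrite mxE; rewrite E.
    by apply: eq_bigr => r _; rewrite mxE mulrC.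
  rewrite evZl; have := ee => /matrixP/(_ l s); rewrite !mxE => ->.
  have := ee => /matrixP/(_ ord0 ord0); rewrite !mxE => ->.
  by rewrite eqxx mulr1n mulr_natl.
have Md p : M p = w p.1 p.2 *: d.
  rewrite My (bigD1 p.1) //= yd eqxx scale1r big1 ?addr0 // => s ne.
  by rewrite yd eq_sym (negPf ne) scale0r scaler0.
have cM := corep_tensor ca cA.
have evM' p z : ev (M p) z = \sum_q w q.1 q.2 * ev (a p.1 q.1 * A p.2 q.2) z.
  by rewrite ev_sum; apply: eq_bigr => q _; rewrite evZl.
have [t0 wn0] : exists t, w ord0 t != 0.
  have [t|w0] := pickP (fun t => w ord0 t != 0); first by exists t.
  have /eqP := vE ord0 ord0; rewrite eqxx big1 ?(eq_sym 0) ?oner_eq0 // => t _.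
  by have /negbFE/eqP-> := w0 t; rewrite mul0r.
(* The matrix on whole words is a corepresentation and has $w$ as an eigenvector with eigenvalue
   $d$; this is read at a word where $w$ does not vanish. *)
have cd : character d.
  pose p0 := (ord0 : 'I_n.+1, t0).
  have can z z' : w p0.1 p0.2 * z = w p0.1 p0.2 * z' -> z = z' by exact: mulfI.
  split=> [|z z']; apply: can.
    rewrite -evZl -Md evM' (bigD1 p0) //= big1 ?addr0 => [|q ne].
      by rewrite (cM.1 p0 p0) eqxx.
    by rewrite (cM.1 p0 q) eq_sym (negPf ne) mulr0.
  rewrite -evZl -Md evM'.
  under eq_bigr do rewrite (cM.2 p0) mulr_sumr.
  rewrite exchange_big /=.
  transitivity (\sum_r ev (a p0.1 r.1 * A p0.2 r.2) z * ev (M r) z').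
    apply: eq_bigr => r _; rewrite evM' mulr_sumr; apply: eq_bigr => q _.
    by rewrite mulrCA.
  under eq_bigr do rewrite Md evZl mulrCA mulrA.
  by rewrite -mulr_suml -evM' Md evZl mulrA.
apply: (corep_commutes cd); move=> i s.
apply: (@antipode_square_intertwine _ _ _ a u (fun i j => mu i j) d ca cd) => [l s'|k s'].
  exact: yd.
suff -> : \sum_k' (\sum_k'' mu k' k'' *: u s' k'') * a k k' = mu k s' *: d by [].
rewrite -/(x s' k).
transitivity (\sum_t v t s' *: \sum_r w r t *: x r k).
  apply: hdualP => z; rewrite -[LHS](lsum (fun r => ev (x r k) z) s') ev_sum; apply: eq_bigr => t _.
  by rewrite evZl ev_sum; congr (_ * _); apply: eq_bigr => r _; rewrite evZl.
have Mt t : \sum_r w r t *: x r k = (\sum_r w r t * mu k r) *: d.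
  have := etrans (esym (Mx (psi (t, k)))) (Md _); rewrite cyc psiK /= => ->.
  by congr (_ *: _); apply: eq_bigr => r _; rewrite mulrC.
under eq_bigr do rewrite Mt scalerA; rewrite -scaler_suml.
by rewrite lsum.
Qed.

End Superpotential.

(** * The free algebra and graded actions *)

Lemma product_telescope (R : pzRingType) (p q r p0 w r0 : R) :
  p * q * r - p0 * w * r0 = p * (q - w) * r + ((p - p0) * w * r + p0 * w * (r - r0)).
Proof. by rewrite !(mulrBr, mulrBl) !addrA !subrK. Qed.

Section FreeAlgebra.
Variables (K : fieldType) (n : nat).
Local Notation F := (free_algebra K n).
Implicit Types (p q r : F) (s : seq 'I_n).

(* Locked: unifying two distinct monomials would unfold finite maps. *)
Fact word_key : unit. Proof. by []. Qed.
Definition word : seq 'I_n -> F := locked_with word_key (fun s => << FMonom s >>).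

Lemma wordE s : word s = << FMonom s >>.
Proof. by rewrite /word unlock. Qed.

Lemma fgenE i : fgen K i = word [:: i].
Proof. by rewrite wordE /fgen fmuE. Qed.

Lemma wordM s s' : word s * word s' = word (s ++ s').
Proof.
rewrite !wordE malgM_def fgmulUU mulr1; congr << _ >>.
by apply/eqP; rewrite fmP fmM.
Qed.

Lemma word_coef s s' : (word s)@_(FMonom s') = (s == s')%:R :> K.
Proof. by rewrite wordE mcoeffU1. Qed.

Definition wcoef p s : K := p@_(FMonom s).

Lemma wcoef_word s s' : wcoef (word s) s' = (s == s')%:R.
Proof. exact: word_coef. Qed.

Lemma wcoefD p q s : wcoef (p + q) s = wcoef p s + wcoef q s.
Proof. exact: mcoeffD. Qed.

Lemma wcoefB p q s : wcoef (p - q) s = wcoef p s - wcoef q s.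
Proof. exact: mcoeffB. Qed.

Lemma wcoefZ c p s : wcoef (c *: p) s = c * wcoef p s.
Proof. exact: mcoeffZ. Qed.

Lemma wcoef_sum (I : Type) (r : seq I) (c : I -> K) (G : I -> F) s :
  wcoef (\sum_(i <- r) c i *: G i) s = \sum_(i <- r) c i * wcoef (G i) s.
Proof.
elim: r => [|i r IH]; first by rewrite !big_nil; exact: mcoeff0.
by rewrite !big_cons wcoefD wcoefZ IH.
Qed.

Lemma wcoefP p q : (forall s, wcoef p s = wcoef q s) -> p = q.
Proof. by move=> e; apply/malgP => -[s]; exact: e. Qed.

Definition order_ge d p := forall w : {fmonom 'I_n}, (fdeg w < d)%N -> p@_w = 0.

Lemma order_ge_wcoef d p s : order_ge d p -> (size s < d)%N -> wcoef p s = 0.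
Proof. by move=> op sd; apply: op. Qed.

Lemma order_geP d p : order_ge d p -> forall w, w \in msupp p -> (d <= fdeg w)%N.
Proof. by move=> op w; rewrite -mcoeff_neq0 leqNgt; apply: contra => /op->. Qed.

Lemma order_ge0 d : order_ge d 0.
Proof. by move=> w _; rewrite mcoeff0. Qed.

Lemma order_geD d p q : order_ge d p -> order_ge d q -> order_ge d (p + q).
Proof. by move=> op oq w dw; rewrite mcoeffD op // oq // addr0. Qed.

Lemma order_geZ d c p : order_ge d p -> order_ge d (c *: p).
Proof. by move=> op w dw; rewrite mcoeffZ op // mulr0. Qed.

Lemma order_geM d e p q : order_ge d p -> order_ge e q -> order_ge (d + e) (p * q).
Proof.
move=> op oq w dw; apply: mcoeff_outdom; apply/negP => /msuppM_le[u [v [pu qv ew]]].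
move: dw; rewrite ew fdegM ltnNge leq_add //; first exact: order_geP pu.
exact: order_geP qv.
Qed.

Lemma order_geW d e p : (d <= e)%N -> order_ge e p -> order_ge d p.
Proof. by move=> de op w wd; apply: op; apply: leq_trans wd de. Qed.

Lemma order_ge_all p : order_ge 0 p. Proof. by []. Qed.

Lemma order_ge_sum d (I : finType) (G : I -> F) :
  (forall i, order_ge d (G i)) -> order_ge d (\sum_i G i).
Proof.
move=> oG; elim/big_ind: _ => //; [exact: order_ge0 | exact: order_geD].
Qed.

Lemma order_ge_word s : order_ge (size s) (word s).
Proof.
move=> w; rewrite fdegE wordE => ws; rewrite mcoeffU1; case: eqP ws => // <-.
by rewrite ltnn.
Qed.

Local Notation one := (@mone {fmonom 'I_n}).

Lemma mul_const p c : p * (c *: 1) = c *: p.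
Proof.
have -> : c *: 1 = << c *g one >> :> F.
  by apply/malgP=> w; rewrite mcoeffZ mcoeff1 mcoeffU mulr_natr eq_sym.
rewrite malgM_def fgmulgU malgZ_def; apply: eq_bigr => w _.
by rewrite mulm1 mulrC.
Qed.

Lemma split_const p : order_ge 1 (p - p@_one *: 1).
Proof.
move=> w; rewrite ltnS leqn0 => /eqP/fdeg_eq0I->.
by rewrite mcoeffB mcoeffZ mcoeff1 eqxx mulr1 subrr.
Qed.

Lemma order_ge_ideal d : two_sided_ideal (order_ge d).
Proof.
split; [exact: order_ge0 | exact: order_geD | move=> p q r oq].
have := order_geM (order_geM (order_ge_all p) oq) (order_ge_all r).
by rewrite addn0.
Qed.

(* The ideal generated by the span of the forms [W s] of degree [N], modulo
   elements of order [> N]. *)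
Lemma truncated_ideal (I : finType) (N : nat) (W : I -> F) :
  (forall i, order_ge N (W i)) ->
  two_sided_ideal (fun p => exists b : I -> K, order_ge N.+1 (p - \sum_i b i *: W i)).
Proof.
move=> oW; split=> [|p q [b hb] [c hc]|p q r [b hb]].
- exists (fun=> 0); rewrite big1 ?subr0; first exact: order_ge0.
  by move=> i _; rewrite scale0r.
- exists (fun i => b i + c i).
  have -> : \sum_i (b i + c i) *: W i = \sum_i b i *: W i + \sum_i c i *: W i.
    by rewrite -big_split; apply: eq_bigr => i _; rewrite scalerDl.
  by rewrite opprD addrACA; exact: order_geD hb hc.
exists (fun i => p@_one * r@_one * b i).
set w := \sum_i b i *: W i in hb.
have ow : order_ge N w by apply: order_ge_sum => i; apply: order_geZ.
have -> : \sum_i (p@_one * r@_one * b i) *: W i = (p@_one *: 1) * w * (r@_one *: 1).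
  rewrite -scalerAl mul1r mul_const scalerA scaler_sumr.
  by apply: eq_bigr => i _; rewrite scalerA [p@_ _ * _]mulrC.
set p0 := p@_one *: 1; set r0 := r@_one *: 1.
have -> : p * q * r - p0 * w * r0 =
   p * (q - w) * r + ((p - p0) * w * r + p0 * w * (r - r0)).
  exact: product_telescope.
apply: order_geD; last apply: order_geD.
- have := order_geM (order_geM (order_ge_all p) hb) (order_ge_all r).
  by rewrite addn0.
- have := order_geM (order_geM (@split_const p) ow) (order_ge_all r).
  by rewrite addn0 add1n.
- have := order_geM (order_geM (order_ge_all p0) ow) (@split_const r).
  by rewrite addn1.
Qed.

Variables (A : algType K) (t : 'I_n -> A).

Lemma feval_linear : linear (feval t).
Proof.
move=> c p q; rewrite /feval mmapD; congr (_ + _).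
rewrite (mmapEw (msuppZ_le _ _)) mmapE scaler_sumr.
by apply: eq_bigr => w _; rewrite mcoeffZ /= -scalerA scalerAl.
Qed.

Lemma feval_word s : feval t (word s) = \prod_(i <- s) t i.
Proof. by rewrite /feval wordE mmapU /= scale1r mul1r. Qed.

End FreeAlgebra.

(** * Graded actions on presented algebras *)

Section GradedAction.
Variables (K : fieldType) (n : nat) (rels : seq (free_algebra K n)).
Variables (A : algType K) (t : 'I_n -> A) (presA : presented_by t rels).
Variables (H : fdHopfType K) (act : H -> A -> A).
Hypotheses (actA : module_algebra act) (graded : preserves_grading act t).
Local Notation D := (hdual H).

Let actD h : linear (act h). Proof. exact: (mact_bilinear actA).1. Qed.
Let actDl x : linear (act^~ x). Proof. exact: (mact_bilinear actA).2. Qed.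

Definition acts_by (I : finType) (a : I -> I -> D) (u : I -> A) :=
  forall h i, act h (u i) = \sum_j ev (a j i) h *: u j.

Lemma acts_by_tensor (I J : finType) (a : I -> I -> D) (b : J -> J -> D) u v :
  acts_by a u -> acts_by b v ->
  acts_by (fun p q => a p.1 q.1 * b p.2 q.2) (fun p : I * J => u p.1 * v p.2).
Proof.
move=> au bv h q; rewrite (mact_mul actA) -/(sw _ h).
have lu : bilinear_map (fun h1 h2 => act h1 (u q.1) * act h2 (v q.2)).
  by split=> x; [apply: lin_mulr | apply: lin_mull].
rewrite sw_hitr //.
transitivity (\sum_i \sum_j (\sum_l ev (a i q.1) (hitr (hcoord l) h) *
   ev (b j q.2) (hbasis l)) *: (u i * v j)).
  transitivity (\sum_l \sum_i \sum_j (ev (a i q.1) (hitr (hcoord l) h) *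
     ev (b j q.2) (hbasis l)) *: (u i * v j)).
    apply: eq_bigr => l _; rewrite au bv mulr_suml; apply: eq_bigr => i _.
    rewrite mulr_sumr; apply: eq_bigr => j _.
    by rewrite -scalerAl -scalerAr scalerA.
  rewrite exchange_big; apply: eq_bigr => i _; rewrite exchange_big.
  by apply: eq_bigr => j _; rewrite scaler_suml.
rewrite pair_bigA; apply: eq_bigr => -[i j] _ /=; congr (_ *: _).
rewrite evM [b j q.2 in RHS]hdual_expand (lin_sum _ _ _ (hitrPl h)) linear_sum.
by apply: eq_bigr => l _; rewrite linearZ mulrC.
Qed.

Hypothesis rels2 : forall r, r \in rels -> order_ge 2 r.

(** Elements of order at least 2 form an ideal containing the relations, so no nonzero linear form
    is a relation. *)
Lemma generators_free (c : 'I_n -> K) : \sum_i c i *: t i = 0 -> forall i, c i = 0.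
Proof.
move=> c0 i; have := (presA.2 (\sum_i c i *: word K [:: i])).1.
rewrite (lin_sum _ _ _ (feval_linear t)) /=.
under eq_bigr do rewrite feval_word big_seq1.
move=> /(_ c0)/(_ _ (order_ge_ideal K n 2) rels2) o.
have := @order_ge_wcoef _ _ _ _ [:: i] o (ltnSn 1).
rewrite wcoef_sum (bigD1 i) //= wcoef_word eqxx mulr1 big1 ?addr0 // => j ne.
by rewrite wcoef_word eqseq_cons andbT (negPf ne) mulr0.
Qed.

(** A boolean equation on finite functions, so that [xchoose] can select the coefficients. *)
Lemma linear_piece x : graded_piece t 1 x -> exists c : {ffun 'I_n -> K}, x == \sum_i c i *: t i.
Proof.
case=> p dp <-; exists [ffun i => wcoef p [:: i]].
have {1}-> : p = \sum_i wcoef p [:: i] *: word K [:: i].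
  apply: wcoefP => s; rewrite wcoef_sum.
  have [p0|ps] := eqVneq (wcoef p s) 0.
    rewrite p0 big1 // => i _; rewrite wcoef_word.
    by case: eqP => [->|_]; rewrite ?p0 ?mul0r ?mulr0.
  have : size s = 1%N by rewrite -(dp (FMonom s)) // -mcoeff_neq0.
  case: s ps => [|i [|//]] //= _ _.
  rewrite (bigD1 i) //= wcoef_word eqxx mulr1 big1 ?addr0 // => j ne.
  by rewrite wcoef_word eqseq_cons andbT (negPf ne) mulr0.
rewrite (lin_sum _ _ _ (feval_linear t)); apply/eqP; apply: eq_bigr => i _.
by rewrite ffunE feval_word big_seq1.
Qed.

Lemma generator_piece i : graded_piece t 1 (t i).
Proof.
exists (word K [:: i]); last by rewrite feval_word big_seq1.
by move=> w; rewrite wordE msuppU1 in_fset1 => /eqP->; rewrite fdegE.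
Qed.

Lemma generators_corep : exists2 a : 'I_n -> 'I_n -> D, corep a & acts_by a t.
Proof.
pose ex h i := linear_piece (graded h (generator_piece i)).
pose cf h i : {ffun 'I_n -> K} := xchoose (ex h i).
have hx h i : act h (t i) = \sum_j cf h i j *: t j.
  exact/eqP/(xchooseP (ex h i)).
move: cf hx => cf hx; pose a j i : D := dualfun (fun h => cf h i j).
have uni (c d : 'I_n -> K) : \sum_i c i *: t i = \sum_i d i *: t i -> c =1 d.
  move=> e i; apply/eqP; rewrite -subr_eq0; apply/eqP.
  apply: (generators_free (c := fun i => c i - d i)).
  under eq_bigr do rewrite scalerBl; by rewrite sumrB e subrr.
have aE h j i : ev (a j i) h = cf h i j.
  rewrite dualfunE // => c u v.
  apply: (uni (fun j => cf (c *: u + v) i j)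
              (fun j => c * cf u i j + cf v i j)).
  rewrite -hx actDl !hx scaler_sumr -big_split; apply: eq_bigr => l _ /=.
  by rewrite scalerA scalerDl.
have aa : acts_by a t by move=> h i; rewrite hx; apply: eq_bigr => j _; rewrite aE.
exists a => //; split=> [i j|i j x y].
  apply: (uni (fun i => ev (a i j) 1) (fun i => (i == j)%:R)).
  rewrite -aa (mact1 actA) (bigD1 j) //= eqxx scale1r big1 ?addr0 // => l ne.
  by rewrite (negPf ne) scale0r.
apply: (uni (fun i => ev (a i j) (x * y))
            (fun i => \sum_k ev (a i k) x * ev (a k j) y)).
rewrite -aa (mactM actA) aa (lin_sum _ _ _ (actD x)).
under eq_bigr do rewrite aa scaler_sumr.
rewrite exchange_big; apply: eq_bigr => l _ /=; rewrite scaler_suml.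
by apply: eq_bigr => m _; rewrite scalerA mulrC.
Qed.

Variables (T : finType) (wd : T -> seq 'I_n) (N : nat) (J : finType).
Variables (rho : J -> T -> K) (w : 'I_n -> T -> K).
Variables (C : 'I_n -> J -> K) (C' : J -> 'I_n -> K).
Hypotheses (wd_inj : injective wd) (wd_size : forall s, size (wd s) = N).
Hypothesis rels_rho : forall r, r \in rels -> exists j, r = \sum_s rho j s *: word K (wd s).
Hypothesis rho_rels : forall j, \sum_s rho j s *: word K (wd s) \in rels.
Hypothesis w_rho : forall i s, w i s = \sum_j C i j * rho j s.
Hypothesis rho_w : forall j s, rho j s = \sum_i C' j i * w i s.

Let wA s := \prod_(i <- wd s) t i.

(** Membership in the ideal of relations is tested on the larger ideal of [truncated_ideal], whose
    elements agree with a combination of the [W i] up to order above $N$; comparing coefficients of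
    words of length $N$ gives [b]. *)
Lemma degree_relation (z : T -> K) : \sum_s z s *: wA s = 0 ->
  exists b : 'I_n -> K, forall s, z s = \sum_i w i s * b i.
Proof.
move=> z0; pose W i := \sum_s w i s *: word K (wd s).
have oW i : order_ge N (W i).
  by apply: order_ge_sum => s; apply: order_geZ; rewrite -(wd_size s); exact: order_ge_word.
have := (presA.2 (\sum_s z s *: word K (wd s))).1.
rewrite (lin_sum _ _ _ (feval_linear t)) /=.
under eq_bigr do rewrite feval_word.
move=> /(_ z0)/(_ _ (truncated_ideal oW)) [].
  move=> r /rels_rho[j ->]; exists (C' j).
  have -> : \sum_i C' j i *: W i = \sum_s rho j s *: word K (wd s).
    under eq_bigr do rewrite scaler_sumr; rewrite exchange_big; apply: eq_bigr => s _ /=.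
    by rewrite rho_w scaler_suml; apply: eq_bigr => i _; rewrite scalerA.
  by rewrite subrr; exact: order_ge0.
move=> b hb; exists b => s.
have := @order_ge_wcoef _ _ _ _ (wd s) hb; rewrite wd_size ltnSn => /(_ isT).
have coef (f : T -> K) : wcoef (\sum_s' f s' *: word K (wd s')) (wd s) = f s.
  rewrite wcoef_sum (bigD1 s) //= wcoef_word eqxx mulr1 big1 ?addr0 // => s' ne.
  by rewrite wcoef_word (inj_eq wd_inj) (negPf ne) mulr0.
rewrite -scaleN1r wcoefD wcoefZ coef mulN1r => /eqP; rewrite subr_eq0 => /eqP->.
by rewrite wcoef_sum; apply: eq_bigr => i _ /=; rewrite coef mulrC.
Qed.

Lemma relation_zero i : \sum_s w i s *: wA s = 0.
Proof.
transitivity (\sum_j C i j *: \sum_s rho j s *: wA s).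
  under [RHS]eq_bigr do rewrite scaler_sumr; rewrite exchange_big; apply: eq_bigr => s _ /=.
  by rewrite w_rho scaler_suml; apply: eq_bigr => j _; rewrite scalerA.
apply: big1 => j _.
have := (presA.2 _).2 (fun J _ h => h _ (rho_rels j)).
rewrite (lin_sum _ _ _ (feval_linear t)) /=.
under eq_bigr do rewrite feval_word.
by move=> ->; rewrite scaler0.
Qed.

Lemma relations_stable (B : T -> T -> D) : acts_by B wA ->
  forall z i, exists b : 'I_n -> K, forall s,
    \sum_s' w i s' * ev (B s s') z = \sum_j w j s * b j.
Proof.
move=> actB z i; apply: degree_relation.
transitivity (act z (\sum_s w i s *: wA s)); last first.
  by rewrite relation_zero (lin0 (actD z)).
rewrite (lin_sum _ _ _ (actD z)); under [RHS]eq_bigr do rewrite actB scaler_sumr.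
rewrite exchange_big; apply: eq_bigr => s _ /=; rewrite scaler_suml.
by apply: eq_bigr => s' _; rewrite scalerA.
Qed.

End GradedAction.

(** * Commuting characters and group algebras *)

Section FiniteOrderMatrices.
Variables (k : closedFieldType) (char0 : [pchar k] =i pred0).

Lemma finite_order_diagonalizable (n m : nat) (M : 'M[k]_n) : (0 < m)%N ->
  iter m (mulmx M) 1%:M = 1%:M -> diagonalizable M.
Proof.
case: n M => [|n] M m0 eM.
  by exists 1%:M; rewrite ?unitmx1 //; apply/diagonalizable_forPp => -[].
have [r er] := closed_field_poly_normal ('X^m - 1 : {poly k}).
apply/diagonalizableP; exists r.
  have : separable_poly ('X^m - 1 : {poly k}).
    by apply: separable_Xn_sub_1; rewrite (pcharf0P k).1 // -lt0n.
  by rewrite er (monicP _) ?monicXnsubC // scale1r separable_prod_XsubC.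
move: er; rewrite (monicP _) ?monicXnsubC // scale1r => <-.
apply: mxminpoly_min; rewrite rmorphB rmorph1 rmorphXn /= horner_mx_X.
apply/eqP; rewrite subr_eq0 -[X in _ == X]eM; apply/eqP.
by elim: (m) => [//|j IH]; rewrite iterS -IH exprS.
Qed.

End FiniteOrderMatrices.

Section TensorSubspace.
Variables (K : fieldType).

Lemma tens_tensv (U V : vectType K) (U' : {vspace U}) (V' : {vspace V}) u v :
  u \in U' -> v \in V' -> tens u v \in tensv U' V'.
Proof.
move=> uU vV; rewrite (coord_vbasis uU) (coord_vbasis vV).
rewrite bilinear_comb; last exact: tens_bilinear.
apply: memv_suml => i _; apply: memv_suml => j _; apply/memvZ/memv_span.
by apply/allpairsP; exists ((vbasis U')`_i, (vbasis V')`_j);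
   rewrite !mem_nth ?size_tuple.
Qed.

Lemma swD (H : fdHopfType K) (X : lmodType K) (B C : H -> H -> X) x :
  sw (fun a b => B a b + C a b) x = sw B x + sw C x.
Proof.
rewrite /sw /tlift -big_split; apply: eq_bigr => i _ /=.
by rewrite -big_split; apply: eq_bigr => j _ /=; rewrite scalerDr.
Qed.

Lemma sw_ev (H : fdHopfType K) (X : lmodType K) (f g : hdual H) (c : X) x :
  sw (fun a b => (ev f a * ev g b) *: c) x = ev (f * g) x *: c.
Proof.
rewrite evM /hitr (@sw_linear _ _ _ _ (fun u => ev f u *: c)); last by lin.
by apply: eq_sw => a b; rewrite linearZ mulrC.
Qed.

Lemma dual_basis (H : fdHopfType K) (s : seq (hdual H)) : free s ->
  exists d : 'I_(size s) -> H, forall i j : 'I_(size s), ev s`_i (d j) = (i == j)%:R.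
Proof.
move=> fs; pose M := \matrix_(i < size s, l < \dim {:H}) ev s`_i (hbasis l).
have fM : row_free M.
  rewrite -kermx_eq0; apply/rowV0P => c /sub_kermxP cM; apply/rowP => i.
  rewrite mxE; have /(_ (fun i => c 0 i)) := elimT freeP (fs : free (in_tuple s)).
  apply; apply: hdualP => x; rewrite (hcoordE x) !linear_sum; apply: eq_bigr => l _.
  rewrite !linearZ /=; congr (_ * _); move/matrixP/(_ 0 l): cM; rewrite !mxE.
  have -> : ev 0 (hbasis l) = 0 by rewrite /ev lfunE.
  move=> <-; rewrite ev_sum; apply: eq_bigr => j _; by rewrite evZl mxE.
exists (fun j => \sum_l pinvmx M l j *: hbasis l) => i j.
have /matrixP/(_ i j) := mulmxVp fM; rewrite !mxE => <-.
by rewrite linear_sum; apply: eq_bigr => l _; rewrite linearZ /= [M _ _]mxE mulrC.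
Qed.

End TensorSubspace.

(** * Diagonal actions and separation of points *)

Section DiagonalAction.
Variables (K : fieldType) (n : nat) (rels : seq (free_algebra K n)).
Variables (A : algType K) (t : 'I_n -> A) (presA : presented_by t rels).
Variables (H : fdHopfType K) (act : H -> A -> A).
Hypotheses (actA : module_algebra act) (faithful : inner_faithful act).
Local Notation D := (hdual H).
Local Notation S := (@antipode K H).

Lemma act_mul_eigen f g (x y : A) :
  (forall h, act h x = ev f h *: x) -> (forall h, act h y = ev g h *: y) ->
  forall h, act h (x * y) = ev (f * g) h *: (x * y).
Proof.
move=> ex ey h; have := @acts_by_tensor _ _ _ act actA unit unit
  (fun _ _ => f) (fun _ _ => g) (fun _ => x) (fun _ => y).
have one (f' : D) z : (forall h, act h z = ev f' h *: z) ->
    acts_by act (fun _ _ : unit => f') (fun _ => z).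
  by move=> e h' i; rewrite e (bigD1 tt) //= big1 ?addr0 // => -[] /eqP.
move=> /(_ (one _ _ ex) (one _ _ ey) h (tt, tt)) ->.
by rewrite (bigD1 (tt, tt)) //= big1 ?addr0 // => -[[] []] /eqP.
Qed.

Variable g : 'I_n -> D.
Hypotheses (gC : forall i, character (g i)).
Hypothesis actg : forall h i, act h (t i) = ev (g i) h *: t i.

Local Notation gword s := (\prod_(i <- s) g i).

Lemma act_word s h : act h (\prod_(i <- s) t i) = ev (gword s) h *: \prod_(i <- s) t i.
Proof.
elim: s h => [|i s IH] h; first by rewrite !big_nil (mact_unit actA) ev1.
by rewrite !big_cons; apply: act_mul_eigen.
Qed.

Lemma gword_character s : character (gword s).
Proof.
elim: s => [|i s IH]; first by rewrite big_nil; exact: character1.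
by rewrite big_cons; exact: characterM.
Qed.

(* Distinct characters are independent, so the words in the [g i] form a
   finite set. *)
Lemma gword_finite : exists s : seq D, [/\ uniq s,
  forall f, f \in s -> exists u, f = gword u & forall u, gword u \in s].
Proof.
have bound (s : seq D) : uniq s -> (forall f, f \in s -> exists u, f = gword u) ->
    (size s <= \dim {:D})%N.
  move=> us ws; have fs : free s.
    by apply: character_free => // f /ws[u ->]; exact: gword_character.
  by move: fs; rewrite /free => /eqP<-; apply: dimvS (subvf _).
suff [s [us ws s1 cl]] : exists s : seq D, [/\ uniq s,
    forall f, f \in s -> exists u, f = gword u, 1 \in s &
    forall f i, f \in s -> g i * f \in s].
  exists s; split=> // u; elim: u => [|i u IH]; first by rewrite big_nil.
  by rewrite big_cons; exact: cl.
have [N] := ubnP (\dim {:D} - size [:: 1 : D]).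
have: 1 \in [:: 1 : D] by rewrite inE.
have: forall f, f \in [:: 1 : D] -> exists u, f = gword u.
  by move=> f; rewrite inE => /eqP->; exists [::]; rewrite big_nil.
have: uniq [:: 1 : D] by [].
move: [:: 1 : D] => s.
elim: N s => [//|N IH] s us ws s1 sN.
have [/allP cl|/allPn[f fs]] := boolP (all (fun f => [forall i, g i * f \in s]) s).
  by exists s; split=> // f i /cl/forallP.
case/forallPn => i fi; apply: (IH (g i * f :: s)); rewrite /= ?fi ?inE ?s1 ?orbT //.
  move=> f'; rewrite inE => /orP[/eqP->|/ws//]; have [u ->] := ws f fs.
  by exists (i :: u); rewrite big_cons.
have := bound (g i * f :: s); rewrite /= fi us => /(_ isT) le.
have {}le : (size s < \dim {:D})%N.
  apply: le => f'; rewrite inE => /orP[/eqP->|/ws//]; have [u ->] := ws f fs.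
  by exists (i :: u); rewrite big_cons.
by rewrite -ltnS (leq_trans _ sN) // ltnS subnS prednK ?subn_gt0.
Qed.

(** The common kernel [I] of the characters in [s] annihilates every word in the generators, hence
    $A$. It is a Hopf ideal because [s] is closed under products, so inner faithfulness makes it
    zero. *)
Lemma gword_separates (s : seq D) : uniq s ->
  (forall f, f \in s -> exists u, f = gword u) -> (forall u, gword u \in s) ->
  forall x, (forall f, f \in s -> ev f x = 0) -> x = 0.
Proof.
move=> us ws sg.
have cs f : f \in s -> character f by move=> /ws[u ->]; exact: gword_character.
pose I : {vspace H} := (\bigcap_(i < size s) lker (s`_i : 'Hom(H, K^o)))%VS.
have IP x : reflect (forall f, f \in s -> ev f x = 0) (x \in I).
  rewrite /I; apply: (iffP idP) => [xI f /(nthP 0)[i si <-]|e].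
    have /subvP/(_ _ xI) := bigcapv_inf (Ordinal si) (isT) (subvv _)
      : (I <= lker (s`_(Ordinal si) : 'Hom(H, K^o)))%VS.
    by rewrite memv_ker => /eqP.
  rewrite -[x \in _]/(_ <= _)%VS; apply/subv_bigcapP => i _.
  by rewrite -memvE memv_ker; apply/eqP/e/mem_nth.
suff I0 : I = 0%VS by move=> x /IP; rewrite I0 memv0 => /eqP.
apply: faithful; last first.
  move=> h x /IP hI; have [p <-] := presA.1 x.
  have -> : feval t p = \sum_(w <- msupp p) p@_w *: \prod_(i <- w) t i.
    by rewrite /feval mmapE; apply: eq_bigr => w _; rewrite /= -scalerAl mul1r.
  rewrite (lin_sum _ _ _ ((mact_bilinear actA).1 h)) big1 // => w _.
  by rewrite act_word hI ?scale0r ?scaler0.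
have [d dE] := dual_basis (character_free us cs).
(* A projection along [I] onto a complement. Splitting $a \otimes b$ by $q$ leaves, besides terms in
   $I \otimes H + H \otimes I$, only $q(a) \otimes q(b)$; its coefficients on $\Delta(h)$ are the
   values at $h$ of products of elements of [s]. *)
pose q x := \sum_(i < size s) ev s`_i x *: d i.
have pI x : x - q x \in I.
  apply/IP => f /(nthP 0)[i si <-].
  rewrite linearB linear_sum (bigD1 (Ordinal si)) //= linearZ /=.
  rewrite (dE (Ordinal si)) eqxx mulr1 big1 ?addr0 ?subrr // => j ne.
  by rewrite linearZ /= (dE (Ordinal si)) eq_sym (negPf ne) mulr0.
have sM f f' : f \in s -> f' \in s -> f * f' \in s.
  by move=> /ws[u ->] /ws[u' ->]; rewrite -big_cat.
have s1 : 1 \in s by have := sg [::]; rewrite big_nil.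
split=> [y x /IP xI|y x /IP xI|h /IP hI|x /IP xI|x /IP xI].
- by apply/IP => f fs; rewrite (cs f fs).2 xI ?mulr0.
- by apply/IP => f fs; rewrite (cs f fs).2 xI ?mul0r.
- have -> : comul h = sw (fun a b => tens (a - q a) b) h +
     sw (fun a b => tens (q a) (b - q b)) h.
    rewrite -[LHS]tlift_id -/(sw _ h).
    transitivity (sw (fun a b => tens (a - q a) b +
       (tens (q a) (b - q b) + tens (q a) (q b))) h).
      apply: eq_sw => a b; have [B1 B2] := tens_bilinear H H.
      have := B1 (q a) 1 (b - q b) (q b); rewrite !scale1r subrK => <-.
      have := B2 b 1 (a - q a) (q a); rewrite !scale1r subrK => <-.
      by [].
    rewrite !swD; congr (_ + _).
    rewrite -[RHS]addr0; congr (_ + _).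
    transitivity (\sum_(i < size s) \sum_(j < size s)
       ev (s`_i * s`_j) h *: tens (d i) (d j)).
      transitivity (sw (fun a b => \sum_(i < size s) \sum_(j < size s)
         (ev s`_i a * ev s`_j b) *: tens (d i) (d j)) h).
        by apply: eq_sw => a b; rewrite bilinear_comb //; exact: tens_bilinear.
      rewrite sw_sum; apply: eq_bigr => i _; rewrite sw_sum; apply: eq_bigr => j _.
      exact: sw_ev.
    apply: big1 => i _; apply: big1 => j _.
    by rewrite hI ?scale0r //; apply: sM; apply: mem_nth.
  apply: memv_add; apply: memv_suml => i _; apply: memv_suml => j _; apply/memvZ/tens_tensv;
    rewrite ?memvf //; exact: pI.
- by rewrite -ev1 xI.
- apply/IP => f fs; rewrite -dSE xI //.
  have [m m0 fm] := character_order (cs f fs).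
  (* Closure under products yields inverses because each character has finite order. *)
  have -> : dS f = f ^+ m.-1.
    rewrite -[RHS]mul1r -(character_antipodel (cs f fs)) -mulrA -exprS prednK //.
    by rewrite fm mulr1.
  elim: m.-1 => [|j IHj]; last by rewrite exprS; exact: sM.
  by rewrite expr0.
Qed.

End DiagonalAction.

(** * The group algebra on a basis of group-like elements *)

Section GroupLikeGroup.
Variables (K : fieldType) (H : fdHopfType K).

(** The operations are bundled with the family so that its index set [gl_type B] can carry a
    declared group structure. *)
Record grouplike_family := GroupLikeFamily {
  gl_dim : nat;
  gl_elt : 'I_gl_dim -> H;
  gl_mul : 'I_gl_dim -> 'I_gl_dim -> 'I_gl_dim;
  gl_one : 'I_gl_dim;
  gl_inv : 'I_gl_dim -> 'I_gl_dim;
  gl_inj : injective gl_elt;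
  gl_mulE : forall i j, gl_elt (gl_mul i j) = gl_elt i * gl_elt j;
  gl_oneE : gl_elt gl_one = 1;
  gl_invE : forall i, gl_elt (gl_inv i) * gl_elt i = 1
}.

Variable B : grouplike_family.

Definition gl_type : Type := 'I_(gl_dim B).
HB.instance Definition _ := Finite.copy gl_type 'I_(gl_dim B).

Lemma gl_mulA : associative (@gl_mul B).
Proof. by move=> i j l; apply: gl_inj; rewrite !gl_mulE mulrA. Qed.
Lemma gl_mul1 : left_id (gl_one B) (@gl_mul B).
Proof. by move=> i; apply: gl_inj; rewrite gl_mulE gl_oneE mul1r. Qed.
Lemma gl_mulV : left_inverse (gl_one B) (@gl_inv B) (@gl_mul B).
Proof. by move=> i; apply: gl_inj; rewrite gl_mulE gl_oneE gl_invE. Qed.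

HB.instance Definition _ := Finite_isGroup.Build gl_type gl_mulA gl_mul1 gl_mulV.

Variable b : (gl_dim B).-tuple H.
Hypotheses (bB : forall i : 'I_(gl_dim B), b`_i = gl_elt i) (bb : basis_of {:H} b).
Hypothesis gB : forall i, grouplike (@gl_elt B i).

Local Notation G := (group_algebra K gl_type).
Local Notation cf := (coord b).

Lemma gl_expand x : x = \sum_i cf i x *: gl_elt i.
Proof. by rewrite {1}(coord_basis bb (memvf x)); apply: eq_bigr => i _; rewrite bB. Qed.

Lemma gl_coord i j : cf i (gl_elt j) = (i == j)%:R.
Proof. by rewrite -bB coord_free ?(basis_free bb) // eq_sym. Qed.

Definition gl_iso (x : H) : G := [ffun i => cf i x].

Lemma gl_iso_linear : linear gl_iso.
Proof. by move=> a x y; apply/ffunP => i; rewrite !ffunE linearP. Qed.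

Lemma gl_isoE i : gl_iso (gl_elt i) = gelt K (i : gl_type).
Proof. by apply/ffunP => j; rewrite !ffunE gl_coord. Qed.

Lemma gl_ext (X : lmodType K) (F F' : H -> X) : linear F -> linear F' ->
  (forall i, F (@gl_elt B i) = F' (gl_elt i)) -> F =1 F'.
Proof.
move=> lF lF' e x; rewrite (gl_expand x) (lin_sum _ _ _ lF) (lin_sum _ _ _ lF').
by apply: eq_bigr => i _; rewrite e.
Qed.

Lemma gl_isoM : monoid_morphism gl_iso.
Proof.
have [mr ml] := @gmul_bilinear K gl_type.
split; first by rewrite -(gl_oneE B) gl_isoE.
move=> x y.
have l1 u : linear (fun v => gl_iso (u * v)).
  by move=> a v w; rewrite mulrDr -scalerAr gl_iso_linear.
have l2 v : linear (fun u => gl_iso (u * v)).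
  by move=> a u w; rewrite mulrDl -scalerAl gl_iso_linear.
have l3 u : linear (fun v => gl_iso u * gl_iso v).
  by move=> a v w; rewrite gl_iso_linear mr.
have l4 v : linear (fun u => gl_iso u * gl_iso v).
  by move=> a u w; rewrite gl_iso_linear ml.
apply: (gl_ext (l1 x) (l3 x)) => j; apply: (gl_ext (l2 _) (l4 _)) => i.
by rewrite -gl_mulE !gl_isoE -geltM.
Qed.

Lemma gl_iso_bij : bijective gl_iso.
Proof.
exists (fun f : G => \sum_(i < gl_dim B) f i *: gl_elt i) => [x|f].
  by rewrite [RHS]gl_expand; apply: eq_bigr => i _; rewrite ffunE.
apply/ffunP => i; rewrite ffunE linear_sum (bigD1 i) //= linearZ /= gl_coord eqxx.
rewrite mulr1 big1 ?addr0 // => j ne.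
by rewrite linearZ /= gl_coord eq_sym (negPf ne) mulr0.
Qed.

Lemma gl_hopf_isomorphic : hopf_isomorphic H G.
Proof.
pose f : {lrmorphism H -> G} := HB.pack gl_iso
  (GRing.isLinear.Build K H G *:%R gl_iso gl_iso_linear)
  (GRing.isMonoidMorphism.Build H G gl_iso gl_isoM).
exists f; first exact: gl_iso_bij.
have lf : linear gl_iso := gl_iso_linear.
split=> h.
- apply: (@gl_ext _ (fun x => comul (gl_iso x)) (fun x => sw (fun a b => tens (gl_iso a) (gl_iso b)) x)).
  + by move=> a x y; rewrite gl_iso_linear linearP.
  + by lin.
  + move=> i; rewrite grouplike_sw //; last by lin.
    rewrite gl_isoE; exact: gcomulE.
- have := @gl_ext K^o (fun x => counit (gl_iso x)) (fun x => counit x).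
  apply; [by move=> a x y; rewrite gl_iso_linear linearP|by move=> a x y; rewrite linearP|].
  by move=> i; rewrite gl_isoE (gB i).1; exact: gcounitE.
- apply: (@gl_ext _ (fun x => antipode (gl_iso x)) (fun x => gl_iso (antipode x))).
  + by move=> a x y; rewrite gl_iso_linear linearP.
  + by move=> a x y; rewrite linearP gl_iso_linear.
  + move=> i; rewrite gl_isoE.
    have -> : antipode (gl_elt i) = gl_elt (gl_inv i).
      rewrite -[LHS]mul1r -(gl_invE i) -mulrA (grouplike_antipoder (gB i)).
      by rewrite mulr1.
    rewrite gl_isoE; exact: gantipodeE.
Qed.

End GroupLikeGroup.

(** * Hopf algebras separated by commuting characters *)

Section Separated.
Variables (k : closedFieldType) (char0 : [pchar k] =i pred0) (H : fdHopfType k).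
Variable s : seq (hdual H).
Hypotheses (us : uniq s) (cs : forall f, f \in s -> character f).
Hypothesis ss : forall x, (forall f, f \in s -> ev f x = 0) -> x = 0.
Hypothesis sC : forall f g, f \in s -> g \in s -> f * g = g * f.
Local Notation d := (\dim {:H}).

Let Mx (f : hdual H) : 'M[k]_d := \matrix_(i, j) ev (hcoord j) (hitr f (hbasis i)).

Lemma hcoord_basis i j : ev (hcoord i) (@hbasis k H j) = (i == j)%:R.
Proof.
by rewrite mkdualE /= (coord_free _ _ (basis_free (vbasisP _))) eq_sym.
Qed.

(** The matrices act on row vectors, which reverses the product. *)
Lemma MxM f g : Mx f *m Mx g = Mx (g * f).
Proof.
apply/matrixP => i j; rewrite !mxE hitrM [hitr f _ in RHS]hcoordE.
rewrite (lin_sum _ _ _ (hitrP g)) linear_sum; apply: eq_bigr => l _.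
by rewrite !mxE linearZ.
Qed.

Lemma Mx1 : Mx 1 = 1%:M.
Proof. by apply/matrixP => i j; rewrite !mxE hitr_counit hcoord_basis eq_sym. Qed.

Lemma MxX f m : iter m (mulmx (Mx f)) 1%:M = Mx (f ^+ m).
Proof. by elim: m => [|m IH]; rewrite ?Mx1 // iterS IH MxM exprSr. Qed.

Lemma common_eigenbasis : exists2 v : 'I_d -> H,
  (forall j, v j != 0 /\ forall f, f \in s -> exists c, hitr f (v j) = c *: v j) &
  (forall x, exists c, x = \sum_j c j *: v j).
Proof.
have : codiagonalizable [seq Mx f | f <- s].
  apply/codiagonalizableP; split.
    move=> _ _ /mapP[f fs ->] /mapP[g gs ->].
    by rewrite /comm_mx !MxM sC.
  move=> _ /mapP[f fs ->]; have [m m0 fm] := character_order (cs fs).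
  by apply: (finite_order_diagonalizable char0 m0); rewrite MxX fm Mx1.
case=> P Pu /allP PD; pose v j := \sum_i P j i *: @hbasis k H i.
have vE j i : ev (hcoord i) (v j) = P j i.
  rewrite linear_sum (bigD1 i) //= linearZ /= hcoord_basis eqxx mulr1 big1 ?addr0 // => l ne.
  by rewrite linearZ /= hcoord_basis eq_sym (negPf ne) mulr0.
exists v => [j|x].
  split=> [|f fs].
    apply/eqP => v0; have /matrixP/(_ j j) := mulmxV Pu; rewrite !mxE eqxx big1 => [/eqP|i _].
      by rewrite eq_sym oner_eq0.
    by rewrite -vE v0 linear0 mul0r.
  have := PD _ (map_f Mx fs) => /diagonalizable_forPex[D /(simmxP Pu) PDE].
  exists (D 0 j); rewrite [RHS]hcoordE [LHS]hcoordE; apply: eq_bigr => l _; congr (_ *: _).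
  rewrite linearZ /= vE /v (lin_sum _ _ _ (hitrP f)) linear_sum.
  move/matrixP/(_ j l): PDE; rewrite mul_diag_mx !mxE => <-.
  by apply: eq_bigr => i _; rewrite linearZ mxE.
exists (fun j => \sum_l ev (hcoord l) x * invmx P l j).
rewrite [LHS]hcoordE /v.
under [RHS]eq_bigr do rewrite scaler_sumr.
rewrite exchange_big; apply: eq_bigr => l _ /=.
under eq_bigr do rewrite scalerA; rewrite -scaler_suml; congr (_ *: _).
under eq_bigr do rewrite mulr_suml; rewrite exchange_big /=.
rewrite (bigD1 l) //= [X in _ + X]big1 ?addr0 => [|i ne].
  under eq_bigr do rewrite -mulrA; rewrite -mulr_sumr.
  by have /matrixP/(_ l l) := mulVmx Pu; rewrite !mxE eqxx => ->; rewrite mulr1.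
under eq_bigr do rewrite -mulrA; rewrite -mulr_sumr.
by have /matrixP/(_ i l) := mulVmx Pu; rewrite !mxE (negPf ne) => ->; rewrite mulr0.
Qed.

Lemma dual_spanned (F : hdual H) : exists c : 'I_(size s) -> k, F = \sum_i c i *: s`_i.
Proof.
have [e eE] := dual_basis (character_free us cs).
exists (fun i => ev F (e i)); apply: hdualP => x.
have -> : x = \sum_(i < size s) ev s`_i x *: e i.
  apply/eqP; rewrite -subr_eq0; apply/eqP/ss => f /(nthP 0)[i si <-].
  rewrite linearB linear_sum (bigD1 (Ordinal si)) //= linearZ /=.
  rewrite (eE (Ordinal si)) eqxx mulr1 big1 ?addr0 ?subrr // => j ne.
  by rewrite linearZ /= (eE (Ordinal si)) eq_sym (negPf ne) mulr0.
rewrite ev_sum linear_sum; apply: eq_bigr => j _.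
rewrite evZl linearZ /= mulrC linear_sum (bigD1 j) //= linearZ /= eE eqxx mulr1.
by rewrite big1 ?addr0 // => i ne; rewrite linearZ /= eE eq_sym (negPf ne) mulr0.
Qed.

(** The characters in [s] span the dual, so [v] is an eigenvector of every [hitr F]. If its counit
    were zero, every functional would vanish on it; once the counit is normalised to 1, the
    eigenvalue of [hitr F] is $F(v)$, which is group-likeness. *)
Lemma eigen_grouplike (v : H) : v != 0 ->
  (forall f, f \in s -> exists c, hitr f v = c *: v) ->
  exists2 x, grouplike x & exists c, v = c *: x.
Proof.
move=> v0 ev0.
have evF F : exists c, hitr F v = c *: v.
  have [c ->] := dual_spanned F; rewrite (lin_sum _ _ _ (hitrPl v)).
  elim/big_ind: _ => [|x y [a ->] [b ->]|i _]; first by exists 0; rewrite scale0r.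
    by exists (a + b); rewrite scalerDl.
  have [a ->] := ev0 s`_i (mem_nth _ (ltn_ord i)).
  by exists (c i * a); rewrite scalerA.
have e0 : counit v != 0.
  apply: contra v0 => /eqP e0; apply/eqP/ev_inj => F; rewrite linear0.
  have [c cE] := evF F; rewrite -[F]mul1r evM cE linearZ /= ev1 e0.
  by rewrite mulr0.
exists ((counit v)^-1 *: v); last by exists (counit v); rewrite scalerA divff ?scale1r.
have x1 : counit ((counit v)^-1 *: v) = 1 by rewrite linearZ /= mulVf.
split=> // F G; have [c cE] := evF G.
have cE' : hitr G ((counit v)^-1 *: v) = c *: ((counit v)^-1 *: v).
  by rewrite hitrZ cE !scalerA mulrC.
have -> : ev G ((counit v)^-1 *: v) = c.
  by rewrite -[G]mul1r evM cE' [LHS]linearZ /= ev1 x1 mulr1.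
by rewrite evM cE' [LHS]linearZ /= mulrC.
Qed.

Lemma separated_commutative (x y : H) : x * y = y * x.
Proof.
apply/eqP; rewrite -subr_eq0; apply/eqP/ss => f fs.
by rewrite linearB /= !(cs fs).2 mulrC subrr.
Qed.

(** The normalised eigenvectors [y] are a basis of group-like elements. By independence of
    group-like elements there are no others, and this closes [y] under products and antipode. *)
Theorem separated_group_algebra : commutative_group_algebra H.
Proof.
have [v v0 vspan] := common_eigenbasis.
have ex j : exists x, grouplike x /\ exists c, v j = c *: x.
  by have [n0 ev0] := v0 j; have [x gx ?] := eigen_grouplike n0 ev0; exists x.
have [y yE] := fin_all_exists ex.
pose b := [tuple y j | j < d].
have bE (i : 'I_d) : b`_i = y i by rewrite -tnth_nth tnth_mktuple.
have yb i : y i \in b by rewrite -bE mem_nth ?size_tuple.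
have bb : basis_of {:H} b.
  rewrite basisEdim size_tuple leqnn andbT; apply/subvP => x _.
  have [c ->] := vspan x; apply: memv_suml => j _.
  by have [_ [c' ->]] := yE j; rewrite scalerA memvZ // memv_span.
have ub := free_uniq (basis_free bb).
have yinj : injective y.
  move=> i j; rewrite -!bE => /eqP; rewrite nth_uniq ?size_tuple // => /eqP e.
  exact: val_inj.
have cl x : grouplike x -> exists i, y i = x.
  move=> gx; suff /(nthP 0)[i] : x \in b.
    by rewrite size_tuple => id <-; exists (Ordinal id); rewrite -bE.
  apply/negPn/negP => xb; have : free (x :: b).
    apply: grouplike_free => [|z]; first by rewrite /= xb.
    by rewrite inE => /orP[/eqP->//|/mapP[i _ ->]]; exact: (yE i).1.
  move=> fb; have := dimvS (subvf <<x :: b>>%VS).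
  have sb : size (x :: b) = d.+1 by rewrite -[RHS](size_tuple [tuple of x :: b]).
  by move: fb; rewrite /free => /eqP->; rewrite sb ltnn.
have [mul mulE] := fin_all_exists (fun p : 'I_d * 'I_d =>
  cl _ (grouplikeM (yE p.1).1 (yE p.2).1)).
have [inv invE] := fin_all_exists (fun i => cl _ (grouplike_antipode (yE i).1)).
have [one oneE] := cl _ (grouplike1 H).
pose B := @GroupLikeFamily k H d y (fun i j => mul (i, j)) one inv yinj
  (fun i j => mulE (i, j)) oneE
  (fun i => etrans (congr1 (fun z => z * y i) (invE i)) (grouplike_antipodel (yE i).1)).
exists (gl_type B); split; last by apply: (@gl_hopf_isomorphic _ _ B b) => // i; exact: (yE i).1.
apply/centsP => i _ j _; apply: (@gl_inj _ _ B).
by rewrite !(gl_mulE (g := B)) separated_commutative.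
Qed.

End Separated.

(** * Rigidity of graded actions *)

Section Assembly.
Variables (K : fieldType) (n : nat) (rels : seq (free_algebra K n.+1)).
Variables (A : algType K) (t : 'I_n.+1 -> A) (presA : presented_by t rels).
Variables (H : fdHopfType K) (act : H -> A -> A).
Hypotheses (actA : module_algebra act) (graded : preserves_grading act t).
Local Notation D := (hdual H).
Local Notation I := 'I_n.+1.

(** [T] indexes the words of the degree of the relations: two for the quadratic algebras, three for
    the down-up algebras. *)
Variables (T : finType) (wd : T -> seq I) (phi : I * T -> T * I) (N : nat).
Hypotheses (wd_inj : injective wd) (wd_size : forall s, size (wd s) = N.+2).
Hypothesis phi_bij : bijective phi.
Variable word_corep : (I -> I -> D) -> T -> T -> D.
Hypothesis wcP : forall a, corep a -> corep (word_corep a).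
Hypothesis wc_phi : forall a p q, a p.1 q.1 * word_corep a p.2 q.2 =
  word_corep a (phi p).1 (phi q).1 * a (phi p).2 (phi q).2.
Hypothesis wc_act : forall a, acts_by act a t ->
  acts_by act (word_corep a) (fun s => \prod_(i <- wd s) t i).

Variables (rho : I -> T -> K) (C C' mu : 'M[K]_n.+1).
Variable c : I -> K.
Hypothesis c0 : forall j, c j != 0.
Hypothesis relsE : rels = [seq \sum_s (c j * rho j s) *: word K (wd s) | j <- enum I].
Hypothesis CC : C' *m C = 1%:M.

Definition superpotential_of i s := \sum_j C i j * rho j s.

Hypothesis sp : superpotential phi superpotential_of mu.

Theorem graded_action_rigidity : exists a : I -> I -> D,
  [/\ corep a, acts_by act a t,
    forall z i, exists b : I -> K, forall s,
      \sum_s' rho i s' * ev (word_corep a s s') z = \sum_j rho j s * b j &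
    exists2 m, (0 < m)%N & forall x, let M := \matrix_(i, j) ev (a i j) x in
      (iter m (mulmx mu) 1%:M) *m M = M *m (iter m (mulmx mu) 1%:M)].
Proof.
pose rho' j s := c j * rho j s.
have relP r : r \in rels -> exists j, r = \sum_s rho' j s *: word K (wd s).
  by rewrite relsE => /mapP[j _ ->]; exists j.
have rel_in j : \sum_s rho' j s *: word K (wd s) \in rels.
  by rewrite relsE; apply/mapP; exists j; rewrite ?mem_enum.
have rels2 r : r \in rels -> order_ge 2 r.
  case/relP=> j ->; apply: order_ge_sum => s; apply: order_geZ.
  by apply: (@order_geW _ _ _ N.+2) => //; rewrite -(wd_size s); exact: order_ge_word.
have [a ca aa] := generators_corep presA actA graded rels2.
have delta (B : 'M[K]_n.+1) j s : B = 1%:M -> \sum_i B j i * rho i s = rho j s.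
  move=> ->; rewrite (bigD1 j) //= mxE eqxx mul1r big1 ?addr0 // => i ne.
  by rewrite mxE eq_sym (negPf ne) mul0r.
exists a; split=> //.
  (* Stability is needed twice: here for the span of the [rho j] themselves, with identity matrices
     up to the factors [c j], and below for the derivatives of the superpotential, with [C] and its
     inverse. *)
  apply: (relations_stable presA actA wd_inj wd_size relP rel_in
    (C := fun i j => (1%:M : 'M[K]_n.+1) i j / c j)
    (C' := fun i j => c i * (1%:M : 'M[K]_n.+1) i j) _ _ (wc_act aa)) => j s.
    rewrite -{1}(delta 1%:M j s erefl); apply: eq_bigr => i _.
    by rewrite /rho' mulrA divfK.
  by under eq_bigr do rewrite -mulrA; rewrite -mulr_sumr delta.
apply: (superpotential_commutes sp phi_bij ca (wcP ca) (wc_phi a)).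
apply: (relations_stable presA actA wd_inj wd_size relP rel_in (C := fun i j => C i j / c j)
   (C' := fun i j => c i * C' i j) _ _ (wc_act aa)) => j s.
  by apply: eq_bigr => i _; rewrite /rho' mulrA divfK.
under eq_bigr do rewrite -mulrA; rewrite -mulr_sumr; congr (_ * _).
rewrite /superpotential_of; under eq_bigr do rewrite mulr_sumr.
rewrite exchange_big /= -{1}(delta _ j s CC); apply: eq_bigr => i _.
by rewrite mxE mulr_suml; apply: eq_bigr => l _; rewrite mulrA.
Qed.

End Assembly.

(** * Skew-primitive elements in characteristic zero *)

Section SkewPrimitive.
Variables (K : fieldType) (char0 : [pchar K] =i pred0) (H : fdHopfType K).
Local Notation D := (hdual H).

(* A functional [b] with [b (x y) = b x eps y + eps x b y] acts on the powers of
   an element of the augmentation ideal as the derivative does on powers of a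
   variable, so [b != 0] would make these powers independent. *)
Lemma primitive_eq0 (b : D) :
  (forall x y, ev b (x * y) = ev b x * counit y + counit x * ev b y) -> b = 0.
Proof.
move=> bM; apply: hdualP => x0.
have -> : ev 0 x0 = 0 by rewrite /ev lfunE.
apply/eqP/negPn/negP => bx0.
have b1 : ev b 1 = 0.
  by have /eqP := bM 1 1; rewrite mulr1 counit1 mulr1 mul1r -subr_eq0 opprD addNKr oppr_eq0 => /eqP.
pose x := x0 - counit x0 *: 1.
have ex : counit x = 0 by rewrite linearB linearZ /= counit1 mulr1 subrr.
have bx : ev b x != 0 by rewrite linearB linearZ /= b1 mulr0 subr0.
have hb y z : hitr b (y * z) = hitr b y * z + y * hitr b z.
  rewrite hitrMl; transitivity (sw (fun u v => ev b v *: (u * z) + counit v *: (u * hitr b z)) y).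
    apply: eq_sw => u v; rewrite !scalerAr -mulrDr; congr (_ * _).
    have -> : ltr b v = ev b v *: 1 + counit v *: b.
      by apply: hdualP => w; rewrite ltrE bM evPl ev1 evZl.
    by rewrite hitrPl hitr_counit (linZ _ _ (hitrPl z)).
  rewrite swD sw_counitr; last by lin.
  congr (_ + _); rewrite [hitr b y]/hitr (sw_linear _ _ (@lin_mull _ _ _ (fun u => u) z (@lin_id _ _))).
  by apply: eq_sw => u v; rewrite scalerAl.
(* [e m] is the convolution power $b^m$, and [Q m y] says that [y] vanishes to order $m$ like a
   polynomial divisible by $X^m$. As [hitr b] is a derivation, $b^{m+1}(yx) = (m+1)\,b^m(y)\,b(x)$
   for such [y]; hence $b^m(x^m) \neq 0$, while lower powers of $b$ vanish at $x^m$. *)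
pose e m y := counit (iter m (hitr b) y).
pose Q m y := forall i, (i < m)%N -> e i y = 0.
have iterD m : {morph iter m (hitr b) : y z / y + z}.
  by elim: m => [//|m IH] y z; rewrite !iterS IH linearD.
have eS m y z : e m.+1 (y * z) = e m (hitr b y * z) + e m (y * hitr b z).
  by rewrite /e iterSr hb iterD linearD.
have eh m y : e m (hitr b y) = e m.+1 y by rewrite /e iterSr.
have Qh m y : Q m.+1 y -> Q m (hitr b y) by move=> q i im; rewrite eh q.
have C1 i : forall m y z, Q m y -> (i < m)%N -> e i (y * z) = 0.
  elim: i => [|i IH] [//|m] y z q im; first by rewrite /e counitM -[counit y]/(e 0%N y) q ?mul0r.
  by rewrite eS (IH m) ?(IH m.+1) ?addr0 //; [exact: ltnW | exact: Qh].
have L0 m : forall y z, Q m y -> e m (y * z) = e m y * counit z.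
  elim: m => [|m IH] y z q; first by rewrite /e counitM.
  by rewrite eS IH ?eh; [rewrite (C1 _ m.+1) // addr0 | exact: Qh].
have cx : counit (hitr b x) = ev b x by rewrite -ev1 -evM mul1r.
have L1 m : forall y, Q m y -> e m.+1 (y * x) = m.+1%:R * e m y * ev b x.
  elim: m => [|m IH] y q; rewrite eS.
    by rewrite /e /= !counitM ex mulr0 add0r cx mul1r.
  rewrite IH; last exact: Qh.
  by rewrite L0 // cx eh [m.+2%:R]mulrSr !mulrDl mul1r.
have Qx m : Q m (x ^+ m).
  elim: m => [//|m IH] i; rewrite exprSr ltnS leq_eqVlt => /orP[/eqP->|im].
    by rewrite L0 // ex mulr0.
  by rewrite (C1 _ m).
have ex0 m : e m (x ^+ m) != 0.
  elim: m => [|m IH]; first by rewrite /e expr0 counit1 oner_neq0.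
  rewrite exprSr L1 // !mulf_neq0 //.
  by rewrite (pcharf0P K).1.
pose s := [tuple x ^+ i | i < (\dim {:H}).+1].
have sE (i : 'I_(\dim {:H}).+1) : s`_i = x ^+ i by rewrite -tnth_nth tnth_mktuple.
have : free s.
  apply/freeP => c c0; suff P j : forall i : 'I_(\dim {:H}).+1, (i < j)%N -> c i = 0.
    by move=> i; apply: (P i.+1).
  elim: j => [//|j IH] i; rewrite ltnS leq_eqVlt => /orP[/eqP ij|/IH//].
  have le : linear_for *%R (e i).
    move=> a y z; rewrite /e; elim: (i : nat) y z => [|l IHl] y z; rewrite ?linearP //.
    by rewrite !iterSr linearP IHl.
  have := @linear_comb K H K^o (e i) _ (index_enum _) c (fun l => s`_l) le.
  rewrite c0 (bigD1 i) //= big1 => [|l li].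
    rewrite addr0 sE (@lin0 K H K^o _ le) => /esym/eqP.
    by rewrite mulf_eq0 (negPf (ex0 i)) orbF => /eqP.
  rewrite sE; have [il|il|il] := ltngtP i l.
  - by rewrite (Qx l) // scaler0.
  - by rewrite IH ?scale0r // -ij.
  - by case/eqP: li; exact: val_inj.
rewrite /free => /eqP fs; have := dimvS (subvf <<s>>%VS).
by rewrite fs size_tuple ltnn.
Qed.

(** Multiplying by the inverse character [dS g] makes [b] primitive. *)
Lemma skew_primitive_eq0 (g b : D) : character g ->
  (forall x y, ev b (x * y) = ev g x * ev b y + ev b x * ev g y) -> b = 0.
Proof.
move=> cg bM; have cS := character_dS cg.
suff z : dS g * b = 0 by rewrite -[b]mul1r -(character_antipoder cg) -mulrA z mulr0.
apply: primitive_eq0 => x y.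
have hb : hitr b (x * y) = hitr g x * hitr b y + hitr b x * hitr g y.
  rewrite hitrMl; transitivity (sw (fun u v => ev g v *: (u * hitr b y) + ev b v *: (u * hitr g y)) x).
    apply: eq_sw => u v; rewrite !scalerAr -mulrDr; congr (_ * _).
    have -> : ltr b v = ev g v *: b + ev b v *: g.
      by apply: hdualP => w; rewrite ltrE bM evPl evZl.
    by rewrite hitrPl (linZ _ _ (hitrPl y)).
  rewrite swD; congr (_ + _).
    rewrite [hitr g x]/hitr (sw_linear _ _ (@lin_mull _ _ _ (fun u => u) (hitr b y) (@lin_id _ _))).
    by apply: eq_sw => u v; rewrite scalerAl.
  rewrite [hitr b x]/hitr (sw_linear _ _ (@lin_mull _ _ _ (fun u => u) (hitr g y) (@lin_id _ _))).
  by apply: eq_sw => u v; rewrite scalerAl.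
rewrite evM hb linearD /= !cS.2 -!evM (character_antipodel cg) !ev1 addrC.
by [].
Qed.

End SkewPrimitive.

(** * The relations of the listed algebras *)

Section RelationSuperpotential.
Variables (K : fieldType) (n : nat) (T : finType).
Local Notation I := 'I_n.+1.
Variables (phi : I * T -> T * I) (rho : I -> T -> K) (C C' mu : 'M[K]_n.+1).
Hypothesis CC : C' *m C = 1%:M.

(** Writing derivatives of $w$ in terms of relations turns the pair $(x, y)$ of [sp_unique] into
    $(C^T x, yC)$; so $y$ is scalar exactly when $yC$ is a multiple of $C$. *)
Lemma superpotential_of_relations :
    (forall p, superpotential_of rho C p.1 p.2 =
       \sum_k mu (phi p).2 k * superpotential_of rho C k (phi p).1) ->
    (exists V : T -> I -> K, forall j j', \sum_t rho j t * V t j' = (j == j')%:R) ->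
    (forall X Y : 'M[K]_n.+1,
       (forall p, \sum_j rho j (phi p).1 * X j (phi p).2 = \sum_j Y p.1 j * rho j p.2) ->
       exists e, Y = e *: C) ->
  superpotential phi (superpotential_of rho C) mu.
Proof.
move=> cyc [V VE] uniq; split=> // [|x y h].
  exists (fun t r => \sum_j V t j * C' j r) => s r.
  have /matrixP/(_ s r) := mulmx1C CC; rewrite !mxE => <-.
  transitivity (\sum_j \sum_j' C s j * (\sum_t rho j t * V t j') * C' j' r).
    rewrite /superpotential_of; under eq_bigr do rewrite mulr_suml.
    rewrite exchange_big; apply: eq_bigr => j _ /=.
    under eq_bigr do rewrite mulr_sumr; rewrite exchange_big; apply: eq_bigr => j' _ /=.
    rewrite mulr_sumr mulr_suml; apply: eq_bigr => t _; by rewrite !mulrA.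
  apply: eq_bigr => j _; rewrite (bigD1 j) //= VE eqxx mulr1 big1 ?addr0 // => j' ne.
  by rewrite VE eq_sym (negPf ne) mulr0 mul0r.
have [p|e ye] := uniq (C^T *m x) (y *m C).
  transitivity (\sum_r superpotential_of rho C r (phi p).1 * x r (phi p).2).
    rewrite /superpotential_of; under [RHS]eq_bigr do rewrite mulr_suml.
    rewrite [RHS]exchange_big; apply: eq_bigr => j _ /=.
    rewrite mxE mulr_sumr; apply: eq_bigr => r _; rewrite mxE; ring.
  rewrite h /superpotential_of; under eq_bigr do rewrite mulr_sumr.
  rewrite exchange_big; apply: eq_bigr => j _ /=.
  rewrite mxE mulr_suml; apply: eq_bigr => r _; ring.
exists e; rewrite -[y]mulmx1 -(mulmx1C CC) mulmxA ye -scalemxAl (mulmx1C CC).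
by rewrite scalemx1.
Qed.

End RelationSuperpotential.

(** Solves one linear equation: the multiplier [c] is a certificate, checked by [ring] or
    [field]. *)
Lemma eq_lincomb (K : fieldType) (c u v A B : K) : u - v = c * (A - B) -> A = B -> u = v.
Proof. by move=> e ab; apply/eqP; rewrite -subr_eq0 e ab subrr mulr0. Qed.

Section Three.
Local Notation i0 := (@Ordinal 3 0 isT).
Local Notation i1 := (@Ordinal 3 1 isT).
Local Notation i2 := (@Ordinal 3 2 isT).

Lemma ord3P (P : 'I_3 -> Prop) : P i0 -> P i1 -> P i2 -> forall i, P i.
Proof.
move=> p0 p1 p2 [[|[|[|//]]] lt]; rewrite (bool_irrelevance lt isT); assumption.
Qed.

Lemma sum3 (V : nmodType) (F : 'I_3 -> V) : \sum_i F i = F i0 + F i1 + F i2.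
Proof.
rewrite !big_ord_recl big_ord0 addr0 addrA.
by congr (F _ + F _ + F _); apply: val_inj.
Qed.

Lemma enum3 : enum 'I_3 = [:: i0; i1; i2].
Proof. by apply: (inj_map val_inj); rewrite val_enum_ord. Qed.

Lemma sum33 (V : nmodType) (F : 'I_3 * 'I_3 -> V) :
  \sum_p F p = \sum_i \sum_j F (i, j).
Proof. by rewrite pair_bigA; apply: eq_bigr => -[]. Qed.

Variable K : fieldType.

Definition mx3 (L : seq (seq K)) : 'M[K]_3 := \matrix_(i, j) nth 0 (nth [::] L i) j.

Definition moveover (n : nat) (p : 'I_n * ('I_n * 'I_n)) : ('I_n * 'I_n) * 'I_n :=
  ((p.1, p.2.1), p.2.2).

(* The relations [t2 t1 - a t1 t2 + b t1^2], [t3 t1 - c t1 t3 + d t1^2 + d' t2 t1] and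
   [t3 t2 - e t2 t3 + f t1^2 + g t1 t3 + i t2^2 + i' t1 t2]: their leading words
   overlap only in [t3 t2 t1]. *)
Variables (a b c d d' e f g i i' : K).
Hypotheses (a0 : a != 0) (c0 : c != 0) (e0 : e != 0).

Definition qrel (j : 'I_3) (s : 'I_3 * 'I_3) : K :=
  nth 0 (nth [::] (nth [::]
    [:: [:: [:: b; - a; 0]; [:: 1; 0; 0]; [:: 0; 0; 0]];
        [:: [:: d; 0; - c]; [:: d'; 0; 0]; [:: 1; 0; 0]];
        [:: [:: f; i'; g]; [:: 0; i; - e]; [:: 0; 1; 0]]] j) s.1) s.2.

(** Row $l$ gives the left derivative of $w$ by the $l$-th generator in terms of the relations. The
    entries are the solution of the linear system in [qrel_unique], normalised so that the overlap
    word $t_3t_2t_1$ has coefficient 1 in $w$. *)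
Definition qC : 'M[K]_3 := mx3
  [:: [:: i' * c + b * i * c / a + d; g - c * b; c * a];
      [:: i * c / a + d'; - e; 0];
      [:: 1; 0; 0]].

Definition qC' : 'M[K]_3 := mx3
  [:: [:: 0; 0; 1];
      [:: 0; - e^-1; (i * c / a + d') / e];
      [:: (c * a)^-1; (g - c * b) / (e * (c * a));
          - (i' * c + b * i * c / a + d + (g - c * b) * ((i * c / a + d') / e)) / (c * a)]].

Lemma qCC : qC' *m qC = 1%:M.
Proof.
apply/matrixP; apply: ord3P; apply: ord3P; rewrite !mxE sum3 !mxE /=;
  field; by rewrite ?a0 ?c0 ?e0.
Qed.

Lemma qrel_free : exists V : 'I_3 * 'I_3 -> 'I_3 -> K,
  forall j j', \sum_t qrel j t * V t j' = (j == j')%:R.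
Proof.
(* Reads the coefficients of the leading words $t_2t_1$, $t_3t_1$, $t_3t_2$; the entry [- d']
   compensates for $t_2t_1$ in the second relation. *)
exists (fun (t : 'I_3 * 'I_3) (j : 'I_3) => nth 0 (nth [::] (nth [::]
  [:: [:: [::]; [::]; [::]]; [:: [:: 1]; [::]; [::]];
      [:: [:: - d'; 1]; [:: 0; 0; 1]; [::]]] t.1) t.2) j).
by apply: ord3P; apply: ord3P; rewrite sum33 !sum3 /qrel /=; ring.
Qed.

Ltac solve_entry := rewrite !sum3 /qrel /=;
  repeat match goal with h : fun_of_matrix _ _ _ = _ |- _ => rewrite h end;
  field; rewrite ?a0 ?c0 ?e0.

Lemma qrel_unique (X Y : 'M[K]_3) :
  (forall p, \sum_j qrel j (moveover p).1 * X j (moveover p).2 =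
             \sum_j Y p.1 j * qrel j p.2) ->
  exists e, Y = e *: qC.
Proof.
move=> h; have w l m n := h (l, (m, n)).
have solve u v l m n q : u - v = q * (\sum_j qrel j (l, m) * X j n - \sum_j Y l j * qrel j (m, n)) -> u = v.
  by move=> /eq_lincomb; apply; exact: w.
(* Each line obtains one entry from the coefficient of one word of length three, in an order where
   only entries already known occur besides it. All entries of [Y] end up as multiples of
   [Y i2 i0]. *)
have X22 : X i2 i2 = 0. by apply: (solve _ _ i1 i2 i2 (- e^-1)); solve_entry.
have Y22 : Y i2 i2 = 0. by apply: (solve _ _ i2 i1 i2 e^-1); solve_entry.
have Y21 : Y i2 i1 = 0. by apply: (solve _ _ i2 i2 i0 (- 1)); solve_entry.
have X12 : X i1 i2 = 0. by apply: (solve _ _ i0 i2 i2 (- c^-1)); solve_entry.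
have Y12 : Y i1 i2 = 0. by apply: (solve _ _ i1 i1 i2 e^-1); solve_entry.
have X21 : X i2 i1 = 0. by apply: (solve _ _ i1 i2 i1 (- e^-1)); solve_entry.
have X10 : X i1 i0 = b * Y i2 i0. by apply: (solve _ _ i2 i0 i0 1); solve_entry.
have X11 : X i1 i1 = - a * Y i2 i0. by apply: (solve _ _ i2 i0 i1 1); solve_entry.
have X20 : X i2 i0 = Y i2 i0. by apply: (solve _ _ i2 i1 i0 1); solve_entry.
have Y01 : Y i0 i1 = (g - c * b) * Y i2 i0. by apply: (solve _ _ i0 i2 i0 (- 1)); solve_entry.
have Y02 : Y i0 i2 = c * a * Y i2 i0. by apply: (solve _ _ i0 i2 i1 (- 1)); solve_entry.
have Y11 : Y i1 i1 = - e * Y i2 i0. by apply: (solve _ _ i1 i2 i0 (- 1)); solve_entry.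
have X01 : X i0 i1 = - (i * c) * Y i2 i0. by apply: (solve _ _ i0 i1 i1 (- a^-1)); solve_entry.
have Y10 : Y i1 i0 = (i * c / a + d') * Y i2 i0. by apply: (solve _ _ i1 i0 i1 a^-1); solve_entry.
have Y00 : Y i0 i0 = (i' * c + b * i * c / a + d) * Y i2 i0. by apply: (solve _ _ i0 i0 i1 a^-1); solve_entry.
exists (Y i2 i0); apply/matrixP; apply: ord3P; apply: ord3P; rewrite !mxE /=
  ?Y00 ?Y01 ?Y02 ?Y10 ?Y11 ?Y12 ?Y21 ?Y22; ring.
Qed.

End Three.

Section Diagonal.
Variables (K : fieldType) (H : fdHopfType K) (n : nat).
Local Notation D := (hdual H).

Definition diagonal (a : 'I_n -> 'I_n -> D) := forall i j, i != j -> a i j = 0.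

Lemma diagonal_character a i : corep a -> diagonal a -> character (a i i).
Proof.
move=> ca da; split=> [|x y]; first by rewrite ca.1 eqxx.
rewrite ca.2 (bigD1 i) //= big1 ?addr0 // => j ne.
by rewrite da ?(eq_sym i) // /ev lfunE mul0r.
Qed.

End Diagonal.

Section DiagonalGroupAlgebra.
Variables (k : closedFieldType) (char0 : [pchar k] =i pred0).
Variables (n : nat) (rels : seq (free_algebra k n)).
Variables (A : algType k) (t : 'I_n -> A) (presA : presented_by t rels).
Variables (H : fdHopfType k) (act : H -> A -> A).
Hypotheses (actA : module_algebra act) (faithful : inner_faithful act).
Local Notation D := (hdual H).

Lemma diagonal_group_algebra a : corep a -> acts_by act a t -> diagonal a ->
  (forall i j, a i i * a j j = a j j * a i i) -> commutative_group_algebra H.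
Proof.
move=> ca aa da aC; pose g i := a i i.
have gC i : character (g i) by exact: diagonal_character.
have actg h i : act h (t i) = ev (g i) h *: t i.
  rewrite aa (bigD1 i) //= big1 ?addr0 // => j ne.
  by rewrite da // /ev lfunE scale0r.
have [s [us ws sg]] := gword_finite gC.
have comm1 i u : g i * \prod_(j <- u) g j = (\prod_(j <- u) g j) * g i.
  elim: u => [|j u IH]; first by rewrite !big_nil mulr1 mul1r.
  by rewrite !big_cons mulrA aC -!mulrA IH.
apply: (separated_group_algebra char0 us) => [f /ws[u ->]||f f' /ws[u ->] /ws[u' ->]].
- exact: gword_character.
- exact: (gword_separates presA actA faithful gC actg us ws sg).
- elim: u => [|j u IH]; first by rewrite !big_nil mulr1 mul1r.
  by rewrite !big_cons -mulrA IH mulrA comm1 mulrA.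
Qed.

End DiagonalGroupAlgebra.

(** * The five quadratic families *)

Section Quadratic.
Local Notation i0 := (@Ordinal 3 0 isT).
Local Notation i1 := (@Ordinal 3 1 isT).
Local Notation i2 := (@Ordinal 3 2 isT).

Variables (K : fieldType) (rels : seq (free_algebra K 3)).
Variables (A : algType K) (t : 'I_3 -> A) (presA : presented_by t rels).
Variables (H : fdHopfType K) (act : H -> A -> A).
Hypotheses (actA : module_algebra act) (graded : preserves_grading act t).
Local Notation D := (hdual H).

Variables (a b c d d' e f g i i' : K).
Hypotheses (a0 : a != 0) (c0 : c != 0) (e0 : e != 0).
Local Notation rho := (qrel a b c d d' e f g i i').
Local Notation C := (qC a b c d d' e g i i').
Variable mu : 'M[K]_3.

Definition pair_word (n : nat) (p : 'I_n * 'I_n) : seq 'I_n := [:: p.1; p.2].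
Definition pair_corep (n : nat) (u : 'I_n -> 'I_n -> D) (p q : 'I_n * 'I_n) : D :=
  u p.1 q.1 * u p.2 q.2.

Variable sc : 'I_3 -> K.
Hypothesis sc0 : forall j, sc j != 0.
Hypothesis relsE :
  rels = [seq \sum_s (sc j * rho j s) *: word K (pair_word s) | j <- enum 'I_3].
Hypothesis cyc : forall p : 'I_3 * ('I_3 * 'I_3), superpotential_of rho C p.1 p.2 =
  \sum_k mu (moveover p).2 k * superpotential_of rho C k (moveover p).1.

Theorem quadratic_rigidity : exists u : 'I_3 -> 'I_3 -> D,
  [/\ corep u, acts_by act u t,
    exists2 m, (0 < m)%N & forall x, let M := \matrix_(i, j) ev (u i j) x in
      (iter m (mulmx mu) 1%:M) *m M = M *m (iter m (mulmx mu) 1%:M) &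
    diagonal u -> forall i j, u i i * u j j = u j j * u i i].
Proof.
have [u [uc ua st um]] : exists u : 'I_3 -> 'I_3 -> D, [/\ corep u, acts_by act u t,
    forall z i, exists b : 'I_3 -> K, forall s,
      \sum_s' rho i s' * ev (pair_corep u s s') z = \sum_j rho j s * b j &
    exists2 m, (0 < m)%N & forall x, let M := \matrix_(i, j) ev (u i j) x in
      (iter m (mulmx mu) 1%:M) *m M = M *m (iter m (mulmx mu) 1%:M)].
  apply: (@graded_action_rigidity K 2 rels A t presA H act actA graded _
    (@pair_word 3) (@moveover 3) 0 _ _ _ (@pair_corep 3) _ _ _ rho C
    (qC' a b c d d' e g i i') mu sc sc0 relsE (qCC b d d' g i i' a0 c0 e0)).
  - by move=> [p p'] [q q'] [-> ->].
  - by [].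
  - by exists (fun q => (q.1.1, (q.1.2, q.2))) => [[p [p' p'']]|[[p p'] p'']].
  - by move=> u uc; exact: corep_tensor.
  - by move=> u p q; rewrite /pair_corep /= mulrA.
  - move=> u ua h q; have := acts_by_tensor actA ua ua h q.
    rewrite /pair_word !big_cons !big_nil mulr1 => ->.
    by apply: eq_bigr => p _; rewrite !big_cons !big_nil mulr1.
  - apply: (superpotential_of_relations (qCC b d d' g i i' a0 c0 e0)) => //.
      exact: qrel_free.
    exact: qrel_unique.
exists u; split=> // du.
have stab z l : exists b : 'I_3 -> K, forall s,
    rho l s * ev (u s.1 s.1 * u s.2 s.2) z = \sum_j rho j s * b j.
  have [b' b'E] := st z l; exists b' => s; rewrite -b'E (bigD1 s) //= big1 ?addr0 // => s' ne.
  rewrite /pair_corep; have [e1|n1] := eqVneq s.1 s'.1; last first.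
    by rewrite (du _ _ n1) mul0r /ev lfunE mulr0.
  have [e2|n2] := eqVneq s.2 s'.2; last first.
    by rewrite (du _ _ n2) mulr0 /ev lfunE mulr0.
  by case/eqP: ne; case: (s) (s') e1 e2 => [? ?] [? ?] /= -> ->.
(* For diagonal [u] the transform of a relation $r$ has the words of $r$ only. The leading words of
   the other relations therefore have coefficient zero, which makes it a multiple of $r$; comparing
   the words $t_2t_1$ and $t_1t_2$ gives commutation. The next two cases use $t_3t_1$ and $t_3t_2$
   in the same way. *)
have C10 : u i1 i1 * u i0 i0 = u i0 i0 * u i1 i1.
  apply: hdualP => z; have [v vE] := stab z i0.
  have := vE (i2, i0); rewrite sum3 /qrel /= => E1.
  have := vE (i2, i1); rewrite sum3 /qrel /= => E2.
  have := vE (i1, i0); rewrite sum3 /qrel /= => E3.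
  have := vE (i0, i1); rewrite sum3 /qrel /= => E4.
  have v1 : v i1 = 0 by apply: eq_lincomb (esym E1); instantiate (1 := 1); ring.
  have v2 : v i2 = 0 by apply: eq_lincomb (esym E2); instantiate (1 := 1); ring.
  have v3 : ev (u i1 i1 * u i0 i0) z = v i0.
    by apply: eq_lincomb E3; instantiate (1 := 1); rewrite v1; ring.
  by rewrite v3; apply/esym; apply: eq_lincomb E4; instantiate (1 := - a^-1);
     rewrite v2; field; exact: a0.
have C20 : u i2 i2 * u i0 i0 = u i0 i0 * u i2 i2.
  apply: hdualP => z; have [v vE] := stab z i1.
  have := vE (i2, i0); rewrite sum3 /qrel /= => E1.
  have := vE (i2, i1); rewrite sum3 /qrel /= => E2.
  have := vE (i0, i2); rewrite sum3 /qrel /= => E4.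
  have v2 : v i2 = 0 by apply: eq_lincomb (esym E2); instantiate (1 := 1); ring.
  have v3 : ev (u i2 i2 * u i0 i0) z = v i1.
    by apply: eq_lincomb E1; instantiate (1 := 1); ring.
  by rewrite v3; apply/esym; apply: eq_lincomb E4; instantiate (1 := - c^-1);
     rewrite v2; field; exact: c0.
have C21 : u i2 i2 * u i1 i1 = u i1 i1 * u i2 i2.
  apply: hdualP => z; have [v vE] := stab z i2.
  have := vE (i2, i1); rewrite sum3 /qrel /= => E1.
  have := vE (i1, i2); rewrite sum3 /qrel /= => E4.
  have v3 : ev (u i2 i2 * u i1 i1) z = v i2.
    by apply: eq_lincomb E1; instantiate (1 := 1); ring.
  by rewrite v3; apply/esym; apply: eq_lincomb E4; instantiate (1 := - e^-1);
     field; exact: e0.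
by apply: ord3P; apply: ord3P.
Qed.

End Quadratic.

(** * Down-up algebras *)

Section Cubic.
Local Notation j0 := (@Ordinal 2 0 isT).
Local Notation j1 := (@Ordinal 2 1 isT).

Lemma ord2P (P : 'I_2 -> Prop) : P j0 -> P j1 -> forall i, P i.
Proof. by move=> p0 p1 [[|[|//]] lt]; rewrite (bool_irrelevance lt isT). Qed.

Lemma sum2 (V : nmodType) (F : 'I_2 -> V) : \sum_i F i = F j0 + F j1.
Proof.
by rewrite !big_ord_recl big_ord0 addr0; congr (F _ + F _); apply: val_inj.
Qed.

Lemma enum2 : enum 'I_2 = [:: j0; j1].
Proof. by apply: (inj_map val_inj); rewrite val_enum_ord. Qed.

Lemma sum222 (V : nmodType) (F : 'I_2 * ('I_2 * 'I_2) -> V) :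
  \sum_p F p = \sum_i \sum_j \sum_l F (i, (j, l)).
Proof.
transitivity (\sum_i \sum_q F (i, q)); first by rewrite pair_bigA; apply: eq_bigr => -[].
by apply: eq_bigr => i _; rewrite pair_bigA; apply: eq_bigr => -[].
Qed.

Variables (K : fieldType) (a b : K).
Hypothesis b0 : b != 0.

Definition mx2 (L : seq (seq K)) : 'M[K]_2 := \matrix_(i, j) nth 0 (nth [::] L i) j.

Definition moveover3 (n : nat) (p : 'I_n * ('I_n * ('I_n * 'I_n))) :
    ('I_n * ('I_n * 'I_n)) * 'I_n :=
  ((p.1, (p.2.1, p.2.2.1)), p.2.2.2).

Definition drel (j : 'I_2) (s : 'I_2 * ('I_2 * 'I_2)) : K :=
  nth 0 (nth [::] (nth [::] (nth [::]
    [:: [:: [:: [:: 0; 1]; [:: - a; 0]]; [:: [:: - b; 0]; [:: 0; 0]]];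
        [:: [:: [:: 0; 0]; [:: 0; 1]]; [:: [:: 0; - a]; [:: - b; 0]]]] j) s.1) s.2.1) s.2.2.

(** With $r_1, r_2$ the two relations, $w = b\,y\,r_1 - x\,r_2$. Moving the last letter of $w$ to
    the front multiplies by $-b$ for $x$ and by $-b^{-1}$ for $y$, whence [dmu]. *)
Definition dC : 'M[K]_2 := mx2 [:: [:: 0; - 1]; [:: b; 0]].
Definition dC' : 'M[K]_2 := mx2 [:: [:: 0; b^-1]; [:: - 1; 0]].
Definition dmu : 'rV[K]_2 := \row_i nth 0 [:: - b; - b^-1] i.

Lemma dCC : dC' *m dC = 1%:M.
Proof.
by apply/matrixP; apply: ord2P; apply: ord2P; rewrite !mxE sum2 !mxE /=; field; rewrite ?b0.
Qed.

Lemma drel_free : exists V : 'I_2 * ('I_2 * 'I_2) -> 'I_2 -> K,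
  forall j j', \sum_t drel j t * V t j' = (j == j')%:R.
Proof.
exists (fun t j => (t == if j == j0 then (j0, (j0, j1)) else (j0, (j1, j1)))%:R).
by apply: ord2P; apply: ord2P; rewrite sum222 !sum2 /drel /=; ring.
Qed.

Lemma drel_unique (X Y : 'M[K]_2) :
  (forall p, \sum_j drel j (moveover3 p).1 * X j (moveover3 p).2 =
             \sum_j Y p.1 j * drel j p.2) ->
  exists e, Y = e *: dC.
Proof.
move=> h; have w l m n o := h (l, (m, (n, o))).
have solve u v l m n o q :
    u - v = q * (\sum_j drel j (l, (m, n)) * X j o - \sum_j Y l j * drel j (m, (n, o))) -> u = v.
  by move=> /eq_lincomb; apply; exact: w.
have Y00 : Y j0 j0 = 0.
  by apply: (solve _ _ j0 j0 j0 j1 (- 1)); rewrite !sum2 /drel /=; ring.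
have Y11 : Y j1 j1 = 0.
  by apply: (solve _ _ j1 j1 j1 j0 b^-1); rewrite !sum2 /drel /=; field.
have X01 : X j0 j1 = Y j0 j1.
  by apply: (solve _ _ j0 j0 j1 j1 1); rewrite !sum2 /drel /= Y00; ring.
have Y10 : Y j1 j0 = - b * Y j0 j1.
  by apply: (solve _ _ j1 j0 j0 j1 (- 1)); rewrite !sum2 /drel /= X01; ring.
exists (- Y j0 j1); apply/matrixP; apply: ord2P; apply: ord2P; rewrite !mxE /=
  ?Y00 ?Y11 ?Y10; ring.
Qed.

Lemma drel_cyclic p : superpotential_of drel dC p.1 p.2 =
  \sum_k diag_mx dmu (moveover3 p).2 k * superpotential_of drel dC k (moveover3 p).1.
Proof.
case: p => l [m [n o]]; move: l m n o; do 4!apply: ord2P;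
  by rewrite /superpotential_of !sum2 !mxE /drel /= ?mulr1n ?mulr0n; field.
Qed.

Variables (rels : seq (free_algebra K 2)).
Variables (A : algType K) (t : 'I_2 -> A) (presA : presented_by t rels).
Variables (H : fdHopfType K) (act : H -> A -> A).
Hypotheses (actA : module_algebra act) (graded : preserves_grading act t).
Local Notation D := (hdual H).

Definition triple_word (n : nat) (p : 'I_n * ('I_n * 'I_n)) : seq 'I_n :=
  [:: p.1; p.2.1; p.2.2].
Definition triple_corep (n : nat) (u : 'I_n -> 'I_n -> D) (p q : 'I_n * ('I_n * 'I_n)) : D :=
  u p.1 q.1 * (u p.2.1 q.2.1 * u p.2.2 q.2.2).

Hypothesis a0 : a != 0.
Hypothesis relsE : rels = [seq \sum_s (1 * drel j s) *: word K (triple_word s) | j <- enum 'I_2].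

Theorem down_up_rigidity : exists u : 'I_2 -> 'I_2 -> D,
  [/\ corep u, acts_by act u t,
    exists2 m, (0 < m)%N & forall x, let M := \matrix_(i, j) ev (u i j) x in
      (iter m (mulmx (diag_mx dmu)) 1%:M) *m M = M *m (iter m (mulmx (diag_mx dmu)) 1%:M) &
    diagonal u -> forall i j, u i i * u j j = u j j * u i i].
Proof.
have [u [uc ua st um]] : exists u : 'I_2 -> 'I_2 -> D, [/\ corep u, acts_by act u t,
    forall z i, exists b : 'I_2 -> K, forall s,
      \sum_s' drel i s' * ev (triple_corep u s s') z = \sum_j drel j s * b j &
    exists2 m, (0 < m)%N & forall x, let M := \matrix_(i, j) ev (u i j) x in
      (iter m (mulmx (diag_mx dmu)) 1%:M) *m M = M *m (iter m (mulmx (diag_mx dmu)) 1%:M)].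
  apply: (@graded_action_rigidity K 1 rels A t presA H act actA graded _
    (@triple_word 2) (@moveover3 2) 1 _ _ _ (@triple_corep 2) _ _ _ drel dC
    dC' (diag_mx dmu) (fun=> 1) (fun=> oner_neq0 K) relsE dCC).
  - by move=> [p [p' p'']] [q [q' q'']] [-> -> ->].
  - by [].
  - by exists (fun q => (q.1.1, (q.1.2.1, (q.1.2.2, q.2)))) =>
      [[p [p' [p'' p3]]]|[[p [p' p'']] p3]].
  - by move=> u uc; exact: corep_tensor uc (corep_tensor uc uc).
  - by move=> u p q; rewrite /triple_corep /= !mulrA.
  - move=> u ua h q; have := acts_by_tensor actA ua (acts_by_tensor actA ua ua) h q.
    rewrite /triple_word !big_cons !big_nil mulr1 => ->.
    by apply: eq_bigr => p _; rewrite !big_cons !big_nil mulr1.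
  - apply: (superpotential_of_relations dCC drel_cyclic drel_free) => //.
    exact: drel_unique.
exists u; split=> // du.
have stab z l : exists v : 'I_2 -> K, forall s,
    drel l s * ev (triple_corep u s s) z = \sum_j drel j s * v j.
  have [b' b'E] := st z l; exists b' => s; rewrite -b'E (bigD1 s) //= big1 ?addr0 // => s' ne.
  rewrite /triple_corep; have [e1|n1] := eqVneq s.1 s'.1; last first.
    by rewrite (du _ _ n1) mul0r /ev lfunE mulr0.
  have [e2|n2] := eqVneq s.2.1 s'.2.1; last first.
    by rewrite (du _ _ n2) mul0r mulr0 /ev lfunE mulr0.
  have [e3|n3] := eqVneq s.2.2 s'.2.2; last first.
    by rewrite (du _ _ n3) !mulr0 /ev lfunE mulr0.
  by case/eqP: ne; case: (s) (s') e1 e2 e3 => [? [? ?]] [? [? ?]] /= -> -> ->.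
(* The words $x^2y$ and $xyx$ of the first relation are compared, the second having coefficient $-a
   \neq 0$; the common left factor is a character and cancels. *)
have C001 : u j0 j0 * (u j0 j0 * u j1 j1) = u j0 j0 * (u j1 j1 * u j0 j0).
  apply: hdualP => z; have [v vE] := stab z j0.
  have := vE (j0, (j0, j1)); rewrite sum2 /drel /triple_corep /= => E1.
  have := vE (j0, (j1, j0)); rewrite sum2 /drel /triple_corep /= => E2.
  have -> : ev (u j0 j0 * (u j0 j0 * u j1 j1)) z = v j0.
    by apply: eq_lincomb E1; instantiate (1 := 1); ring.
  by apply/esym; apply: eq_lincomb E2; instantiate (1 := - a^-1); field; exact: a0.
have C01 : u j0 j0 * u j1 j1 = u j1 j1 * u j0 j0.
  have c0 := diagonal_character j0 uc du.
  by rewrite -[LHS]mul1r -[RHS]mul1r -(character_antipodel c0) -!mulrA C001.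
by apply: ord2P; apply: ord2P.
Qed.

End Cubic.

Section MatrixPowers.
Variables (K : fieldType) (n : nat).

Lemma iter_diag_mx (d : 'rV[K]_n) m :
  iter m (mulmx (diag_mx d)) 1%:M = diag_mx (\row_i d 0 i ^+ m).
Proof.
elim: m => [|m IH].
  by apply/matrixP => i j; rewrite !mxE expr0.
by rewrite iterS IH mulmx_diag; congr diag_mx; apply/rowP => i; rewrite !mxE exprS.
Qed.

Lemma diagonal_of_commuting (H : fdHopfType K) (u : 'I_n -> 'I_n -> hdual H) (d : 'rV[K]_n) m :
  (forall i j, i != j -> d 0 i ^+ m != d 0 j ^+ m) ->
  (forall x, let M := \matrix_(i, j) ev (u i j) x in
      (iter m (mulmx (diag_mx d)) 1%:M) *m M = M *m (iter m (mulmx (diag_mx d)) 1%:M)) ->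
  diagonal u.
Proof.
move=> dne com i j ij; apply: hdualP => x.
have /matrixP/(_ i j) := com x; rewrite iter_diag_mx mul_diag_mx mul_mx_diag !mxE.
move/eqP; rewrite [X in _ == X]mulrC -subr_eq0 -mulrBl mulf_eq0 subr_eq0.
by rewrite (negPf (dne _ _ ij)) /= => /eqP->; rewrite /ev lfunE.
Qed.

(** If $x^m = y^m$, then $p^{jm} = 1$. *)
Lemma not_root_of_unity (p x y : K) j m : ~ Defs.root_of_unity p -> (0 < j)%N -> (0 < m)%N ->
  y != 0 -> x / y = p ^+ j -> x ^+ m != y ^+ m.
Proof.
move=> np j0 m0 y0 e; apply/negP => /eqP xy; apply: np.
exists (j * m)%N; first by rewrite muln_gt0 j0.
by rewrite unity_rootE exprM -e expr_div_n xy divff // expf_neq0.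
Qed.

End MatrixPowers.

(** * Matrices commuting with a Jordan block *)

Section JordanBlocks.
Local Notation i0 := (@Ordinal 3 0 isT).
Local Notation i1 := (@Ordinal 3 1 isT).
Local Notation i2 := (@Ordinal 3 2 isT).

Variables (K : fieldType) (char0 : [pchar K] =i pred0) (H : fdHopfType K).
Variable u : 'I_3 -> 'I_3 -> hdual H.
Hypothesis uc : corep u.

(** The superdiagonal entry is $m v x^{m-1}$, written with a quotient so that $m = 0$ is covered. *)
Lemma iter_jordan (x v z : K) m : x != 0 ->
  iter m (mulmx (mx3 [:: [:: x; v; 0]; [:: 0; x; 0]; [:: 0; 0; z]])) 1%:M =
  mx3 [:: [:: x ^+ m; m%:R * (v / x) * x ^+ m; 0]; [:: 0; x ^+ m; 0]; [:: 0; 0; z ^+ m]].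
Proof.
move=> x0; elim: m => [|m IH].
  by apply/matrixP; apply: ord3P; apply: ord3P; rewrite !mxE /= ?expr0 ?mul0r ?mulr0n.
rewrite iterS IH; apply/matrixP; apply: ord3P; apply: ord3P;
  by rewrite !mxE sum3 !mxE /= -?natr1 ?exprS; field.
Qed.

(** The corner entry stays unspecified, as only the superdiagonal matters later. *)
Lemma iter_unipotent (v w : K) m : exists w',
  iter m (mulmx (mx3 [:: [:: 1; v; w]; [:: 0; 1; v]; [:: 0; 0; 1]])) 1%:M =
  mx3 [:: [:: 1; m%:R * v; w']; [:: 0; 1; m%:R * v]; [:: 0; 0; 1]].
Proof.
elim: m => [|m [w' IH]].
  exists 0; apply/matrixP; apply: ord3P; apply: ord3P;
    by rewrite !mxE /= ?mul0r ?mulr0n ?mulr1n.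
exists (w' + v * (m%:R * v) + w); rewrite iterS IH.
apply/matrixP; apply: ord3P; apply: ord3P; by rewrite !mxE sum3 !mxE /= -?natr1; ring.
Qed.

Let ev0 x : ev (0 : hdual H) x = 0. Proof. by rewrite /ev lfunE. Qed.

(** Commutation separates the third generator and leaves on the block a single character $g$ with
    one entry [u i0 i1] above the diagonal. The corepresentation identity makes that entry
    skew-primitive with $g$ on both sides. *)
Lemma jordan_diagonal (X V Z : K) : V != 0 -> X != Z ->
  (forall x, let M := \matrix_(i, j) ev (u i j) x in
    let N := mx3 [:: [:: X; V; 0]; [:: 0; X; 0]; [:: 0; 0; Z]] in N *m M = M *m N) ->
  diagonal u.
Proof.
move=> V0 XZ com.
have E x i j : _ := congr1 (fun M : 'M_3 => M i j) (com x).
have XZ0 : X - Z != 0 by rewrite subr_eq0.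
have u12 : u i1 i2 = 0.
  apply: hdualP => x; have := E x i1 i2; rewrite !mxE !sum3 !mxE /= ev0 => e.
  by apply: eq_lincomb e; instantiate (1 := (X - Z)^-1); field; exact: XZ0.
have u02 : u i0 i2 = 0.
  apply: hdualP => x; have := E x i0 i2; rewrite !mxE !sum3 !mxE /= u12 !ev0 => e.
  by apply: eq_lincomb e; instantiate (1 := (X - Z)^-1); field; exact: XZ0.
have u20 : u i2 i0 = 0.
  apply: hdualP => x; have := E x i2 i0; rewrite !mxE !sum3 !mxE /= !ev0 => e.
  by apply: eq_lincomb e; instantiate (1 := - (X - Z)^-1); field; exact: XZ0.
have u21 : u i2 i1 = 0.
  apply: hdualP => x; have := E x i2 i1; rewrite !mxE !sum3 !mxE /= u20 !ev0 => e.
  by apply: eq_lincomb e; instantiate (1 := - (X - Z)^-1); field; exact: XZ0.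
have u10 : u i1 i0 = 0.
  apply: hdualP => x; have := E x i0 i0; rewrite !mxE !sum3 !mxE /= !ev0 => e.
  by apply: eq_lincomb e; instantiate (1 := V^-1); field; exact: V0.
have u11 : u i1 i1 = u i0 i0.
  apply: hdualP => x; have := E x i0 i1; rewrite !mxE !sum3 !mxE /= => e.
  by apply: eq_lincomb e; instantiate (1 := V^-1); field; exact: V0.
have g0 : character (u i0 i0).
  split=> [|x y]; first by rewrite uc.1.
  by rewrite uc.2 sum3 u10 u20 !ev0 !mulr0 !addr0.
have u01 : u i0 i1 = 0.
  apply: (skew_primitive_eq0 char0 g0) => x y.
  by rewrite uc.2 sum3 u11 u21 ev0 mulr0 addr0.
by apply: ord3P; apply: ord3P.
Qed.

Lemma unipotent_diagonal (V W : K) : V != 0 ->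
  (forall x, let M := \matrix_(i, j) ev (u i j) x in
    let N := mx3 [:: [:: 1; V; W]; [:: 0; 1; V]; [:: 0; 0; 1]] in N *m M = M *m N) ->
  diagonal u.
Proof.
move=> V0 com.
have E x i j : _ := congr1 (fun M : 'M_3 => M i j) (com x).
have u20 : u i2 i0 = 0.
  apply: hdualP => x; have := E x i1 i0; rewrite !mxE !sum3 !mxE /= !ev0 => e.
  by apply: eq_lincomb e; instantiate (1 := V^-1); field; exact: V0.
have u10 : u i1 i0 = 0.
  apply: hdualP => x; have := E x i0 i0; rewrite !mxE !sum3 !mxE /= u20 !ev0 => e.
  by apply: eq_lincomb e; instantiate (1 := V^-1); field; exact: V0.
have u21 : u i2 i1 = 0.
  apply: hdualP => x; have := E x i1 i1; rewrite !mxE !sum3 !mxE /= u10 !ev0 => e.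
  by apply: eq_lincomb e; instantiate (1 := V^-1); field; exact: V0.
have u11 : u i1 i1 = u i0 i0.
  apply: hdualP => x; have := E x i0 i1; rewrite !mxE !sum3 !mxE /= u21 !ev0 => e.
  by apply: eq_lincomb e; instantiate (1 := V^-1); field; exact: V0.
have u22 : u i2 i2 = u i1 i1.
  apply: hdualP => x; have := E x i1 i2; rewrite !mxE !sum3 !mxE /= u10 !ev0 => e.
  by apply: eq_lincomb e; instantiate (1 := V^-1); field; exact: V0.
have g0 : character (u i0 i0).
  split=> [|x y]; first by rewrite uc.1.
  by rewrite uc.2 sum3 u10 u20 !ev0 !mulr0 !addr0.
have u01 : u i0 i1 = 0.
  apply: (skew_primitive_eq0 char0 g0) => x y.
  by rewrite uc.2 sum3 u11 u21 ev0 mulr0 addr0.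
have u12 : u i1 i2 = 0.
  apply: hdualP => x; have := E x i0 i2; rewrite !mxE !sum3 !mxE /= u01 u22 u11 !ev0 => e.
  by apply: eq_lincomb e; instantiate (1 := V^-1); field; exact: V0.
(* The corner becomes skew-primitive only now: its coproduct contains [u i0 i1] times [u i1 i2],
   which had to vanish first. *)
have u02 : u i0 i2 = 0.
  apply: (skew_primitive_eq0 char0 g0) => x y.
  by rewrite uc.2 sum3 u01 u22 u11 !ev0 mul0r addr0.
by apply: ord3P; apply: ord3P.
Qed.

End JordanBlocks.

Section QuadraticGroupAlgebra.
Variables (k : closedFieldType) (char0 : [pchar k] =i pred0).
Variables (rels : seq (free_algebra k 3)).
Variables (A : algType k) (t : 'I_3 -> A) (presA : presented_by t rels).
Variables (H : fdHopfType k) (act : H -> A -> A).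
Hypotheses (actA : module_algebra act) (faithful : inner_faithful act).
Hypothesis graded : preserves_grading act t.

Lemma quadratic_group_algebra (a b c d d' e f g i i' : k) (mu : 'M[k]_3) (sc : 'I_3 -> k) :
  a != 0 -> c != 0 -> e != 0 -> (forall j, sc j != 0) ->
  rels = [seq \sum_s (sc j * qrel a b c d d' e f g i i' j s) *: word k (pair_word s)
         | j <- enum 'I_3] ->
  (forall l m n', let w := superpotential_of (qrel a b c d d' e f g i i')
                            (qC a b c d d' e g i i') in
     w l (m, n') = \sum_r mu n' r * w r (l, m)) ->
  (forall (u : 'I_3 -> 'I_3 -> hdual H) m, corep u -> (0 < m)%N ->
     (forall x, let M := \matrix_(i, j) ev (u i j) x in
        (iter m (mulmx mu) 1%:M) *m M = M *m (iter m (mulmx mu) 1%:M)) ->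
     diagonal u) ->
  commutative_group_algebra H.
Proof.
move=> a0 c0 e0 sc0 relsE cyc diag.
have [|u [uc ua [m m0 um] uC]] := quadratic_rigidity presA actA graded a0 c0 e0 sc0 relsE (mu := mu).
  by case=> l [m n']; exact: cyc.
have du := diag u m uc m0 um.
exact: (diagonal_group_algebra char0 presA actA faithful uc ua du (uC du)).
Qed.

End QuadraticGroupAlgebra.

Lemma distinct3 (T : eqType) (x : 'I_3 -> T) :
  x (@Ordinal 3 0 isT) != x (@Ordinal 3 1 isT) ->
  x (@Ordinal 3 2 isT) != x (@Ordinal 3 0 isT) ->
  x (@Ordinal 3 1 isT) != x (@Ordinal 3 2 isT) -> forall i j, i != j -> x i != x j.
Proof. by move=> n01 n20 n12; do 2!apply: ord3P; move=> // _; rewrite eq_sym. Qed.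

Definition wcoefE := (wcoefB, wcoefD, wcoefZ, wcoef_word).

Lemma wcoef_trinomial (K : fieldType) n (c c' : K) (w w' w'' s : seq 'I_n) :
  wcoef (word K w - c *: word K w' - c' *: word K w'') s =
  (w == s)%:R - c * (w' == s)%:R - c' * (w'' == s)%:R.
Proof. by rewrite 2!wcoefB (wcoefZ c) (wcoefZ c') !wcoef_word. Qed.

Ltac compare_quadratic_coefficients := apply: wcoefP => s;
  rewrite wcoef_sum sum33 !sum3 !(expr2, mulrDl, scalerDr, fgenE, wordM, wcoefE) /qrel /pair_word /=; ring.

Ltac check_cyclic := do 3!apply: ord3P;
  rewrite /superpotential_of !sum3 !mxE /qrel /= ?mulr1n ?mulr0n; field; rewrite ?oner_neq0.

Theorem theorem0p4 (k : closedFieldType) (char0 : [pchar k] =i pred0)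
    (n : nat) (rels : seq (free_algebra k n)) (listed : listed_relations rels)
    (A : algType k) (t : 'I_n -> A) (presA : presented_by t rels)
    (H : fdHopfType k) (act : H -> A -> A)
    (actA : module_algebra act)
    (faithful : inner_faithful act)
    (graded : preserves_grading act t) :
  commutative_group_algebra H.
Proof.
have nat0 m : (0 < m)%N -> m%:R != 0 :> k by rewrite (pcharf0P k).1 // lt0n.
move: t presA graded; case: n rels / listed.
- move=> p12 p13 p23 p31 h12 h13 h23 r1 r2 r3 t presA graded.
  (* The factor gained by each letter when it moves from one end of $w$ to the other. The three
     quotients of these entries, taken cyclically, are the scalars assumed not to be roots of
     unity. *)
  pose d : 'rV[k]_3 := \row_i nth 0 [:: (p12 * p13)^-1; p12 / p23; p13 * p23] i.
  apply: (@quadratic_group_algebra k char0 _ A t presA H act actA faithful graded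
    p12 0 p13 0 0 p23 0 0 0 0 (diag_mx d) (fun=> 1) h12 h13 h23) => [_|||].
  + exact: oner_neq0.
  + by rewrite enum3; congr [:: _; _; _]; compare_quadratic_coefficients.
  + by check_cyclic; rewrite ?h12 ?h13 ?h23.
  + move=> u m uc m0; apply: diagonal_of_commuting.
    apply: (distinct3 (x := fun i => d 0 i ^+ m)); rewrite !mxE /=.
    * apply: (not_root_of_unity (j := 1) r1) => //; first by rewrite mulf_neq0 ?invr_eq0.
      by rewrite /p31; field; rewrite ?oner_neq0 ?h12 ?h13 ?h23.
    * apply: (not_root_of_unity (j := 1) r2) => //; first by rewrite invr_eq0 mulf_neq0.
      by rewrite /p31; field; rewrite ?oner_neq0 ?h12 ?h13 ?h23.
    * apply: (not_root_of_unity (j := 1) r3) => //; first by rewrite mulf_neq0.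
      by rewrite /p31; field; rewrite ?oner_neq0 ?h12 ?h13 ?h23.
- move=> p p0 r t presA graded.
  pose d : 'rV[k]_3 := \row_i nth 0 [:: 1; p^-1; p] i.
  (* The two commutators are listed with the sign opposite to that of [qrel], hence the factors
     $-1$. *)
  apply: (@quadratic_group_algebra k char0 _ A t presA H act actA faithful graded
    1 0 1 0 0 p (-1) 0 0 0 (diag_mx d) (fun j => nth 0 [:: -1; -1; 1] j)
    (oner_neq0 k) (oner_neq0 k) p0) => [|||].
  + by apply: ord3P; rewrite /= ?oppr_eq0 oner_neq0.
  + by rewrite enum3; congr [:: _; _; _]; compare_quadratic_coefficients.
  + by check_cyclic; rewrite ?p0.
  + move=> u m uc m0; apply: diagonal_of_commuting.
    apply: (distinct3 (x := fun i => d 0 i ^+ m)); rewrite !mxE /=.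
    * by apply: (not_root_of_unity (j := 1) r) => //; [rewrite invr_eq0 | field; rewrite ?oner_neq0 ?p0].
    * by apply: (not_root_of_unity (j := 1) r) => //; [exact: oner_neq0 | field; rewrite ?oner_neq0 ?p0].
    * rewrite eq_sym; apply: (not_root_of_unity (j := 2) r) => //; first by rewrite invr_eq0.
      by field; rewrite ?oner_neq0 ?p0.
- move=> q q0 r t presA graded.
  (* The matrix is read off the cyclic identity for $w$: a Jordan block for $q^{-1}$ on $t_1, t_2$
     and the eigenvalue $q^2$ on $t_3$. The exponent 3 below is the quotient $q^2 / q^{-1} =
     q^3$. *)
  apply: (@quadratic_group_algebra k char0 _ A t presA H act actA faithful graded
    1 1 q 0 0 q 0 (- q) 0 0 (mx3 [:: [:: q^-1; - 3%:R / q; 0]; [:: 0; q^-1; 0]; [:: 0; 0; q ^+ 2]])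
    (fun=> 1) (oner_neq0 k) q0 q0) => [_|||].
  + exact: oner_neq0.
  + by rewrite enum3; congr [:: _; _; _]; compare_quadratic_coefficients.
  + by check_cyclic; rewrite ?q0.
  + move=> u m uc m0 um; apply: (jordan_diagonal char0 uc (X := q^-1 ^+ m)
      (V := m%:R * (- 3%:R / q / q^-1) * q^-1 ^+ m) (Z := (q ^+ 2) ^+ m)) => [||x].
    * by rewrite !mulf_neq0 ?expf_neq0 ?invr_eq0 ?oppr_eq0 ?nat0.
    * rewrite eq_sym; apply: (not_root_of_unity (j := 3) r) => //; first by rewrite invr_eq0.
      by field; rewrite ?oner_neq0 ?q0.
    * by rewrite -iter_jordan ?invr_eq0 //; exact: um.
- move=> p p0 r t presA graded.
  apply: (@quadratic_group_algebra k char0 _ A t presA H act actA faithful graded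
    1 1 p 0 0 p 0 0 0 0 (mx3 [:: [:: p^-1; - 2%:R / p; 0]; [:: 0; p^-1; 0]; [:: 0; 0; p ^+ 2]])
    (fun=> 1) (oner_neq0 k) p0 p0) => [_|||].
  + exact: oner_neq0.
  + by rewrite enum3; congr [:: _; _; _]; compare_quadratic_coefficients.
  + by check_cyclic; rewrite ?p0.
  + move=> u m uc m0 um; apply: (jordan_diagonal char0 uc (X := p^-1 ^+ m)
      (V := m%:R * (- 2%:R / p / p^-1) * p^-1 ^+ m) (Z := (p ^+ 2) ^+ m)) => [||x].
    * by rewrite !mulf_neq0 ?expf_neq0 ?invr_eq0 ?oppr_eq0 ?nat0.
    * rewrite eq_sym; apply: (not_root_of_unity (j := 3) r) => //; first by rewrite invr_eq0.
      by field; rewrite ?oner_neq0 ?p0.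
    * by rewrite -iter_jordan ?invr_eq0 //; exact: um.
- move=> t presA graded.
  (* Here the matrix is one unipotent block, so only its nilpotent part can force [u] to be
     diagonal. *)
  apply: (@quadratic_group_algebra k char0 _ A t presA H act actA faithful graded
    1 1 1 1 1 1 0 (- 1) 1 1 (mx3 [:: [:: 1; - 3%:R; 3%:R]; [:: 0; 1; - 3%:R]; [:: 0; 0; 1]])
    (fun=> 1) (oner_neq0 k) (oner_neq0 k) (oner_neq0 k)) => [_|||].
  + exact: oner_neq0.
  + by rewrite enum3; congr [:: _; _; _]; compare_quadratic_coefficients.
  + by check_cyclic.
  + move=> u m uc m0 um; have [w wE] := iter_unipotent (- 3%:R : k) 3%:R m.
    apply: (unipotent_diagonal char0 uc (V := m%:R * - 3%:R) (W := w)) => [|x].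
      by rewrite mulf_neq0 ?oppr_eq0 ?nat0.
    by rewrite -wE; exact: um.
- move=> a b a0 b0 r t presA graded.
  have [|u [uc ua [m m0 um] uC]] := down_up_rigidity b0 presA actA graded a0.
    rewrite enum2; congr [:: _; _]; apply: wcoefP => s;
      by rewrite wcoef_sum sum222 !sum2 !expr2 !fgenE !wordM
        wcoef_trinomial !wcoef_word /drel /triple_word /=; ring.
  have du : diagonal u.
    apply: diagonal_of_commuting um.
    (* The eigenvalues $-b$ and $-b^{-1}$ have quotient $b^2$. *)
    have ne : dmu b 0 (@Ordinal 2 0 isT) ^+ m != dmu b 0 (@Ordinal 2 1 isT) ^+ m.
      rewrite !mxE /=; apply: (not_root_of_unity (j := 2) r) => //.
        by rewrite oppr_eq0 invr_eq0.
      by field; rewrite ?oppr_eq0 ?oner_neq0 ?b0.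
    by do 2!apply: ord2P; move=> // _; rewrite eq_sym.
  exact: (diagonal_group_algebra char0 presA actA faithful uc ua du (uC du)).
Qed.
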